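(* Let $C\subset\mathbb{R}^{n+1}$ ($n\ge 1$) be a cylindrically bounded convex body, $C_\infty=K\times\mathbb{R}$ its asymptotic cylinder and $C_\infty^+=K\times[0,\infty)$. Let $\{E_i\}_{i\in\mathbb{N}}$ be a sequence of isoperimetric regions in $C$ with $\lim_{i\to\infty}|E_i|=\infty$. Then truncated downward translations of $E_i$ converge in Hausdorff distance to a half-slab $K\times[0,b]$ in $C_\infty^+$, and the same convergence result holds for their free boundaries. That is, there exist $b>0$ and vertical vectors $y_i=t_i e_{n+1}$ with $t_i\to+\infty$ such that the sets $\Omega_i=(-y_i+E_i)\cap\{x_{n+1}\ge 0\}$ (for $i$ large) converge in Hausdorff distance to $K\times[0,b]$, and the free boundaries $\operatorname{cl}(\partial\Omega_i\cap\operatorname{int}(C_i))$, where $C_i=(-y_i+C)\cap\{x_{n+1}\ge 0\}$, converge in Hausdorff distance to $K\times\{b\}$.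
   Context: A closed unbounded convex set $C\subset\mathbb{R}^{n+1}$ with non-empty interior is a cylindrically bounded convex body if its orthogonal projection onto some hyperplane is bounded and $C$ is not itself a cylinder (i.e. it contains no complete line). Coordinates $(x_1,\dots,x_{n+1})$ in $\mathbb{R}^{n+1}=\mathbb{R}^n\times\mathbb{R}$ are chosen so that this hyperplane is $\{x_{n+1}=0\}$ and $C$ is unbounded in the positive $x_{n+1}$-direction (called vertical); $e_{n+1}=(0,\dots,0,1)$. Let $K\subset\mathbb{R}^n$ be the closure of the orthogonal projection of $C$ to $\mathbb{R}^n\times\{0\}\equiv\mathbb{R}^n$; the asymptotic cylinder of $C$ is $C_\infty=K\times\mathbb{R}$. For measurable $E\subset C$, $|E|$ denotes the $(n+1)$-dimensional Hausdorff (Lebesgue) measure, called volume. The relative perimeter of $E$ in the interior of $C$ is $P_C(E)=\sup\{\int_E \operatorname{div}\xi\, dH^{n+1} : \xi \text{ smooth vector field with compact support in } \operatorname{int}(C),\ |\xi|\le 1\}$. The isoperimetric profile is $I_C(v)=\inf\{P_C(E): E\subset C,\ |E|=v\}$, and $E\subset C$ is an isoperimetric region if $P_C(E)=I_C(|E|)$. An isoperimetric region is always represented by a closed set that includes its points of density one and contains no points of density zero. *)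

(* Defs.v *)
From HB Require Import structures.
From mathcomp Require Import all_boot all_order all_algebra.
From mathcomp Require Import all_classical all_reals all_analysis.

Set Implicit Arguments.
Unset Strict Implicit.
Unset Printing Implicit Defensive.

Import Order.TTheory GRing.Theory Num.Theory.
Import numFieldNormedType.Exports.

Local Open Scope classical_set_scope.
Local Open Scope ring_scope.

(* R^{n+1} is 'rV[R]_n.+1 and the vertical coordinate x_{n+1} is the entry of
   index ord_max.  The topology of 'rV[R]_n.+1 is the usual one, but the norm
   `|x| of the library is the sup norm, hence the Euclidean norm below. *)

Section euclidean.
Context {R : realType}.

Definition dot {n} (x y : 'rV[R]_n) : R := \sum_i x 0 i * y 0 i.

Definition enorm {n} (x : 'rV[R]_n) : R := Num.sqrt (dot x x).

Definition eball {n} (x : 'rV[R]_n) (r : R) : set 'rV[R]_n :=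
  [set y | enorm (y - x) < r].

End euclidean.

(* The outer measure below is the infimum of the total volume of the countable
   covers by boxes.  The Lebesgue measurable sets are its Caratheodory
   measurable sets, on which the library makes it a (complete) measure. *)

Section lebesgue_nd.
Context {R : realType} (n : nat).
Local Notation V := 'rV[R]_n.+1.

Definition box (c : V * V) : set V :=
  [set x | forall i, c.1 0 i < x 0 i <= c.2 0 i].

Definition box_volume (c : V * V) : R :=
  \prod_i Num.max 0 (c.2 0 i - c.1 0 i).

Definition box_cover (A : set V) : set (nat -> V * V) :=
  [set B | A `<=` \bigcup_k box (B k)].

Definition lebesgue_outer (A : set V) : \bar R :=
  ereal_inf [set (\sum_(k <oo) (box_volume (B k))%:E)%E | B in box_cover A].

Lemma box_volume_ge0 c : 0 <= box_volume c.
Proof. by apply: prodr_ge0 => i _; rewrite le_max lexx. Qed.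

Lemma lebesgue_outer_ge0 A : (0 <= lebesgue_outer A)%E.
Proof.
apply: le_ereal_inf_tmp => _ [B _ <-]; apply: nneseries_ge0 => k _ _.
by rewrite lee_fin box_volume_ge0.
Qed.

Lemma lebesgue_outer0 : lebesgue_outer set0 = 0%E.
Proof.
apply/eqP; rewrite eq_le lebesgue_outer_ge0 andbT.
apply: ereal_inf_lbound; exists (fun=> (0, 0)); first by move=> x.
rewrite eseries0// => k _ _; rewrite /box_volume (bigD1 ord0)//= subrr.
by rewrite maxxx mul0r.
Qed.

Lemma lebesgue_outer_le : {homo lebesgue_outer : A B / A `<=` B >-> (A <= B)%E}.
Proof.
move=> A B AB; apply: ereal_inf_le_tmp => _ [F BF <-]; exists F => //.
exact: subset_trans AB BF.
Qed.

Lemma lebesgue_outer_subadditive : sigma_subadditive lebesgue_outer.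
Proof.
move=> A; have [[i ioo]|] := pselect (exists i, lebesgue_outer (A i) = +oo%E).
  rewrite (eseries_pinfty _ _ ioo) ?leey// => k _.
  by rewrite -ltNye (lt_le_trans _ (lebesgue_outer_ge0 _)).
rewrite -forallNE => Aoo.
suff add2e (e : {posnum R}) : (lebesgue_outer (\bigcup_k A k) <=
    \sum_(i <oo) lebesgue_outer (A i) + e%:num%:E)%E.
  by apply/lee_addgt0Pr => _/posnumP[].
rewrite (le_trans _ (epsilon_trick _ _ _))//; last first.
  by move=> k; exact: lebesgue_outer_ge0.
pose P k (B : nat -> V * V) := box_cover (A k) B /\
  (\sum_(j <oo) (box_volume (B j))%:E <=
   lebesgue_outer (A k) + (e%:num / (2 ^ k.+1)%:R)%:E)%E.
have [G PG] : {G : nat -> nat -> V * V & forall k, P k (G k)}.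
  apply: (@choice _ _ P) => k; rewrite /P /lebesgue_outer.
  set S := (X in ereal_inf X); move infS : (ereal_inf S) => iS.
  case: iS infS => [r Sr|Soo|Soo].
  - have en1 : 0 < e%:num / (2 ^ k.+1)%:R by [].
    have /(lb_ereal_inf_adherent en1) : ereal_inf S \is a fin_num by rewrite Sr.
    move=> [x [B AB muBx] xS].
    by exists B; split => //; rewrite muBx -Sr; exact/ltW.
  - by have := Aoo k; rewrite /lebesgue_outer Soo.
  - by have := lebesgue_outer_ge0 (A k); rewrite /lebesgue_outer Soo.
pose m (p : nat * nat) := (box_volume (G p.1 p.2))%:E.
have m_ge0 p : (0 <= m p)%E by rewrite lee_fin box_volume_ge0.
apply: (@le_trans _ _ (\esum_(p in setT) m p)%E).
  apply: ereal_inf_lbound => /=.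
  have /card_esym/ppcard_eqP[f] := card_nat2.
  exists (fun i => G (f i).1 (f i).2).
    move=> x [i _ Aix]; have [j _ Gijx] := (PG i).1 _ Aix.
    by exists (f^-1%FUN (i, j)) => //=; rewrite invK ?inE.
  rewrite nneseries_esumT; last by move=> k; rewrite lee_fin box_volume_ge0.
  by apply/esym; rewrite (reindex_esum setT setT f).
rewrite (_ : esum _ _ = \sum_(i <oo) \sum_(j <oo) m (i, j))%E; last first.
  rewrite (_ : [set: nat * nat] = setT `*`` (fun=> setT)); last first.
    by apply/seteqP; split => // -[].
  rewrite -(@esum_esum _ _ _ setT (fun=> setT) (fun i j => m (i, j)))//.
  rewrite nneseries_esumT; last first.
    by move=> i; apply: nneseries_ge0 => j _ _; exact: m_ge0.
  by apply: eq_esum => i _; rewrite nneseries_esumT.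
apply: lee_nneseries.
- by move=> i _ _; apply: nneseries_ge0 => j _ _; exact: m_ge0.
- by move=> i _; exact: (PG i).2.
Qed.

HB.instance Definition _ := isOuterMeasure.Build R V lebesgue_outer
  lebesgue_outer0 lebesgue_outer_ge0 lebesgue_outer_le
  lebesgue_outer_subadditive.

Definition lebesgue : set (caratheodory_type lebesgue_outer) -> \bar R :=
  lebesgue_outer.

HB.instance Definition _ := isMeasure.Build _ _ _ lebesgue
  lebesgue_outer0 lebesgue_outer_ge0
  (@caratheodory_measure_sigma_additive R V lebesgue_outer).

Definition lebesgue_measurable (E : set V) : Prop :=
  lebesgue_outer.-cara.-measurable E.

End lebesgue_nd.
Arguments lebesgue {R n}.

Section perimeter.
Context {R : realType} {n : nat}.
Local Notation V := 'rV[R]_n.+1.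

Definition pderiv (i : 'I_n.+1) (f : V -> R) : V -> R :=
  fun x => 'D_(delta_mx 0 i) f x.

(* C^oo: all the iterated partial derivatives exist and are continuous. *)
Definition smooth (f : V -> R) : Prop :=
  forall s : seq 'I_n.+1, let g := foldr pderiv f s in
    continuous g /\ forall x i, derivable g x (delta_mx 0 i).

Definition smooth_field (xi : V -> V) : Prop :=
  forall i, smooth (fun x => xi x 0 i).

Definition div (xi : V -> V) (x : V) : R :=
  \sum_i pderiv i (fun y => xi y 0 i) x.

Definition field_support (xi : V -> V) : set V := closure [set x | xi x != 0].

Definition admissible_field (C : set V) (xi : V -> V) : Prop :=
  [/\ smooth_field xi, compact (field_support xi),
      field_support xi `<=` C° & forall x, enorm (xi x) <= 1].

Definition perimeter (C E : set V) : \bar R :=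
  ereal_sup [set (\int[lebesgue]_(x in E) (div xi x)%:E)%E
            | xi in admissible_field C].

Definition isoperimetric_profile (C : set V) (v : R) : \bar R :=
  ereal_inf [set perimeter C E
            | E in [set E | [/\ lebesgue_measurable E, E `<=` C
                              & lebesgue E = v%:E]]].

Definition isoperimetric_region (C E : set V) : Prop :=
  [/\ lebesgue_measurable E, E `<=` C, lebesgue E \is a fin_num
    & perimeter C E = isoperimetric_profile C (fine (lebesgue E))].

Definition has_density (E : set V) (x : V) (d : R) : Prop :=
  fine (lebesgue (E `&` eball x r)) / fine (lebesgue (eball x r))
    @[r --> 0^'+] --> d.

(* The representative by which an isoperimetric region is always given. *)
Definition normalized (E : set V) : Prop :=
  [/\ closed E, [set x | has_density E x 1] `<=` E
    & E `&` [set x | has_density E x 0] = set0].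

End perimeter.

Section cylindrically_bounded.
Context {R : realType} {n : nat}.
Local Notation V := 'rV[R]_n.+1.

(* The orthogonal projection onto the hyperplane with unit normal u. *)
Definition hyperplane_proj (u x : V) : V := x - dot x u *: u.

Definition contains_line (C : set V) : Prop :=
  exists p v : V, v != 0 /\ forall s : R, C (p + s *: v).

Definition cylindrically_bounded_convex_body (C : set V) : Prop :=
  [/\ closed C, ~ bounded_set C, convex_set (C : set (convex_lmodType V)),
      C° !=set0
    & (exists u, enorm u = 1 /\ bounded_set (hyperplane_proj u @` C)) /\
      ~ contains_line C].

Definition vert (x : V) : R := x 0 ord_max.

Definition e_vert : V := delta_mx 0 ord_max.

Definition horiz (x : V) : 'rV[R]_n := \row_j x 0 (widen_ord (leqnSn n) j).

(* The choice of coordinates: the hyperplane is {x_{n+1} = 0} and C is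
   unbounded in the positive vertical direction. *)
Definition vertical_coordinates (C : set V) : Prop :=
  bounded_set (horiz @` C) /\ forall M : R, exists2 x, C x & M < vert x.

(* The set K x I, where I is a set of heights. *)
Definition cylinder (K : set 'rV[R]_n) (I : set R) : set V :=
  [set x | K (horiz x) /\ I (vert x)].

(* The base K of the asymptotic cylinder K x R. *)
Definition asymptotic_base (C : set V) : set 'rV[R]_n := closure (horiz @` C).

(* (- t e_{n+1} + A) \cap {x_{n+1} >= 0} *)
Definition truncated_translation (t : R) (A : set V) : set V :=
  [set - (t *: e_vert) + x | x in A] `&` [set x | 0 <= vert x].

Definition boundary (A : set V) : set V := closure A `\` A°.

Definition free_boundary (C A : set V) : set V :=
  closure (boundary A `&` C°).

Definition thickening (A : set V) (r : R) : set V :=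
  [set x | exists2 a, A a & enorm (x - a) <= r].

(* Extended-real valued: the distance to the empty set is +oo. *)
Definition hausdorff_dist (A B : set V) : \bar R :=
  ereal_inf [set r%:E | r in [set r : R |
    [/\ 0 <= r, A `<=` thickening B r & B `<=` thickening A r]]].

Definition hausdorff_cvg (A : nat -> set V) (B : set V) : Prop :=
  hausdorff_dist (A i) B @[i --> \oo] --> 0%E.

End cylindrically_bounded.

(* Main.v *)
From HB Require Import structures.
Require Import Defs.
From mathcomp Require Import all_boot all_order all_algebra.
From mathcomp Require Import all_classical all_reals all_analysis.
From mathcomp Require Import ring lra measurable_realfun.
Set Implicit Arguments.
Unset Strict Implicit.
Unset Printing Implicit Defensive.
Import Order.TTheory GRing.Theory Num.Theory.
Import numFieldNormedType.Exports.
Local Open Scope classical_set_scope.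
Local Open Scope ring_scope.

(* Let A be the supremum of the volumes of the slabs of C of unit height.
   Cutting C at a given height shows that an isoperimetric region has perimeter
   at most A, and translating downwards that the profile is nondecreasing.
   Cut C into cells of height one.  By the relative isoperimetric inequality in
   the cells, a region E of large volume and perimeter at most A nearly fills
   some cell, hence has a vertical test field of flux nearly A.  As perimeter is
   at most A, no field that can be combined with it has much flux: E is nearly
   invariant under horizontal translations and under downward ones.  So E is
   close in volume to the lower part of C of the same volume, cut at height h
   say.  Let m(s) be the volume of E above a height s > h.  Cutting E at s and
   restoring the volume by a homothety bounds the perimeter of E above s in terms
   of - m'(s) and m(s); the isoperimetric inequality turns this into
   m^(n/(n+1)) <= - c m', by which m vanishes just above h.  Filling C below s
   gives the same for the complement of E.  So E is pinched between two parts of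
   C cut at heights close to h, which gives both convergences.

   Perimeter is compared with volume through the test fields
   x |-> (int_0^1 g(x - t v) dt) v, whose divergence is g(x) - g(x - v): they
   measure the points that leave E under a translation by v. *)

(** * Lebesgue measure *)

(** The obstacle is that perimeter is only a supremum of fluxes: the regions come with no regularity
    and no boundary to slice, so each geometric fact is extracted from one explicit test field, with
    bounds uniform in [E]. A vertical field of flux at least A - 2 s^2 tolerates two additions. A
    downward field is added at full weight, since it cancels against the upward one and two values
    in [0, 1] differ by at most 1. A horizontal one is added with weights on the unit circle: a
    weight of order s costs the vertical flux only order s^2, so the horizontal flux is of order s.
    These two moves lead from any point of [E] high up to any hole lower down, so the product of the
    two volumes is small. One of them is then thinly spread over the cells, where perimeter pays for
    it, and the other total is equal to it. Above [h] the lost volume is restored by a homothety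
    because [C] is tall there: the top is raised enough by a ratio very close to 1, which hardly
    changes perimeter. Below [h] nothing has to be restored, as filling only adds volume and the
    profile is nondecreasing. *)

Section measure.
Context {R : realType} {n : nat}.
Local Notation V := 'rV[R]_n.+1.
Local Notation T := (caratheodory_type (@lebesgue_outer R n)).

Lemma lebesgue_outer_box (c : V * V) :
  (lebesgue_outer (box c) <= (box_volume c)%:E)%E.
Proof.
apply: ereal_inf_lbound; exists (fun k => if k == 0%N then c else (0, 0)).
  by move=> x cx; exists 0%N.
rewrite (nneseries_split 0 1) => [|k _]; last by rewrite lee_fin box_volume_ge0.
rewrite eseries0 => [|k]; first by rewrite adde0 add0n big_nat1.
rewrite add0n => /lt0n_neq0 /negbTE -> _.
by rewrite /box_volume (bigD1 ord0)//= subrr maxxx mul0r.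
Qed.

Definition upd (c : V) (i : 'I_n.+1) (a : R) : V :=
  \row_j (if j == i then a else c 0 j).

(** The side lengths in direction [i] add up even when the plane misses the box: the clamping at 0
    in [box_volume] then gives one of the halves volume 0. *)
Lemma box_volume_split (c : V * V) i a :
  box_volume (c.1, upd c.2 i (Num.min (c.2 0 i) a)) +
  box_volume (upd c.1 i (Num.max (c.1 0 i) a), c.2) = box_volume c.
Proof.
rewrite /box_volume (bigD1 i)//= [X in _ + X](bigD1 i)//= [RHS](bigD1 i)//=.
rewrite !mxE eqxx.
under eq_bigr => j ji do rewrite mxE (negbTE ji).
under [X in _ + _ * X = _]eq_bigr => j ji do rewrite mxE (negbTE ji).
rewrite -mulrDl; congr (_ * _).
by rewrite /Num.max /Num.min; do ![case: ifPn => //]; rewrite -?leNgt; lra.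
Qed.

(** Cutting each box of a cover along the plane yields covers of the two parts of [X] with the same
    total volume, which is Caratheodory's condition. *)
Lemma measurable_halfspace i a : lebesgue_measurable [set x : V | x 0 i <= a].
Proof.
apply: le_caratheodory_measurable => X.
apply: le_ereal_inf_tmp => _ [B XB <-].
pose B1 k := ((B k).1, upd (B k).2 i (Num.min ((B k).2 0 i) a)).
pose B2 k := (upd (B k).1 i (Num.max ((B k).1 0 i) a), (B k).2).
have -> : (\sum_(k <oo) (box_volume (B k))%:E =
   \sum_(k <oo) (box_volume (B1 k))%:E + \sum_(k <oo) (box_volume (B2 k))%:E)%E.
  rewrite -nneseriesD; try by move=> *; rewrite lee_fin box_volume_ge0.
  apply: eq_eseriesr => k _; rewrite -EFinD; congr (_%:E).
  by rewrite box_volume_split.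
apply: leeD; apply: ereal_inf_lbound.
  exists B1 => // x [/XB[k _ Bx] /= xa]; exists k => // j /=.
  by rewrite mxE; case: eqP => [->|_]//; have /andP[-> xc] := Bx i; rewrite le_min xc.
exists B2 => // x [/XB[k _ Bx] /= /negP]; rewrite -ltNge => xa; exists k => // j /=.
by rewrite mxE; case: eqP => [->|_]//; have /andP[xc ->] := Bx i; rewrite gt_max xc xa.
Qed.

Lemma measurable_coord i : measurable_fun setT ((fun x : V => x 0 i) : T -> R).
Proof.
move=> _; apply: (measurability _ (RGenOInfty.measurableE R)) => // _ [_ [a ->] <-].
rewrite setTI (_ : _ @^-1` _ = ~` [set x : V | x 0 i <= a]).
  exact/measurableC/measurable_halfspace.
by apply/seteqP; split => x /=; rewrite in_itv /= andbT ltNge => /negP.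
Qed.

Definition cube (q : V) (r : R) : set V := [set x | forall i, `|x 0 i - q 0 i| < r].

Definition ccube (q : V) (r : R) : set V := [set x | forall i, `|x 0 i - q 0 i| <= r].

Definition rcube (p : 'rV[rat]_n.+1 * rat) : set V :=
  cube (map_mx ratr p.1) (ratr p.2).

Lemma nbhs_cubeP (O : set V) x : nbhs x O <-> exists2 r, 0 < r & cube x r `<=` O.
Proof.
split=> [/nbhs_ballP[r /= r0 h]|[r r0 h]].
  exists r => // y yx; apply: h; split=> // i j.
  by rewrite ord1 /ball /= distrC; exact: yx.
apply/nbhs_ballP; exists r => //= y [_ xy]; apply: h => i.
by have := xy 0 i; rewrite /ball /= distrC.
Qed.

Lemma open_cube q r : open (cube q r).
Proof.
rewrite openE => x xq; apply/nbhs_cubeP.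
pose m := \big[Num.min/1]_i (r - `|x 0 i - q 0 i|).
have m0 : 0 < m by apply/bigmin_gtP; split=> // i _; rewrite subr_gt0.
exists m => // y yx i; have := yx i.
have mi : m <= r - `|x 0 i - q 0 i| by exact: bigmin_le.
move=> /lt_le_trans /(_ mi) h.
rewrite (_ : _ - _ = (y 0 i - x 0 i) + (x 0 i - q 0 i)); last by ring.
by rewrite (le_lt_trans (ler_normD _ _))// -ltrBrDr.
Qed.

(** The closed cubes, not only the open ones, are kept inside [O]: they later serve as compact
    supports of bump functions. *)
Lemma open_rcubes (O : set V) : open O ->
  O = \bigcup_(p in [set p | 0 < p.2 /\ ccube (map_mx ratr p.1) (ratr p.2) `<=` O]) rcube p.
Proof.
move=> oO; apply/seteqP; split; last first.
  by move=> x [p [_ pO] px]; apply: pO => i; exact/ltW.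
move=> x Ox; have /nbhs_cubeP[r r0 h] : nbhs x O by exact: open_nbhs_nbhs.
have [e] := @rat_in_itvoo R 0 (r / 2) ltac:(lra).
rewrite in_itv /= => /andP[e0 er].
have qP i : exists q : rat, `|x 0 i - ratr q| < ratr e.
  have [q] := @rat_in_itvoo R (x 0 i - ratr e) (x 0 i + ratr e) ltac:(lra).
  rewrite in_itv /= => /andP[q0 q1]; exists q.
  by rewrite ltr_norml; apply/andP; split; lra.
have [q Pq] := choice qP.
exists (\row_i q i, e) => /=; last by move=> i; rewrite !mxE.
split; first by rewrite -(ltr0q R).
move=> y yq; apply: h => i; have := yq i; have := Pq i; rewrite !mxE => h1 h2.
rewrite (_ : _ - _ = (y 0 i - ratr (q i)) - (x 0 i - ratr (q i))); last by ring.
rewrite (le_lt_trans (ler_normB _ _))//; lra.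
Qed.

(** Measurability into [V] is tested on coordinates, through the countable base of rational cubes.
    This will be applied to the sum of two vectors, defined on a product. *)
Lemma preimage_open_measurable d (X : measurableType d) (f : X -> V) (O : set V) :
  (forall i, measurable_fun setT (fun x => f x 0 i)) -> open O ->
  measurable (f @^-1` O).
Proof.
move=> mf oO; rewrite (open_rcubes oO) preimage_bigcup.
rewrite bigcup_mkcond; apply: countable_bigcupT_measurable => [|p].
  exact: (@countableP ('rV[rat]_n.+1 * rat)%type).
case: ifP => // _.
rewrite (_ : _ @^-1` _ = \bigcap_(i in [set: 'I_n.+1])
   ((fun x => f x 0 i) @^-1` `](ratr (p.1 0 i) - ratr p.2), (ratr (p.1 0 i) + ratr p.2)[)).
  apply: fin_bigcap_measurable => // i _; rewrite -[X in measurable X]setTI.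
  exact: mf.
apply/seteqP; split => x /= h i /=.
  move=> _; have := h i; rewrite mxE in_itv/= ltr_norml => /andP[h1 h2].
  by apply/andP; split; lra.
have := h i I; rewrite /= mxE in_itv/= ltr_norml => /andP[h1 h2].
by apply/andP; split; lra.
Qed.

(** The preimage of a set under the sum of two vectors is measurable for the product sigma-algebra
    when the set is Borel, but not for every Lebesgue measurable set; regions are therefore replaced
    by Borel hulls before double counting. *)
Definition borel : set (set V) := <<s open >>.

Lemma preimage_borel_measurable d (X : measurableType d) (f : X -> V) (B : set V) :
  (forall i, measurable_fun setT (fun x => f x 0 i)) -> borel B ->
  measurable (f @^-1` B).
Proof.
move=> mf; move: B.
have sX : sigma_algebra setT (image_set_system setT f (measurable : set (set X))).
  apply: sigma_algebra_image; split=> [|A mA|F mF].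
  - exact: measurable0.
  - by rewrite setTD; exact: measurableC.
  - exact: bigcupT_measurable.
have := smallest_sub sX; rewrite /borel => h.
have {}h : <<s open >> `<=` image_set_system setT f (measurable : set (set X)).
  by apply: h => O oO; rewrite /image_set_system /= setTI; exact: preimage_open_measurable.
by move=> B /h; rewrite /image_set_system /= setTI.
Qed.

Lemma borel_measurable (B : set V) : borel B -> lebesgue_measurable B.
Proof.
move=> bB; have := @preimage_borel_measurable _ T (fun x : V => x) B _ bB.
by apply=> i; exact: measurable_coord.
Qed.

Lemma open_lebesgue_measurable (O : set V) : open O -> lebesgue_measurable O.
Proof. by move=> oO; apply: borel_measurable; apply: sub_sigma_algebra. Qed.

Lemma closed_lebesgue_measurable (F : set V) : closed F -> lebesgue_measurable F.
Proof.
move=> cF; rewrite -[F]setCK; apply: measurableC; apply: open_lebesgue_measurable.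
by rewrite openC.
Qed.

Lemma continuous_measurable (f : V -> R) : continuous f ->
  measurable_fun setT (f : T -> R).
Proof.
move=> cf _; apply: (measurability _ (RGenOpens.measurableE R)) => // _ [_ [a [b ->]] <-].
rewrite setTI; apply: open_lebesgue_measurable; apply: open_comp; last exact: interval_open.
by move=> x _; exact: cf.
Qed.
End measure.

Section measure2.
Context {R : realType} {n : nat}.
Local Notation V := 'rV[R]_n.+1.
Local Notation lm := (@lebesgue R n).

(** Translations are the case [mu = 1]; the homothety of centre [p] is [aff ((1 - mu) *: p) mu]. *)
Definition aff (c : V) (mu : R) (x : V) : V := c + mu *: x.

Lemma affK c mu : 0 < mu -> cancel (aff c mu) (aff (- (mu^-1 *: c)) mu^-1).
Proof.
move=> m0 x; rewrite /aff scalerDr addrA addNr add0r scalerA mulVf ?scale1r//.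
exact: lt0r_neq0.
Qed.

Lemma affVK c mu : 0 < mu -> cancel (aff (- (mu^-1 *: c)) mu^-1) (aff c mu).
Proof.
move=> m0 x; rewrite /aff scalerDr scalerN !scalerA mulfV ?lt0r_neq0//.
by rewrite !scale1r addrA subrr add0r.
Qed.

Lemma aff_image c mu (A : set V) : 0 < mu ->
  aff c mu @` A = aff (- (mu^-1 *: c)) mu^-1 @^-1` A.
Proof.
move=> m0; apply/seteqP; split => [_ [x Ax <-]|x Ax] /=; first by rewrite affK.
by exists (aff (- (mu^-1 *: c)) mu^-1 x) => //; rewrite affVK.
Qed.

Lemma aff_preimage c mu (A : set V) : 0 < mu ->
  aff c mu @^-1` A = aff (- (mu^-1 *: c)) mu^-1 @` A.
Proof.
move=> m0; rewrite aff_image ?invr_gt0//; rewrite (_ : aff (- _) _ = aff c mu)//.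
by apply/funext => x; rewrite /aff invrK scalerN opprK scalerA mulfV ?lt0r_neq0// scale1r.
Qed.

Let lebesgue_outer_aff_le c mu (A : set V) : 0 < mu ->
  (lebesgue_outer (aff c mu @` A) <= (mu ^+ n.+1)%:E * lebesgue_outer A)%E.
Proof.
move=> m0; rewrite -lee_pdivrMl ?exprn_gt0//.
apply: le_ereal_inf_tmp => _ [B XB <-].
rewrite lee_pdivrMl ?exprn_gt0//.
apply: ereal_inf_lbound; exists (fun k => (aff c mu (B k).1, aff c mu (B k).2)).
  move=> _ [x Ax <-]; have [k _ Bx] := XB x Ax; exists k => // i /=.
  by rewrite !mxE; have /andP[h1 h2] := Bx i; rewrite ltrD2l ltr_pM2l// h1 lerD2l ler_pM2l.
rewrite -nneseriesZl; last by move=> *; rewrite lee_fin box_volume_ge0.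
apply: eq_eseriesr => k _; rewrite -EFinM; congr (_%:E).
have -> : mu ^+ n.+1 = \prod_(i < n.+1) mu by rewrite prodr_const card_ord.
rewrite /box_volume -big_split/=.
apply: eq_bigr => i _; rewrite !mxE maxr_pMr ?ltW// mulr0; congr (Num.max _ _).
by ring.
Qed.

(** Boxes are mapped to boxes, which gives one inequality; the other is the same inequality for the
    inverse map. *)
Lemma lebesgue_aff c mu (A : set V) : 0 < mu ->
  lebesgue_outer (aff c mu @` A) = ((mu ^+ n.+1)%:E * lebesgue_outer A)%E.
Proof.
move=> m0; apply/eqP; rewrite eq_le lebesgue_outer_aff_le//=.
have := @lebesgue_outer_aff_le (- (mu^-1 *: c)) mu^-1 (aff c mu @` A).
rewrite invr_gt0 image_comp => /(_ m0).
rewrite (_ : (_ \o _) @` A = A); last first.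
  rewrite (_ : _ \o _ = id) ?image_id//.
  by apply/funext => x /=; rewrite affK.
by rewrite exprVn lee_pdivlMl ?exprn_gt0.
Qed.

Lemma measurable_aff c mu (A : set V) : 0 < mu -> lebesgue_measurable A ->
  lebesgue_measurable (aff c mu @` A).
Proof.
move=> m0 mA; change (caratheodory_measurable (@lebesgue_outer R n) (aff c mu @` A)).
have {}mA : caratheodory_measurable (@lebesgue_outer R n) A := mA.
move=> X; set f := aff _ _.
have e : X = f @` (f @^-1` X).
  by rewrite aff_preimage// image_comp (_ : _ \o _ = id) ?image_id//; apply/funext => x; rewrite /f /= affVK.
have e1 (B : set V) : X `&` f @` B = f @` ((f @^-1` X) `&` B).
  apply/seteqP; split => [y [Xy [x Bx fx]]|_ [x [Xx Bx] <-]].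
    by exists x => //; split => //=; rewrite fx.
  by split => //; exists x.
have e2 (B : set V) : ~` (f @` B) = f @` (~` B).
  by rewrite aff_image// preimage_setC -aff_image.
rewrite e2 !e1 !lebesgue_aff// -ge0_muleDr; try exact: lebesgue_outer_ge0.
by rewrite -mA [in LHS]e lebesgue_aff.
Qed.

Lemma coord_le_norm (x : V) i : `|x 0 i| <= `|x|.
Proof. by rewrite [leRHS]mx_normrE; apply/bigmax_geP; right => /=; exists (0, i). Qed.

Lemma norm_le_coord (x : V) M : 0 <= M -> (forall i, `|x 0 i| <= M) -> `|x| <= M.
Proof.
move=> M0 h; rewrite [leLHS]mx_normrE; apply/bigmax_leP; split=> // -[i j] _ /=.
by rewrite ord1.
Qed.

Lemma lebesgue_bounded (A : set V) : bounded_set A -> (lebesgue_outer A < +oo)%E.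
Proof.
move=> [M [_ /(_ (M + 1))]]; rewrite ltrDl ltr01 => /(_ isT) h.
have AB : A `<=` box (const_mx (- (M + 2)), const_mx (M + 2)).
  move=> x /h xM i; rewrite !mxE.
  have : `|x 0 i| <= `|x| by exact: coord_le_norm.
  by move=> /le_trans /(_ xM); rewrite ler_norml; lra.
by rewrite (le_lt_trans (lebesgue_outer_le AB))// (le_lt_trans (lebesgue_outer_box _))// ltey.
Qed.

Lemma cvg_prod_seq (J I : Type) (s : seq I) (F : I -> J -> R) (l : I -> R)
  (G : set_system J) {FG : Filter G} :
  (forall i, F i r @[r --> G] --> l i) ->
  (\prod_(i <- s) F i r) @[r --> G] --> \prod_(i <- s) l i.
Proof.
move=> h; elim: s => [|i s ih].
  by rewrite big_nil; under eq_fun do rewrite big_nil; exact: cvg_cst.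
by rewrite big_cons; under eq_fun do rewrite big_cons; exact: cvgM.
Qed.

Definition obox (c : V * V) : set V := [set x | forall i, c.1 0 i < x 0 i < c.2 0 i].

Lemma open_obox c : open (obox c).
Proof.
rewrite openE => x xc; apply/nbhs_cubeP.
pose m := \big[Num.min/1]_i (Num.min (x 0 i - c.1 0 i) (c.2 0 i - x 0 i)).
exists m.
  apply/bigmin_gtP; split=> // i _; have /andP[? ?] := xc i.
  by rewrite lt_min !subr_gt0; apply/andP.
move=> y yx i; have := yx i.
have mi : m <= Num.min (x 0 i - c.1 0 i) (c.2 0 i - x 0 i) by exact: bigmin_le.
move=> /lt_le_trans /(_ mi); rewrite lt_min !ltr_norml => /andP[/andP[h1 h2] /andP[h3 h4]].
by apply/andP; split; lra.
Qed.

(** Moving the upper corner is enough, because boxes are already open on the lower side. *)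
Lemma box_enlarge (c : V * V) (e : R) : 0 < e ->
  exists c' : V * V, [/\ box c `<=` obox c', obox c' `<=` box c'
    & box_volume c' <= box_volume c + e].
Proof.
move=> e0.
have : (fun r : R => box_volume (c.1, c.2 + const_mx r)) @ 0^'+ --> box_volume c.
  apply: cvg_prod_seq => i.
  have mE (z : R) : Num.max 0 z = (z + `|z|) / 2.
    by case: (lerP 0 z) => z0; [rewrite ger0_norm//|rewrite ltr0_norm//]; lra.
  rewrite mE; under eq_fun do rewrite !mxE /= mE.
  have h : (c.2 0 i + r - c.1 0 i) @[r --> (0:R)^'+] --> c.2 0 i - c.1 0 i.
    rewrite -{2}(addr0 (c.2 0 i)); apply: cvg_at_right_filter.
    by apply: cvgB; [apply: cvgD; [exact: cvg_cst|exact: cvg_id]|exact: cvg_cst].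
  by apply: cvgM; [apply: cvgD; [exact: h|exact: cvg_norm]|exact: cvg_cst].
move=> /cvgrPdist_le /(_ _ e0) h.
have [r [r0 hr]] : exists r, 0 < r /\
   `|box_volume c - box_volume (c.1, c.2 + const_mx r)| <= e.
  near (0 : R)^'+ => r; exists r; split; first by [].
  by near: r; exact: h.
exists (c.1, c.2 + const_mx r); split.
- by move=> x xc i; rewrite /= !mxE; have /andP[-> h2] := xc i; rewrite ltr_pwDr.
- by move=> x xc i; have /andP[-> /ltW] := xc i.
- move: hr; rewrite distrC ler_norml => /andP[_]; lra.
Unshelve. all: by end_near. Qed.

(** One half of [e] goes to the choice of the cover, the other to the enlargement of its boxes. *)
Lemma outer_open_cover (A : set V) (e : R) : (lebesgue_outer A < +oo)%E -> 0 < e ->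
  exists B : nat -> V * V, [/\ A `<=` \bigcup_k obox (B k),
    (\sum_(k <oo) (box_volume (B k))%:E <= lebesgue_outer A + e%:E)%E
   & (forall k, obox (B k) `<=` box (B k))].
Proof.
move=> Afin e0; have e20 : 0 < e / 2 by rewrite divr_gt0.
have fA : lebesgue_outer A \is a fin_num.
  by rewrite ge0_fin_numE// lebesgue_outer_ge0.
have [_ [B AB <-] hB] := lb_ereal_inf_adherent e20 fA.
have [B' hB'] := choice (fun k => box_enlarge (B k)
   (divr_gt0 e20 (exprn_gt0 k.+1 (ltr0Sn R 1)))).
exists B'; split; last by move=> k; case: (hB' k).
  by move=> x /AB[k _ xk]; exists k => //; case: (hB' k) => + _ _; exact.
apply: (@le_trans _ _ (\sum_(k <oo) ((box_volume (B k))%:E + (e / 2 / (2 ^ k.+1)%:R)%:E))%E).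
  apply: lee_nneseries => k; first by rewrite lee_fin box_volume_ge0.
  by case: (hB' k) => _ _; rewrite -EFinD lee_fin natrX.
apply: le_trans (epsilon_trick _ _ _) _.
- by move=> k; rewrite lee_fin box_volume_ge0.
- exact: ltW.
rewrite [leRHS](_ : _ = lebesgue_outer A + (e / 2)%:E + (e / 2)%:E)%E; last first.
  by rewrite -addeA -EFinD -splitr.
rewrite leeD2r//.
exact: ltW.
Qed.

Lemma outer_regular (A : set V) (e : R) : (lebesgue_outer A < +oo)%E -> 0 < e ->
  exists O : set V, [/\ open O, A `<=` O & (lebesgue_outer O <= lebesgue_outer A + e%:E)%E].
Proof.
move=> Afin /(outer_open_cover Afin)[B [AB hB oB]].
exists (\bigcup_k obox (B k)); split => //; first by apply: bigcup_open => k _; exact: open_obox.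
apply: le_trans hB; apply: ereal_inf_lbound; exists B => // x [k _ xk].
by exists k => //; exact: oB.
Qed.

Lemma lebesgueD0 (A B : set V) : lebesgue_measurable A -> lebesgue_measurable B ->
  A `<=` B -> (lm A < +oo)%E -> (lm B <= lm A)%E -> lm (B `\` A) = 0%E.
Proof.
move=> mA mB AB Afin BA; rewrite measureD//; last exact: le_lt_trans BA Afin.
have -> : B `&` A = A by apply/setIidPr.
have e : lm B = lm A.
  by apply/eqP; rewrite eq_le BA/=; apply: le_measure; rewrite ?inE.
change (lm B - lm A = 0)%E; rewrite e subee// ge0_fin_numE//.
Qed.

Lemma borel_approx (A : set V) : lebesgue_measurable A -> (lm A < +oo)%E ->
  exists B : set V, [/\ borel B, A `<=` B & lm (B `\` A) = 0%E].
Proof.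
move=> mA Afin.
have h (k : nat) : exists O : set V, [/\ open O, A `<=` O & (lm O <= lm A + (k.+1%:R^-1)%:E)%E].
  by apply: outer_regular => //; rewrite invr_gt0.
have [Q hO] := choice h.
have borQ : borel (\bigcap_k Q k).
  rewrite /borel; apply: (@bigcapT_measurable _ (g_sigma_algebraType (@open V))).
  by move=> k; apply: sub_sigma_algebra; case: (hO k).
have AQ : A `<=` \bigcap_k Q k by move=> x Ax k _; case: (hO k) => _ + _; exact.
exists (\bigcap_k Q k); split => //.
apply: lebesgueD0 => //; first exact: borel_measurable.
apply/lee_addgt0Pr => e e0.
have [k] := ltr_add_invr e0; rewrite add0r => ke.
case: (hO k) => oO _ hk.
apply: (@le_trans _ _ (lm (Q k))).
  apply: le_measure; rewrite ?inE; [exact: borel_measurable|exact: open_lebesgue_measurable|].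
  by move=> x; exact.
by apply: le_trans hk _; rewrite leeD2l// lee_fin ltW.
Qed.

End measure2.

(** * Positivity of the measure of open sets, and Tonelli's theorem *)

Section measure3.
Context {R : realType} {n : nat}.
Local Notation V := 'rV[R]_n.+1.
Local Notation T := (caratheodory_type (@lebesgue_outer R n)).
Local Notation lm := (@lebesgue R n).

Lemma cvg_sum_seq (J I : Type) (s : seq I) (F : I -> J -> R) (l : I -> R)
  (G : set_system J) {FG : Filter G} :
  (forall i, F i r @[r --> G] --> l i) ->
  (\sum_(i <- s) F i r) @[r --> G] --> \sum_(i <- s) l i.
Proof.
move=> h; elim: s => [|i s ih].
  by rewrite big_nil; under eq_fun do rewrite big_nil; exact: cvg_cst.
by rewrite big_cons; under eq_fun do rewrite big_cons; exact: cvgD.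
Qed.

Let card_grid (m : nat) (a b : R) : (0 < m)%N ->
  (#|[set j : 'I_m | a < j%:R / m%:R <= b]%SET|)%:R <= m%:R * Num.max 0 (b - a) + 1.
Proof.
move=> m0; have m0R : (0 : R) < m%:R by rewrite ltr0n.
set S := [set j : _ | _]%SET.
have [->|[j0' j0'S]] := set_0Vmem S.
  by rewrite cards0 addr_ge0// mulr_ge0// le_max lexx.
pose j0 := [arg min_(i < j0' in S) (i : nat)].
have [j0S j0min] : j0 \in S /\ forall j, j \in S -> (j0 <= j)%N.
  by rewrite /j0; case: arg_minnP.
pose j1 := [arg max_(i > j0' in S) (i : nat)].
have [j1S j1max] : j1 \in S /\ forall j, j \in S -> (j <= j1)%N.
  by rewrite /j1; case: arg_maxnP.
have : (#|S| <= (j1 - j0).+1)%N.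
  pose f (j : 'I_m) : 'I_(j1 - j0).+1 := inord (j - j0).
  rewrite -(@card_in_imset _ _ f); first by rewrite (leq_trans (max_card _))// card_ord.
  move=> x y xS yS /(congr1 val); rewrite /f /= !inordK ?ltnS ?leq_sub2r ?j1max//.
  move=> h; apply/val_inj => /=.
  by rewrite -(subnK (j0min _ xS)) h subnK ?j0min.
rewrite -(ler_nat R) => /le_trans; apply.
rewrite -natr1 lerD2r natrB ?j0min//.
move: j0S j1S; rewrite !inE => /andP[h1 _] /andP[_ h2].
have h3 : j1%:R / m%:R - j0%:R / m%:R <= b - a by rewrite lerB// ltW.
rewrite -ler_pdivrMl// mulrC mulrBl (le_trans h3)// le_max lexx orbT//.
Qed.

Let unit_cube : set V := [set x | forall i, `[0, 1]%classic (x 0 i)].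

(** All m^(n+1) points of a grid in the unit cube have to be counted by the boxes, and a box holds
    at most the product over its sides of m times the length plus 1. Dividing by m^(n+1) leaves
    volumes with an error 1/m per side. *)
Let grid_bound (M : nat) (B : nat -> V * V) (m : nat) : (0 < m)%N ->
  (forall x, unit_cube x -> exists2 k, (k < M)%N & box (B k) x) ->
  1 <= \sum_(k < M) \prod_(i < n.+1) (Num.max 0 ((B k).2 0 i - (B k).1 0 i) + m%:R^-1).
Proof.
move=> m0 cov; have m0R : (0 : R) < m%:R by rewrite ltr0n.
pose S (k : nat) (i : 'I_n.+1) := [set j : 'I_m | (B k).1 0 i < j%:R / m%:R <= (B k).2 0 i]%SET.
have h1 : (m%:R ^+ n.+1 : R) <= \sum_(k < M) \prod_(i < n.+1) (#|S k i|)%:R.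
  have -> : (m%:R ^+ n.+1 : R) = \sum_(f : {ffun 'I_n.+1 -> 'I_m}) 1.
    by rewrite sumr_const card_ffun !card_ord natrX.
  have -> : \sum_(k < M) \prod_(i < n.+1) (#|S k i|)%:R =
     \sum_(k < M) \sum_(f : {ffun 'I_n.+1 -> 'I_m}) (f \in family (S k))%:R :> R.
    apply: eq_bigr => k _.
    under eq_bigr => i _ do rewrite -sum1_card natr_sum.
    rewrite bigA_distr_big_dep/= big_mkcond/=.
    apply: eq_bigr => f _; rewrite prodr_const expr1n.
    by rewrite -[f \in _]/(f \in family (S k)); case: (f \in family (S k)).
  rewrite exchange_big/=; apply: ler_sum => f _.
  have [|k kM fk] := cov (\row_i ((f i)%:R / m%:R)).
    move=> i; rewrite /= mxE in_itv/= divr_ge0 ?ler0n//= ler_pdivrMr// mul1r ler_nat.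
    exact/ltnW.
  rewrite (bigD1 (Ordinal kM))//=.
  have -> : f \in family (S k).
    by apply/familyP => i; rewrite inE; have := fk i; rewrite mxE.
  by rewrite lerDl sumr_ge0.
have h2 : (m%:R ^+ n.+1 : R) <= \sum_(k < M) \prod_(i < n.+1)
   (m%:R * (Num.max 0 ((B k).2 0 i - (B k).1 0 i) + m%:R^-1)).
  apply: le_trans h1 _; apply: ler_sum => k _; apply: ler_prod => i _.
  by rewrite ler0n/= mulrDr mulfV ?gt_eqF// card_grid.
move: h2; under eq_bigr => k _ do rewrite big_split/= prodr_const card_ord.
by rewrite -mulr_sumr ler_pMr// exprn_gt0.
Qed.

(** Compactness makes the cover finite, and the count of grid points is then passed to the limit as
    the mesh tends to 0. The positivity of the volume of open sets rests on this bound. *)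
Lemma lebesgue_unit_cube : (1%:E <= lebesgue_outer unit_cube)%E.
Proof.
rewrite leNgt; apply/negP => lt1.
have fI : lebesgue_outer unit_cube \is a fin_num.
  by rewrite ge0_fin_numE ?lebesgue_outer_ge0// (lt_trans lt1)// ltey.
pose e := (1 - fine (lebesgue_outer unit_cube)) / 2.
have e0 : 0 < e.
  by rewrite /e divr_gt0// subr_gt0 -lte_fin fineK.
have [B [cov hB oB]] := outer_open_cover (lt_trans lt1 (ltey 1)) e0.
have cI : compact unit_cube by apply: (@rV_compact R n.+1 (fun=> `[0, 1]%classic)) => _; exact: segment_compact.
move: cI; rewrite compact_cover => /(_ nat setT (fun k => obox (B k))).
case; [by move=> k _; exact: open_obox|by []|].
move=> D _ covD.
pose M := (\max_(k <- finmap.enum_fset D) k).+1.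
have covM x : unit_cube x -> exists2 k, (k < M)%N & box (B k) x.
  move=> /covD[k /= kD xk]; exists k; last exact: oB.
  rewrite ltnS; have kD2 : k \in finmap.enum_fset D := kD.
  exact: (@leq_bigmax_seq _ _ xpredT id _ kD2 isT).
have lim1 : (fun m : nat => \sum_(k < M) \prod_(i < n.+1)
   (Num.max 0 ((B k).2 0 i - (B k).1 0 i) + m.+1%:R^-1)) @ \oo -->
   \sum_(k < M) box_volume (B k).
  apply: cvg_sum_seq => k; apply: cvg_prod_seq => i.
  rewrite -[X in _ --> X]addr0; apply: cvgD; first exact: cvg_cst.
  exact: cvg_harmonic.
have : 1 <= \sum_(k < M) box_volume (B k).
  rewrite -(cvg_lim (@Rhausdorff R) lim1); apply: limr_ge; first by apply/cvg_ex; eexists; exact: lim1.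
  by near=> m; exact: grid_bound.
rewrite -lee_fin -sumEFin => h.
have := @nneseries_lim_ge R (fun k => (box_volume (B k))%:E) xpredT 0 M.
rewrite big_mkord => h'.
have {h' h} := le_trans h (h' (fun k _ _ => _)).
move=> /(_ (fun k => box_volume_ge0 _)) /le_trans /(_ hB).
rewrite -(fineK fI) -EFinD lee_fin /e.
have := fineK fI; have : fine (lebesgue_outer unit_cube) < 1 by rewrite -lte_fin fineK.
lra.
Unshelve. all: by end_near. Qed.

Lemma cube_measure_gt0 (q : V) (r : R) : 0 < r -> (0 < lebesgue_outer (cube q r))%E.
Proof.
move=> r0; rewrite lt_neqAle lebesgue_outer_ge0 andbT; apply/negP => /eqP q0.
have := lebesgue_unit_cube; rewrite leNgt => /negP; apply.
have m0 : 0 < (r / 2)^-1 by rewrite invr_gt0; lra.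
apply: (@le_lt_trans _ _ (lebesgue_outer (aff (- ((r / 2)^-1 *: q)) (r / 2)^-1 @` cube q r))).
  apply: lebesgue_outer_le => x xI; rewrite aff_image// => i; rewrite !mxE !invrK.
  have := xI i; rewrite /= in_itv/= => /andP[h1 h2].
  rewrite (_ : _ - _ = r / 2 * x 0 i); last by field; rewrite gt_eqF.
  by rewrite ger0_norm ?mulr_ge0//; [nra|lra].
by rewrite lebesgue_aff// -q0 mule0 lte_fin.
Qed.

Lemma open_measure_gt0 (O : set V) : open O -> O !=set0 -> (0 < lebesgue_outer O)%E.
Proof.
move=> oO [x Ox]; have /nbhs_cubeP[r r0 h] : nbhs x O by exact: open_nbhs_nbhs.
exact: lt_le_trans (cube_measure_gt0 x r0) (lebesgue_outer_le h).
Qed.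

Lemma lebesgue_sigma_finite : sigma_finite setT lm.
Proof.
exists (fun k => ccube 0 k%:R) => [|k].
  apply/seteqP; split => // x _.
  have := archimedean.Num.Theory.truncnS_gt `|x|; set k := (Num.Def.truncn _).+1 => h.
  exists k => // i /=; rewrite mxE subr0.
  exact: le_trans (coord_le_norm _ _) (ltW h).
have b : bounded_set (ccube 0 k%:R : set V).
  exists k%:R; split => // M kM y hy /=; apply: norm_le_coord.
    exact: le_trans (ler0n _ k) (ltW kM).
  by move=> i; have := hy i; rewrite mxE subr0 => /le_trans; apply; exact: ltW.
split; last exact: lebesgue_bounded.
rewrite (_ : ccube _ _ = \bigcap_(i in [set: 'I_n.+1]) ((fun x : V => x 0 i) @^-1` `[- k%:R, k%:R])).
  apply: fin_bigcap_measurable => // i _; rewrite -[X in measurable X]setTI.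
  exact: measurable_coord.
apply/seteqP; split => x h i; first by have := h i; rewrite mxE subr0 ler_norml /= in_itv/=.
by have := h i I; rewrite mxE subr0 ler_norml /= in_itv/=.
Qed.

HB.instance Definition _ := Measure_isSigmaFinite.Build _ _ _ lm lebesgue_sigma_finite.

Lemma lebesgue_tonelli (Q : set (T * T)) : measurable Q ->
  (\int[lm]_x lm (xsection Q x) = \int[lm]_y lm (ysection Q y))%E.
Proof.
move=> mQ; have := @indic_fubini_tonelli _ _ _ _ R lm lm Q mQ.
by rewrite indic_fubini_tonelli_FE// indic_fubini_tonelli_GE.
Qed.

(* Double counting of the pairs (x, v) with x in A, v in B and x + v in G. *)
Lemma double_counting (A B G : set V) (a c : \bar R) :
  lebesgue_measurable A -> lebesgue_measurable B -> borel G ->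
  (0 <= a)%E -> (0 <= c)%E ->
  (forall x, A x -> (a <= lm (B `&` [set v | G (x + v)%R]))%E) ->
  (forall v, B v -> (lm (A `&` [set x | G (x + v)%R]) <= c)%E) ->
  (a * lm A <= c * lm B)%E.
Proof.
move=> mA mB bG a0 c0 hA hB.
pose Q : set (T * T) := (A `*` B) `&` [set p | G (p.1 + p.2)].
have mQ : measurable Q.
  apply: measurableI; first exact: measurableX.
  apply: (@preimage_borel_measurable _ _ _ _ (fun p : T * T => p.1 + p.2 : V)) bG => i.
  under eq_fun do rewrite mxE.
  apply: measurable_funD.
    exact: (measurableT_comp (measurable_coord i) measurable_fst).
  exact: (measurableT_comp (measurable_coord i) measurable_snd).
have xQ x : xsection Q x = if x \in A then B `&` [set v | G (x + v)%R] else set0.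
  case: ifPn => xA; apply/seteqP; split => v; rewrite /xsection /= inE /Q //=.
  - by move=> [[]].
  - by move=> [Bv Gxv]; split => //; split => //; exact: set_mem.
  - by move=> [[/mem_set]]; rewrite (negbTE xA).
have yQ v : ysection Q v = if v \in B then A `&` [set x | G (x + v)%R] else set0.
  case: ifPn => vB; apply/seteqP; split => x; rewrite /ysection /= inE /Q //=.
  - by move=> [[]].
  - by move=> [Ax Gxv]; split => //; split => //; exact: set_mem.
  - by move=> [[_ /mem_set]]; rewrite (negbTE vB).
rewrite -[X in (X <= _)%E]integral_cst// -[X in (_ <= X)%E]integral_cst//.
rewrite [X in (X <= _)%E]integral_mkcond [X in (_ <= X)%E]integral_mkcond.
apply: (@le_trans _ _ (\int[lm]_x lm (xsection Q x))%E).
  apply: ge0_le_integral; first exact: measurableT.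
  - by move=> x _; rewrite patchE; case: ifP.
  - by apply/measurable_restrict; rewrite ?setIT //; exact: measurable_cst.
  - exact: measurable_fun_xsection.
  - move=> x _; rewrite patchE xQ; case: ifPn => [/set_mem xA|_]; last by rewrite measure0.
    exact: (hA x xA).
rewrite lebesgue_tonelli//.
apply: ge0_le_integral; first exact: measurableT.
- by move=> v _; exact: measure_ge0.
- exact: measurable_fun_ysection.
- by apply/measurable_restrict; rewrite ?setIT //; exact: measurable_cst.
- move=> v _; rewrite patchE yQ; case: ifPn => [/set_mem vB|_]; last by rewrite measure0.
  exact: (hB v vB).
Qed.

End measure3.

(** * Volumes as real numbers, and convex sets *)

Section volume.
Context {R : realType} {n : nat}.
Local Notation V := 'rV[R]_n.+1.
Local Notation lm := (@lebesgue R n).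

(** A set of infinite measure gets the volume 0, hence the hypotheses [mfin] below. *)
Definition vol (A : set V) : R := fine (lm A).

Definition mfin (A : set V) : Prop := lebesgue_measurable A /\ (lm A < +oo)%E.

Lemma vol_ge0 A : 0 <= vol A.
Proof. exact/fine_ge0/lebesgue_outer_ge0. Qed.

Lemma volE A : mfin A -> lm A = (vol A)%:E.
Proof. by move=> [_ Af]; rewrite /vol fineK// ge0_fin_numE// lebesgue_outer_ge0. Qed.

Lemma mfinS A B : mfin A -> lebesgue_measurable B -> B `<=` A -> mfin B.
Proof. by move=> [_ Af] mB BA; split => //; exact: le_lt_trans (lebesgue_outer_le BA) Af. Qed.

Lemma vol_le A B : mfin A -> B `<=` A -> vol B <= vol A.
Proof.
move=> Af BA; have h : (lm B <= lm A)%E by exact: lebesgue_outer_le.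
apply: fine_le => //; last by rewrite volE.
by rewrite ge0_fin_numE ?lebesgue_outer_ge0// (le_lt_trans h)//; case: Af.
Qed.

Lemma mfinI A B : mfin A -> lebesgue_measurable B -> mfin (A `&` B).
Proof.
by move=> Af mB; apply: (mfinS Af); [apply: measurableI => //; case: Af|move=> x []].
Qed.

Lemma mfinD A B : mfin A -> lebesgue_measurable B -> mfin (A `\` B).
Proof.
by move=> Af mB; apply: (mfinS Af); [apply: measurableD => //; case: Af|move=> x []].
Qed.

Lemma volID A B : mfin A -> lebesgue_measurable B ->
  vol A = vol (A `&` B) + vol (A `\` B).
Proof.
move=> Af mB; apply: EFin_inj; rewrite EFinD -!volE//; [|exact: mfinD|exact: mfinI].
case: Af => mA _; have -> := measureDI lm mA mB; exact: addeC.
Qed.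

Lemma mfinU A B : mfin A -> mfin B -> mfin (A `|` B).
Proof.
move=> [mA Af] [mB Bf]; split; first exact: measurableU.
by rewrite (le_lt_trans (measureU2 _ mA mB))// lte_add_pinfty.
Qed.

Lemma volU_le A B : mfin A -> mfin B -> vol (A `|` B) <= vol A + vol B.
Proof.
move=> fA fB; rewrite -lee_fin EFinD -!volE//; last exact: mfinU.
by case: fA fB => mA _ [mB _]; exact: measureU2.
Qed.

Lemma volU A B : mfin A -> mfin B -> A `&` B = set0 -> vol (A `|` B) = vol A + vol B.
Proof.
move=> fA fB AB; apply: EFin_inj; rewrite EFinD -!volE//; last exact: mfinU.
by case: fA fB => mA _ [mB _]; exact: measureU.
Qed.

Lemma mfin0 : mfin set0.
Proof. by split; [exact: measurable0|rewrite [X in (X < _)%E]lebesgue_outer0]. Qed.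

Lemma vol0 : vol set0 = 0.
Proof. by rewrite /vol [X in fine X]lebesgue_outer0. Qed.

Lemma vol_null A : vol A = 0 -> mfin A -> lm A = 0%E.
Proof. by move=> A0 /volE ->; rewrite A0. Qed.

Lemma mfin_null A : lebesgue_measurable A -> lm A = 0%E -> mfin A /\ vol A = 0.
Proof. by move=> mA A0; rewrite /mfin /vol A0. Qed.

Lemma null_measurable (A : set V) : lm A = 0%E -> lebesgue_measurable A.
Proof.
move=> A0; apply: le_caratheodory_measurable => X.
change (lebesgue_outer (X `&` A) + lebesgue_outer (X `&` ~` A) <= lebesgue_outer X)%E.
have -> : lebesgue_outer (X `&` A) = 0%E.
  apply/eqP; rewrite eq_le lebesgue_outer_ge0 andbT -A0.
  by apply: lebesgue_outer_le => x [].
by rewrite add0e; apply: lebesgue_outer_le => x [].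
Qed.

Lemma mfin_bounded A : bounded_set A -> lebesgue_measurable A -> mfin A.
Proof. by move=> bA mA; split => //; exact: lebesgue_bounded. Qed.

Lemma mfin_aff c mu A : 0 < mu -> mfin A -> mfin (aff c mu @` A).
Proof.
move=> m0 fA; split; first by apply: measurable_aff => //; case: fA.
by rewrite [X in (X < _)%E]lebesgue_aff// [lebesgue_outer A](volE fA) ltey.
Qed.

Lemma vol_aff c mu A : 0 < mu -> vol (aff c mu @` A) = mu ^+ n.+1 * vol A.
Proof.
move=> m0; rewrite /vol [lebesgue _]lebesgue_aff// -/(lebesgue A).
have := @lebesgue_outer_ge0 R n A; rewrite -/(lm A).
case: (lm A) => [r _|_|]//=.
by rewrite gt0_muley ?mulr0// lte_fin exprn_gt0.
Qed.

Lemma vol_gt0 A : mfin A -> open A -> A !=set0 -> 0 < vol A.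
Proof. by move=> fA oA A0; rewrite -lte_fin -volE//; exact: open_measure_gt0. Qed.

Lemma mfin_bigcup (A : nat -> set V) B : mfin B -> (forall i, lebesgue_measurable (A i)) ->
  (forall i, A i `<=` B) -> mfin (\bigcup_i A i).
Proof.
move=> fB mA AB; apply: (mfinS fB); first exact: bigcupT_measurable.
by move=> x [i _ /AB].
Qed.

Lemma vol_bigcup_cvg (A : nat -> set V) : (forall i, lebesgue_measurable (A i)) ->
  {homo A : i j / (i <= j)%N >-> (i <= j)%O} -> mfin (\bigcup_i A i) ->
  (fun i => vol (A i)) @ \oo --> vol (\bigcup_i A i).
Proof.
move=> mA ndA fA; apply: fine_cvg; rewrite -volE//.
by apply: nondecreasing_cvg_mu => //; case: fA.
Qed.

Lemma vol_bigcap_cvg (A : nat -> set V) : mfin (A 0%N) -> (forall i, lebesgue_measurable (A i)) ->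
  {homo A : i j / (i <= j)%N >-> (j <= i)%O} ->
  (fun i => vol (A i)) @ \oo --> vol (\bigcap_i A i).
Proof.
move=> fA mA niA; apply: fine_cvg; rewrite -volE//.
  by apply: nonincreasing_cvg_mu => //; [case: fA|exact: bigcapT_measurable].
apply: (mfinS fA); first exact: bigcapT_measurable.
by move=> x; apply.
Qed.

Definition cvx (A : set V) := forall x y (t : R), A x -> A y -> 0 <= t -> t <= 1 ->
  A ((1 - t) *: x + t *: y).

Lemma convex_set_cvx (A : set V) : convex_set (A : set (convex_lmodType V)) -> cvx A.
Proof.
move=> cA x y t Ax Ay t0 t1.
have := cA y x (Itv01 t0 t1) (mem_set Ay) (mem_set Ax).
by rewrite inE /conv /= addrC.
Qed.

Lemma cvxI A B : cvx A -> cvx B -> cvx (A `&` B).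
Proof. by move=> cA cB x y t [Ax Bx] [Ay By] t0 t1; split; [exact: cA|exact: cB]. Qed.

(** The homothety of centre [x] and ratio 1 - t shrinks a cube about [p] contained in [A] to a cube
    about the given point, still in [A]. *)
Lemma cvx_interior (A : set V) p x t : cvx A -> A° p -> A x -> 0 <= t -> t < 1 ->
  A° ((1 - t) *: p + t *: x).
Proof.
move=> cA /nbhs_cubeP[r r0 h] Ax t0 t1; apply/nbhs_cubeP.
have t10 : 0 < 1 - t by rewrite subr_gt0.
exists ((1 - t) * r); first exact: mulr_gt0.
move=> z hz; set z0 := (_ + _) in hz.
pose w := p + (1 - t)^-1 *: (z - z0).
have -> : z = (1 - t) *: w + t *: x.
  rewrite /w scalerDr scalerA mulfV ?gt_eqF// scale1r addrAC -/z0 addrC subrK//.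
apply: cA => //; last exact: ltW.
apply: h => i; rewrite (_ : w 0 i - p 0 i = (1 - t)^-1 * (z 0 i - z0 0 i)); last first.
  by rewrite /w !mxE; ring.
by rewrite normrM gtr0_norm ?invr_gt0// ltr_pdivrMl//; exact: hz.
Qed.

Lemma cvx_interior_cvx (A : set V) : cvx A -> cvx A°.
Proof.
move=> cA x y t Ax Ay t0; rewrite le_eqVlt => /predU1P[->|t1].
  by rewrite subrr scale0r add0r scale1r.
by apply: cvx_interior => //; exact: interior_subset.
Qed.

Lemma cvx_closure_interior (A : set V) p : cvx A -> A° p -> A `<=` closure A°.
Proof.
move=> cA Ap x Ax B /nbhs_cubeP[r r0 h].
have [M M0 hM] : exists2 M, 0 < M & forall i, `|p 0 i - x 0 i| <= M.
  exists (`|p - x| + 1); first by rewrite ltr_wpDl.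
  by move=> i; have := coord_le_norm (p - x) i; rewrite !mxE => /le_trans; apply; rewrite lerDl.
pose m := Num.min (r / (2 * M)) 1.
have m0 : 0 < m by rewrite lt_min ltr01 andbT divr_gt0// mulr_gt0.
have m1 : m <= 1 by rewrite ge_min lexx orbT.
pose t := 1 - m.
exists ((1 - t) *: p + t *: x); split.
  by apply: cvx_interior => //; rewrite /t; lra.
apply: h => i; rewrite (_ : _ - _ = m * (p 0 i - x 0 i)); last by rewrite !mxE /t; ring.
rewrite normrM gtr0_norm//.
have mr : m <= r / (2 * M) by rewrite /m ge_min lexx.
apply: (@le_lt_trans _ _ (r / (2 * M) * M)); first by apply: ler_pM => //; exact: ltW.
rewrite (_ : _ * M = r / 2); last by field; rewrite gt_eqF.
lra.
Qed.

(** A homothety of centre [p] and ratio [mu > 1] carries the interior over all of [A]; letting [mu]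
    tend to 1 compares the two volumes. *)
Lemma cvx_null (A : set V) p : cvx A -> A° p -> mfin A -> lm (A `\` A°) = 0%E.
Proof.
move=> cA Ap fA; have mI : lebesgue_measurable A° by exact/open_lebesgue_measurable/open_interior.
have fI : mfin A° by apply: (mfinS fA) => //; exact: interior_subset.
have h mu : 1 < mu -> vol A <= mu ^+ n.+1 * vol A°.
  move=> m1; have m0 : 0 < mu by lra.
  rewrite -(@vol_aff ((1 - mu) *: p) mu)//; apply: vol_le; first exact: mfin_aff.
  move=> x Ax; rewrite aff_image//.
  rewrite /preimage /= (_ : aff _ _ _ = (1 - mu^-1) *: p + mu^-1 *: x).
    by apply: cvx_interior => //; rewrite ?invr_ge0 ?invf_lt1// ltW.
  by rewrite /aff -scaleNr scalerA; congr (_ *: _ + _); field; rewrite gt_eqF.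
have le : vol A <= vol A°.
  have lim : (fun k : nat => (1 + k.+1%:R^-1) ^+ n.+1 * vol A°) @ \oo --> (1 + 0 : R) ^+ n.+1 * vol A°.
    apply: cvgM; last exact: cvg_cst.
    have e : (fun k : nat => (1 + k.+1%:R^-1 : R)) @ \oo --> (1 + 0 : R).
      by apply: cvgD; [exact: cvg_cst|exact: cvg_harmonic].
    exact: (cvg_comp _ _ e (@exprn_continuous R n.+1 _)).
  rewrite addr0 expr1n mul1r in lim.
  rewrite -(cvg_lim (@Rhausdorff R) lim); apply: limr_ge; first by apply/cvg_ex; eexists; exact: lim.
  by near=> k; apply: h; rewrite ltrDl invr_gt0.
apply: lebesgueD0 => //; [by case: fA|exact: interior_subset|by case: fI|].
by rewrite !volE// lee_fin.
Unshelve. all: by end_near. Qed.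

End volume.

(** * Smooth functions *)

Section continuity.
Context {R : realType} {X : topologicalType}.

Lemma cont_cst (c : R) : continuous (fun _ : X => c).
Proof. exact: cst_continuous. Qed.

Lemma contD (f g : X -> R) : continuous f -> continuous g -> continuous (fun x => f x + g x).
Proof. by move=> cf cg x; exact: (@cvgD _ _ _ _ _ f g _ _ (cf x) (cg x)). Qed.

Lemma contB (f g : X -> R) : continuous f -> continuous g -> continuous (fun x => f x - g x).
Proof. by move=> cf cg x; exact: (@cvgB _ _ _ _ _ f g _ _ (cf x) (cg x)). Qed.

Lemma contM (f g : X -> R) : continuous f -> continuous g -> continuous (fun x => f x * g x).
Proof. by move=> cf cg x; exact: (@cvgM _ _ _ _ f g _ _ (cf x) (cg x)). Qed.

Lemma cont_comp (Y : topologicalType) (f : X -> Y) (g : Y -> R) :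
  continuous f -> continuous g -> continuous (fun x => g (f x)).
Proof. by move=> cf cg x; apply: continuous_comp; [exact: cf|exact: cg]. Qed.

End continuity.

Lemma is_derive_cont {R : realType} (u w : R -> R) :
  (forall x, is_derive x (1 : R) u (w x)) -> continuous u.
Proof.
move=> du y; apply: differentiable_continuous; apply/derivable1_diffP.
by have := du y => d; exact: ex_derive.
Qed.

Section smooth.
Context {R : realType} {n : nat}.
Local Notation V := 'rV[R]_n.+1.
Implicit Types (f g : V -> R).

(** Brings directional derivatives back to functions of one variable, where the chain rule and the
    mean value theorem apply. *)
Lemma is_derive_lineE f x v t0 d :
  is_derive (x + t0 *: v) v f d <-> is_derive t0 (1 : R) (fun t => f (x + t *: v)) d.
Proof.
pose F := (fun t : R => f (x + t *: v)).
have e h : h^-1 *: ((f \o shift (x + t0 *: v)) (h *: v) - f (x + t0 *: v)) =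
  h^-1 *: ((F \o shift t0) (h *: (1 : R)) - F t0).
  rewrite /F /=; congr (_ *: (f _ - _)).
  by rewrite scaler1 scalerDl addrCA.
have e1 : 'D_v f (x + t0 *: v) = 'D_1 F t0.
  exact: (f_equal (fun g : R -> R => lim (g @ (0 : R)^')) (funext e)).
have e2 : derivable f (x + t0 *: v) v = derivable F t0 1.
  exact: (f_equal (fun g : R -> R => cvg (g @ (0 : R)^')) (funext e)).
split=> -[h1 h2]; apply: DeriveDef.
- exact: (eq_ind _ id h1 _ e2).
- exact: (eq_trans (esym e1) h2).
- exact: (eq_ind _ id h1 _ (esym e2)).
- exact: (eq_trans e1 h2).
Qed.

Lemma is_derive_line f x v d :
  is_derive x v f d <-> is_derive (0 : R) (1 : R) (fun t => f (x + t *: v)) d.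
Proof. by rewrite -is_derive_lineE scale0r addr0. Qed.

Lemma derivable_is_derive f x v : derivable f x v -> is_derive x v f ('D_v f x).
Proof. by move=> df; exact/derivableP. Qed.

Lemma smooth_cont f : smooth f -> continuous f.
Proof. by move=> /(_ [::])[]. Qed.

Lemma smooth_is_derive f x i : smooth f -> is_derive x (delta_mx 0 i) f (pderiv i f x).
Proof. by move=> /(_ [::])[_ /(_ x i)]; exact: derivable_is_derive. Qed.

Lemma smooth_pderiv f i : smooth f -> smooth (pderiv i f).
Proof. by move=> sf s; have := sf (rcons s i); rewrite foldr_rcons. Qed.

(** Replaces induction on the order of derivation: a class [P] containing the function is enlarged
    until it is stable under partial derivatives. *)
Lemma smooth_coind (P : (V -> R) -> Prop) :
  (forall f, P f -> continuous f) ->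
  (forall f i, P f -> exists2 g, P g &
     forall x, is_derive x (delta_mx 0 i) f (g x)) ->
  forall f, P f -> smooth f.
Proof.
move=> cP dP f Pf s; have Ps : P (foldr pderiv f s).
  elim: s => // i s Pg; have [g Pg' dg] := dP _ i Pg.
  rewrite /= (_ : pderiv i _ = g)//; apply/funext => x.
  exact: derive_val.
split; first exact: cP.
by move=> x i; have [g _ dg] := dP _ i Ps; exact: ex_derive.
Qed.

(** Sums and products are put into a single class, since the derivative of a product is a sum of
    products. *)
Inductive smooth_alg : (V -> R) -> Prop :=
| smooth_alg_in f : smooth f -> smooth_alg f
| smooth_alg_add f g : smooth_alg f -> smooth_alg g -> smooth_alg (f + g)
| smooth_alg_mul f g : smooth_alg f -> smooth_alg g -> smooth_alg (f * g).

Let smooth_algP f : smooth_alg f -> smooth f.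
Proof.
apply: smooth_coind => {f} f.
  elim=> {f} [f /smooth_cont//|f g _ cf _ cg|f g _ cf _ cg] x.
    exact: (@cvgD _ _ _ _ _ f g _ _ (cf x) (cg x)).
  exact: (@cvgM _ _ _ _ f g _ _ (cf x) (cg x)).
move=> i; elim=> {f} [f sf|f g sf [f' sf' df] sg [g' sg' dg]|f g sf [f' sf' df] sg [g' sg' dg]].
- by exists (pderiv i f); [exact/smooth_alg_in/smooth_pderiv|move=> x; exact: smooth_is_derive].
- by exists (f' + g'); [exact: smooth_alg_add|move=> x; exact: is_deriveD].
- exists (f * g' + g * f'); last by move=> x; exact: is_deriveM.
  by apply: smooth_alg_add; exact: smooth_alg_mul.
Qed.

Lemma smoothD f g : smooth f -> smooth g -> smooth (fun x => f x + g x).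
Proof. by move=> sf sg; apply: smooth_algP; apply: smooth_alg_add; exact: smooth_alg_in. Qed.

Lemma smoothM f g : smooth f -> smooth g -> smooth (fun x => f x * g x).
Proof. by move=> sf sg; apply: smooth_algP; apply: smooth_alg_mul; exact: smooth_alg_in. Qed.

Lemma smooth_cst (c : R) : smooth (fun _ : V => c).
Proof.
apply: (@smooth_coind (fun f => exists c, f = fun=> c)); last by exists c.
  by move=> _ [d ->] x; exact: cst_continuous.
move=> _ i [d ->]; exists (fun=> 0); first by exists 0.
by move=> x; exact: is_derive_cst.
Qed.

Lemma smoothZ (c : R) f : smooth f -> smooth (fun x => c * f x).
Proof. exact/smoothM/smooth_cst. Qed.

Lemma smoothN f : smooth f -> smooth (fun x => - f x).
Proof.
move=> sf; rewrite (_ : (fun x => _) = (fun x => -1 * f x)); first exact: smoothZ.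
by apply/funext => x; rewrite mulN1r.
Qed.

Lemma smoothB f g : smooth f -> smooth g -> smooth (fun x => f x - g x).
Proof. by move=> sf sg; apply: smoothD => //; exact: smoothN. Qed.

Lemma smoothX f k : smooth f -> smooth (fun x => f x ^+ k).
Proof.
move=> sf; elim: k => [|k ih]; first exact: smooth_cst.
by rewrite (_ : (fun x => _) = (fun x => f x * f x ^+ k)); [exact: smoothM|apply/funext => x; rewrite exprS].
Qed.

Lemma smooth_prod (I : Type) (s : seq I) (F : I -> V -> R) :
  (forall i, smooth (F i)) -> smooth (fun x => \prod_(i <- s) F i x).
Proof.
move=> sF; elim: s => [|i s ih].
  by rewrite (_ : (fun x => _) = (fun=> 1)); [exact: smooth_cst|apply/funext => x; rewrite big_nil].
rewrite (_ : (fun x => _) = (fun x => F i x * \prod_(j <- s) F j x)); first exact: smoothM.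
by apply/funext => x; rewrite big_cons.
Qed.

Lemma smooth_lift (P : (R -> R) -> Prop) (phi : R -> R) (i : 'I_n.+1) (a c : R) :
  (forall u : R -> R, P u -> exists2 w : R -> R, P w & forall x, is_derive x (1 : R) u (w x)) ->
  P phi -> smooth (fun x => phi (a * x 0 i + c)).
Proof.
move=> dP Pphi.
(* The scalar [k] absorbs the factors that the chain rule produces at each derivation. *)
apply: (@smooth_coind (fun h => exists k (u : R -> R), P u /\ h = fun x => k * u (a * x 0 i + c))).
- move=> _ [k [f [Pf ->]]]; have [g _ dg] := dP f Pf.
  apply: contM; first exact: cont_cst.
  apply: cont_comp; last exact: is_derive_cont dg.
  by apply: contD; [apply: contM; [exact: cont_cst|exact: coord_continuous]|exact: cont_cst].
- move=> _ j [k [f [Pf ->]]]; have [g Pg dg] := dP f Pf.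
  exists (fun x => (k * a * (j == i)%:R) * g (a * x 0 i + c)).
    by exists (k * a * (j == i)%:R), g.
  move=> x; apply/is_derive_line.
  rewrite (_ : (fun t => _) = (k *: (f \o (fun t : R => (a * (j == i)%:R) *: t + (a * x 0 i + c))))); last first.
    apply/funext => t /=; rewrite !mxE eqxx/= eq_sym [in LHS]mulrC [RHS]mulrC; congr (f _ * _).
    rewrite [X in _ = X + _](_ : _ = a * (j == i)%:R * t)//; ring.
  have dl : is_derive (0:R) (1:R) (fun t : R => (a * (j == i)%:R) *: t + (a * x 0 i + c)) (a * (j == i)%:R).
    by apply: is_derive_eq; rewrite addr0 scaler1.
  have dc := @is_derive1_comp R f _ 0 _ _ _ dl.
  have dg' : is_derive ((a * (j == i)%:R) *: (0 : R) + (a * x 0 i + c)) 1 f (g (a * x 0 i + c)).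
    by rewrite scaler0 add0r; exact: dg.
  have := dc _ dg' => d1; apply: is_derive_eq.
  by rewrite [LHS](_ : _ = k * (g (a * x 0 i + c) * (a * (j == i)%:R)))//; ring.
- by exists 1, phi; split => //; apply/funext => x; rewrite mul1r.
Qed.

Lemma aff_continuous c mu : continuous (aff c mu : V -> V).
Proof.
move=> x.
exact: (@cvgD _ _ _ _ _ (fun=> c) (fun y => mu *: y) c _ (cvg_cst c) (@scaler_continuous _ _ mu x)).
Qed.

Lemma smooth_comp_aff f c mu : smooth f -> smooth (fun x => f (aff c mu x)).
Proof.
move=> sf.
apply: (@smooth_coind (fun h => exists k f, smooth f /\ h = fun x => k * f (aff c mu x))).
- move=> _ [k [g [sg ->]]]; apply: contM; first exact: cont_cst.
  by apply: cont_comp; [exact: aff_continuous|exact: smooth_cont].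
- move=> _ i [k [g [sg ->]]]; exists (fun x => (k * mu) * pderiv i g (aff c mu x)).
    by exists (k * mu), (pderiv i g); split => //; exact: smooth_pderiv.
  move=> x; apply/is_derive_line.
  have dg := smooth_is_derive (aff c mu x) i sg.
  move/is_derive_line : dg => dg.
  rewrite (_ : (fun t => _) = (k *: ((fun t => g (aff c mu x + t *: delta_mx 0 i)) \o (fun t : R => mu *: t)))); last first.
    apply/funext => t /=; rewrite [RHS]/(_ * _); congr (_ * g _).
    by rewrite /aff scalerDr scalerA addrA.
  have dl : is_derive (0:R) (1:R) (fun t : R => mu *: t) mu.
    by apply: is_derive_eq; rewrite scaler1.
  have dg' : is_derive (mu *: (0:R)) 1 (fun t => g (aff c mu x + t *: delta_mx 0 i)) (pderiv i g (aff c mu x)).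
    by rewrite scaler0.
  have d1 := @is_derive1_comp R _ _ 0 _ _ dg' dl; apply: is_derive_eq.
  by rewrite [LHS](_ : _ = k * (pderiv i g (aff c mu x) * mu))//; ring.
- by exists 1, f; split => //; apply/funext => x; rewrite mul1r.
Qed.

End smooth.

(** * Flat functions and smooth cutoffs *)

Section flat.
Context {R : realType}.

(** The derivatives of exp(-1/t), extended by 0, are linear combinations of these functions. *)
Definition flat (k : nat) (t : R) : R :=
  if t <= 0 then 0 else t^-1 ^+ k * expR (- t^-1).

Lemma flat_ge0 k t : 0 <= flat k t.
Proof.
rewrite /flat; case: (leP t 0) => // t0.
by rewrite mulr_ge0 ?expR_ge0// exprn_ge0// invr_ge0 ltW.
Qed.

(** A quadratic bound is what makes the derivative at 0 vanish for every [k]; it comes from exp(u)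
    >= u^(k+2) / (k+2)! at u = 1/t. *)
Lemma flat_bound k t : flat k t <= (k.+2)`!%:R * t ^+ 2.
Proof.
rewrite /flat; case: (leP t 0) => t0; first by rewrite mulr_ge0 ?sqr_ge0.
have u0 : 0 < t^-1 by rewrite invr_gt0.
have h := @expR_ge1Dxn R t^-1 k.+1 (ltW u0).
have f0 : (0 : R) < (k.+2)`!%:R by rewrite ltr0n fact_gt0.
have {}h : t^-1 ^+ k.+2 <= (k.+2)`!%:R * expR t^-1.
  by rewrite -ler_pdivrMl// mulrC (le_trans _ h)// lerDr.
rewrite expRN -ler_pdivlMr ?invr_gt0 ?expR_gt0// invrK.
rewrite -mulrA [_ * expR _]mulrC mulrA -ler_pdivrMr ?exprn_gt0//.
by rewrite -exprVn -exprD addn2.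
Qed.

Lemma is_derive_flat k t :
  is_derive t (1 : R) (flat k) (- k%:R * flat k.+1 t + flat k.+2 t).
Proof.
have [t0|t0|->] := ltgtP t 0.
- rewrite /flat (ltW t0) mulr0 addr0.
  apply: (@near_eq_is_derive _ _ _ (cst 0) _ t 1 0 _ (is_derive_cst 0 t 1)).
  near=> s; rewrite /= ifT//; apply: ltW.
  by near: s; exact: lt_nbhsl.
- have tn0 : id t != 0 by rewrite gt_eqF.
  have dV : is_derive t 1 (fun s : R => s^-1) (- t^-1 ^+ 2).
    by have := @is_deriveV R id t 1 1 tn0 (is_derive_id t 1); rewrite scaler1 -exprVn.
  have dE : is_derive t 1 (fun s : R => expR (- s^-1)) (expR (- t^-1) * t^-1 ^+ 2).
    have dN := is_deriveN dV.
    have := @is_derive1_comp R expR (fun s => - s^-1) t _ _ (is_derive_expR _) dN.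
    by rewrite opprK.
  have dX := is_deriveX k dV.
  have dM := is_deriveM dX dE.
  rewrite (_ : _ + _ = (t^-1 ^+ k) *: (expR (- t^-1) * t^-1 ^+ 2) +
    expR (- t^-1) *: (k%:R * t^-1 ^+ k.-1 *: - t^-1 ^+ 2)); last first.
    rewrite /flat leNgt t0/= /GRing.scale/=; case: k {dX dM} => [|k] /=.
      by rewrite !mulr0n; ring.
    by rewrite !exprS; ring.
  have ne := @near_eq_is_derive _ _ _ _ (flat k) t 1 _ _ dM.
  have e j (s : R) : ((fun s : R => s^-1) ^+ j) s = s^-1 ^+ j.
    by elim: j => // j ih; rewrite !exprS -ih.
  rewrite (e k t) in ne; apply: ne.
  near=> s; rewrite /flat ifF; last first.
    by apply/negbTE; rewrite -ltNge; near: s; exact: lt_nbhsr.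
  by rewrite -e.
- rewrite {2 3}/flat lexx mulr0 addr0.
  have q0 : h^-1 *: ((flat k \o shift 0) (h *: (1 : R)) - flat k 0) @[h --> (0 : R)^'] --> (0 : R).
    apply/cvgrPdist_le => e e0; near=> h.
    have hn0 : h != 0 by near: h; exact: nbhs_dnbhs_neq.
    rewrite /= addr0 scaler1 {2}/flat lexx subr0.
    rewrite sub0r normrN normrM normfV (ger0_norm (flat_ge0 _ _)).
    rewrite ler_pdivrMl ?normr_gt0//; apply: le_trans (flat_bound _ _) _.
    rewrite -[h ^+ 2]real_normK ?num_real// expr2 mulrA [leRHS]mulrC ler_pM2r ?normr_gt0//.
    rewrite mulrC -ler_pdivlMr ?ltr0n ?fact_gt0//.
    near: h; apply: dnbhs0_le; rewrite divr_gt0// ltr0n fact_gt0//.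
  apply: DeriveDef; first by apply/cvg_ex; exists 0; exact: q0.
  exact: (cvg_lim (@Rhausdorff R) q0).
Unshelve. all: by end_near. Qed.

Lemma flat0_lt1 t : flat 0 t < 1.
Proof.
rewrite /flat; case: (leP t 0) => t0; first exact: ltr01.
by rewrite expr0 mul1r expR_lt1 oppr_lt0 invr_gt0.
Qed.

Lemma flat0_gt0 t : (0 < flat 0 t) = (0 < t).
Proof.
rewrite /flat; case: (leP t 0) => t0; first by rewrite ltxx.
by rewrite expr0 mul1r expR_gt0.
Qed.

Lemma flat0_le s t : s <= t -> flat 0 s <= flat 0 t.
Proof.
move=> st; rewrite {1}/flat; case: (leP s 0) => s0; first exact: flat_ge0.
have t0 := lt_le_trans s0 st.
by rewrite /flat [t <= 0]leNgt t0/= !expr0 !mul1r ler_expR lerN2 lef_pV2.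
Qed.

Inductive flat_span : (R -> R) -> Prop :=
| flat_span_in k : flat_span (flat k)
| flat_span_add u w : flat_span u -> flat_span w -> flat_span (u + w)
| flat_span_scale (c : R) u : flat_span u -> flat_span (c *: u).

Lemma flat_span_derive u : flat_span u ->
  exists2 w, flat_span w & forall x, is_derive x (1 : R) u (w x).
Proof.
elim=> {u} [k|u w _ [u' su du] _ [w' sw dw]|c u _ [u' su du]].
- exists ((- k%:R) *: flat k.+1 + flat k.+2).
    by apply: flat_span_add; [apply: flat_span_scale|]; exact: flat_span_in.
  by move=> x; exact: is_derive_flat.
- exists (u' + w'); first exact: flat_span_add.
  by move=> x; exact: is_deriveD.
- exists (c *: u'); first exact: flat_span_scale.
  by move=> x; exact: is_deriveZ.
Qed.

End flat.

Section bumps.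
Context {R : realType} {n : nat}.
Local Notation V := 'rV[R]_n.+1.

Lemma smooth_flat0 i a c : smooth (fun x : V => flat 0 (a * x 0 i + c) : R).
Proof. exact: smooth_lift flat_span_derive (flat_span_in 0). Qed.

(** Each of the two factors of a coordinate vanishes beyond one of the two faces, so the product is
    positive on the open cube only. *)
Definition bump_fun (q : V) (r : R) (x : V) : R :=
  \prod_i (flat 0 (1 * x 0 i + (r - q 0 i)) * flat 0 (-1 * x 0 i + (r + q 0 i))).

Lemma smooth_bump q r : smooth (bump_fun q r).
Proof. by apply: smooth_prod => i; apply: smoothM; exact: smooth_flat0. Qed.

Lemma bump_ge0 q r x : 0 <= bump_fun q r x.
Proof. by apply: prodr_ge0 => i _; rewrite mulr_ge0// flat_ge0. Qed.

Lemma bump_le1 q r x : bump_fun q r x <= 1.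
Proof.
apply: prodr_ile1 => i _; rewrite mulr_ge0 ?flat_ge0//=.
by rewrite mulr_ile1 ?flat_ge0// ltW// flat0_lt1.
Qed.

Lemma bump_gt0 q r x : cube q r x -> 0 < bump_fun q r x.
Proof.
move=> xq; apply: prodr_gt0 => i _; have := xq i; rewrite ltr_norml => /andP[h1 h2].
by rewrite mulr_gt0 // flat0_gt0; lra.
Qed.

Lemma bump_eq0 q r x : ~ ccube q r x -> bump_fun q r x = 0.
Proof.
move=> xq; have [i] : exists i, ~~ (`|x 0 i - q 0 i| <= r).
  by apply: contrapT => h; apply: xq => i; apply: contrapT => /negP hi; apply: h; exists i.
rewrite -ltNge ltr_normr => h.
rewrite /bump_fun (bigD1 i)//=; apply/eqP; rewrite mulf_eq0; apply/orP; left.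
rewrite mulf_eq0; apply/orP; case/orP: h => h; [right|left];
  by rewrite eq_le flat_ge0 andbT leNgt flat0_gt0 -leNgt; lra.
Qed.

Lemma bounded_ccube (q : V) r : bounded_set (ccube q r).
Proof.
exists (`|r| + `|q|); split; first exact: num_real.
move=> M hM y hy /=; apply: norm_le_coord.
  by apply: le_trans (ltW hM); rewrite addr_ge0.
move=> i; rewrite -(subrK (q 0 i) (y 0 i)).
apply: le_trans (ler_normD _ _) _; apply: le_trans (ltW hM).
by apply: lerD; [exact: le_trans (hy i) (ler_norm _)|exact: coord_le_norm].
Qed.

Lemma closed_ccube (q : V) r : closed (ccube q r).
Proof.
rewrite (_ : ccube q r = \bigcap_(i in [set: 'I_n.+1]) ((fun x : V => x 0 i) @^-1` `[(q 0 i - r), (q 0 i + r)])).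
  apply: closed_bigI => i _; apply: closed_comp; last exact: interval_closed.
  by move=> x _; exact: coord_continuous.
apply/seteqP; split => x h i /=.
  by move=> _; have := h i; rewrite in_itv/= ler_norml => /andP[h1 h2]; apply/andP; split; lra.
by have := h i I; rewrite /= in_itv/= ler_norml => /andP[h1 h2]; apply/andP; split; lra.
Qed.

Lemma compact_ccube (q : V) r : compact (ccube q r).
Proof. by apply: bounded_closed_compact; [exact: bounded_ccube|exact: closed_ccube]. Qed.

(** The bumps [b k] of the rational cubes of [U] are combined into 1 - prod (1 - b k)^m over k < m:
    the exponent forces the limit 1 wherever some bump is positive, and finitely many cubes
    contribute to each [g m], which keeps its support compact. *)
Lemma open_smooth_approx (U : set V) : open U ->
  exists g : nat -> V -> R, [/\ forall m, smooth (g m),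
    forall m x, 0 <= g m x <= 1,
    forall m, exists K, [/\ compact K, K `<=` U & forall x, ~ K x -> g m x = 0]
  & forall x, U x -> (fun m => g m x) @ \oo --> (1 : R)].
Proof.
move=> oU.
pose P (p : 'rV[rat]_n.+1 * rat) := `[< 0 < p.2 /\ ccube (map_mx ratr p.1) (ratr p.2) `<=` U >].
pose b (k : nat) : V -> R := if unpickle k is Some p then
   if P p then bump_fun (map_mx ratr p.1) (ratr p.2) else fun=> 0 else fun=> 0.
have sb k : smooth (b k).
  rewrite /b; case: (unpickle k) => [p|]; last exact: smooth_cst.
  by case: ifP => _; [exact: smooth_bump|exact: smooth_cst].
have b01 k x : 0 <= b k x <= 1.
  rewrite /b; case: (unpickle k) => [p|]; last by rewrite lexx ler01.
  by case: ifP => _; [rewrite bump_ge0 bump_le1|rewrite lexx ler01].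
have bK k : exists K, [/\ compact K, K `<=` U & forall x, ~ K x -> b k x = 0].
  rewrite /b; case: (unpickle k) => [p|]; last by exists set0; split => //; exact: compact0.
  case: ifP => [/asboolP[_ pU]|_]; last by exists set0; split => //; exact: compact0.
  exists (ccube (map_mx ratr p.1) (ratr p.2)); split => //; first exact: compact_ccube.
  by move=> x; exact: bump_eq0.
pose g m x := 1 - \prod_(k < m) (1 - b k x) ^+ m.
have p01 m x : 0 <= \prod_(k < m) (1 - b k x) ^+ m <= 1.
  have h k : 0 <= 1 - b k x <= 1 by have := b01 k x => /andP[? ?]; apply/andP; split; lra.
  rewrite prodr_ge0 ?prodr_ile1// => k _; have /andP[h0 h1] := h k.
    by rewrite exprn_ge0// exprn_ile1.
  exact: exprn_ge0.
exists g; split.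
- move=> m; apply: smoothB; first exact: smooth_cst.
  apply: smooth_prod => k; apply: smoothX; apply: smoothB => //; exact: smooth_cst.
- by move=> m x; have /andP[? ?] := p01 m x; rewrite /g; apply/andP; split; lra.
- move=> m; have [K hK] := choice bK.
  exists (\big[setU/set0]_(k < m) K k); split.
  + elim/big_ind : _ => //; [exact: compact0|exact: compactU|].
    by move=> k _; case: (hK k).
  + by rewrite -bigcup_mkord => x [k _]; case: (hK k) => _ + _; exact.
  + move=> x; rewrite -bigcup_mkord => nK; rewrite /g big1 ?subrr// => k _.
    case: (hK k) => _ _ -> ; first by rewrite subr0 expr1n.
    by move=> Kx; apply: nK; exists k => //=.
- move=> x Ux; have := Ux; rewrite {1}(open_rcubes oU) => -[p [p0 pU] px].
  pose k0 := pickle p.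
  have bk0 : 0 < b k0 x.
    by rewrite /b /k0 pickleK ifT; [exact: bump_gt0|apply/asboolP].
  have lim0 : (fun m => (1 - b k0 x) ^+ m) @ \oo --> (0 : R).
    apply: cvg_expr; have /andP[? ?] := b01 k0 x.
    by rewrite ger0_norm; lra.
  rewrite -[X in _ --> X]subr0; apply: cvgB; first exact: cvg_cst.
  apply: (@squeeze_cvgr _ _ _ _ (fun=> 0) (fun m => (1 - b k0 x) ^+ m) _ _ 0);
    [|exact: cvg_cst|exact: lim0].
  near=> m; have /andP[-> _] := p01 m x; rewrite /=.
  have km : (k0 < m)%N by near: m; exact: nbhs_infty_gt.
  have h k : 0 <= 1 - b k x <= 1 by have := b01 k x => /andP[? ?]; apply/andP; split; lra.
  rewrite (bigD1 (Ordinal km))//= ler_piMr//.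
    by apply: exprn_ge0; case/andP: (h k0).
  apply: prodr_ile1 => k _; have /andP[h0 h1] := h k.
  by rewrite exprn_ge0//= exprn_ile1.
Unshelve. all: by end_near. Qed.

End bumps.

(** * Directional derivatives and Lipschitz bounds *)

Section directional.
Context {R : realType} {n : nat}.
Local Notation V := 'rV[R]_n.+1.

Lemma mvt_coord (f : V -> R) (i : 'I_n.+1) (y : V) (d : R) : smooth f ->
  exists2 th : R, `|th| <= `|d| &
    f (y + d *: delta_mx 0 i) - f y = d * pderiv i f (y + th *: delta_mx 0 i).
Proof.
move=> sf; pose u t := f (y + t *: delta_mx 0 i).
have du t : is_derive t (1 : R) u (pderiv i f (y + t *: delta_mx 0 i)).
  by apply/is_derive_lineE; exact: smooth_is_derive.
have cu : continuous u := is_derive_cont du.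
have u0 : u 0 = f y by rewrite /u scale0r addr0.
have [d0|d0] := leP 0 d.
  have [c] := @MVT_segment R u _ 0 d d0 (fun t _ => du t) (continuous_subspaceT cu).
  rewrite in_itv/= subr0 u0 => /andP[c0 cd] e; exists c; last by rewrite e mulrC.
  by rewrite !ger0_norm.
have [c] := @MVT_segment R u _ d 0 (ltW d0) (fun t _ => du t) (continuous_subspaceT cu).
rewrite in_itv/= sub0r u0 => /andP[c0 cd] e; exists c.
  by rewrite ler0_norm// ltr0_norm//; lra.
by rewrite -opprB e; ring.
Qed.

(** The increment is split along a path that changes one coordinate at a time; the mean value
    theorem on each leg and the continuity of the partial derivatives give the limit. *)
Lemma is_derive_dir (f : V -> R) (x v : V) : smooth f ->
  is_derive x v f (\sum_i v 0 i * pderiv i f x).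
Proof.
move=> sf.
pose p (h : R) (k : nat) : V := x + h *: \row_j (if (j < k)%N then v 0 j else 0).
have p0 h : p h 0%N = x by rewrite /p (_ : \row_j _ = 0) ?scaler0 ?addr0//; apply/rowP => j; rewrite !mxE.
have pn h : p h n.+1 = x + h *: v.
  by rewrite /p; congr (_ + _ *: _); apply/rowP => j; rewrite mxE ltn_ord.
have pS h (k : 'I_n.+1) : p h k.+1 = p h k + (h * v 0 k) *: delta_mx 0 k.
  rewrite /p -addrA -scalerA -scalerDr; congr (_ + _ *: _).
  apply/rowP => j; rewrite !mxE eqxx/= ltnS leq_eqVlt.
  have [->|jk] := eqVneq j k; first by rewrite ltnn eqxx add0r mulr1.
  by rewrite (_ : (nat_of_ord j == k) = false) ?mulr0 ?addr0//; apply/negbTE.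
have q0 : h^-1 *: ((f \o shift x) (h *: v) - f x) @[h --> (0 : R)^'] --> \sum_i v 0 i * pderiv i f x.
  apply/cvgrPdist_le => e e0.
  pose M := \sum_i `|v 0 i| + 1.
  have M0 : 0 < M by rewrite ltr_wpDl// sumr_ge0.
  have hc i : \forall y \near x, `|pderiv i f x - pderiv i f y| <= e / M.
    have cp : continuous (pderiv i f) by exact/smooth_cont/smooth_pderiv.
    by have := cp x; move=> /cvgrPdist_le /(_ (e / M)); apply; rewrite divr_gt0.
  have : \forall y \near x, forall i, `|pderiv i f x - pderiv i f y| <= e / M.
    exact: (@filter_forall _ _ (fun i y => `|pderiv i f x - pderiv i f y| <= e / M) (nbhs x) _ hc).
  move=> /nbhs_cubeP[r r0 hr].
  near=> h.
  have hn0 : h != 0 by near: h; exact: nbhs_dnbhs_neq.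
  have hs : `|h| * M < r.
    rewrite -ltr_pdivlMr//; near: h; apply: dnbhs0_lt; exact: divr_gt0.
  have vM i : `|v 0 i| <= M.
    rewrite /M (bigD1 i)//= -addrA lerDl addr_ge0// sumr_ge0//.
  have in_cube (k : 'I_n.+1) (th : R) : `|th| <= `|h * v 0 k| ->
      cube x r (p h k + th *: delta_mx 0 k).
    move=> hth i; apply: le_lt_trans hs.
    rewrite (_ : _ - _ = h * (if (i < k)%N then v 0 i else 0) + th * (i == k)%:R); last first.
      by rewrite !mxE eqxx/=; ring.
    have [->|ik] := eqVneq i k.
      by rewrite ltnn mulr0 add0r mulr1 (le_trans hth)// normrM ler_wpM2l.
    rewrite mulr0 addr0 normrM ler_wpM2l//.
    by case: ifP => // _; rewrite normr0 ltW.
  have tele : f (x + h *: v) - f x = \sum_(k < n.+1) (f (p h k.+1) - f (p h k)).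
    by rewrite -(big_mkord xpredT (fun k => f (p h k.+1) - f (p h k))) telescope_sumr// p0 pn.
  rewrite /= [h *: v + x]addrC tele scaler_sumr -sumrB.
  have : forall k : 'I_n.+1, `|v 0 k * pderiv k f x - h^-1 *: (f (p h k.+1) - f (p h k))| <= `|v 0 k| * (e / M).
    move=> k; rewrite pS.
    have [th hth ->] := mvt_coord k (p h k) (h * v 0 k) sf.
    rewrite [_ *: _](_ : _ = v 0 k * pderiv k f (p h k + th *: delta_mx 0 k)); last first.
      by rewrite /GRing.scale/= mulrA mulrA mulVf// mul1r.
    by rewrite -mulrBr normrM ler_wpM2l//; apply: hr; exact: in_cube.
  move=> hk; apply: le_trans (ler_norm_sum _ _ _) _.
  apply: (@le_trans _ _ (\sum_i `|v 0 i| * (e / M))); first exact: ler_sum.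
  rewrite -mulr_suml mulrA ler_pdivrMr// mulrC ler_pM2l//.
  by rewrite /M lerDl.
apply: DeriveDef; first by apply/cvg_ex; eexists; exact: q0.
exact: (cvg_lim (@Rhausdorff R) q0).
Unshelve. all: by end_near. Qed.

Lemma cont_bounded (f : V -> R) (r : R) : continuous f ->
  exists2 M, 0 <= M & forall x, `|x| <= r -> `|f x| <= M.
Proof.
move=> cf.
have cK : compact (ccube 0 r : set V) by exact: compact_ccube.
have := continuous_compact (continuous_subspaceT cf) cK.
move=> /compact_bounded [M [_ hM]].
exists (`|M| + 1) => [|x xr]; first by rewrite addr_ge0.
apply: hM; first by rewrite (le_lt_trans (ler_norm _))// ltrDl.
exists x => // i; rewrite mxE subr0; exact: le_trans (coord_le_norm _ _) xr.
Qed.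

Lemma smooth_lipschitz (f : V -> R) (r : R) : smooth f ->
  exists2 L, 0 <= L & forall x y, `|x| <= r -> `|y| <= r -> `|f x - f y| <= L * `|x - y|.
Proof.
move=> sf.
have hM i : exists M, 0 <= M /\ forall x, `|x| <= r -> `|pderiv i f x| <= M.
  by have [M M0 h] := cont_bounded r (smooth_cont (smooth_pderiv i sf)); exists M.
have [M HM] := choice hM.
exists (\sum_i M i); first by apply: sumr_ge0 => i _; case: (HM i).
move=> x y xr yr; pose u (t : R) := f (y + t *: (x - y)).
have du t : is_derive t (1 : R) u (\sum_i (x - y) 0 i * pderiv i f (y + t *: (x - y))).
  by apply/is_derive_lineE; exact: is_derive_dir.
have [c] := @MVT_segment R u _ 0 1 ler01 (fun t _ => du t) (continuous_subspaceT (is_derive_cont du)).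
rewrite in_itv/= => /andP[c0 c1].
have -> : u 1 = f x by rewrite /u scale1r addrC subrK.
have -> : u 0 = f y by rewrite /u scale0r addr0.
rewrite subr0 mulr1 => ->.
apply: le_trans (ler_norm_sum _ _ _) _; rewrite mulr_suml; apply: ler_sum => i _.
rewrite normrM mulrC; apply: ler_pM => //; last exact: coord_le_norm.
case: (HM i) => _; apply.
rewrite (_ : y + c *: (x - y) = (1 - c) *: y + c *: x); last first.
  by rewrite scalerBr scalerBl scale1r addrA addrAC.
apply: le_trans (ler_normD _ _) _; rewrite !normrZ !ger0_norm//; last by rewrite subr_ge0.
have : (1 - c) * `|y| <= (1 - c) * r by rewrite ler_wpM2l// subr_ge0.
have : c * `|x| <= c * r by rewrite ler_wpM2l.
lra.
Qed.

End directional.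

Lemma Rintegral_sum d (X : measurableType d) (R : realType)
    (mu : {measure set X -> \bar R}) (D : set X) (I : Type) (s : seq I) (F : I -> X -> R) :
  measurable D -> (forall i, mu.-integrable D (EFin \o F i)) ->
  mu.-integrable D (EFin \o (fun x => \sum_(i <- s) F i x)) /\
  \int[mu]_(x in D) (\sum_(i <- s) F i x) = \sum_(i <- s) \int[mu]_(x in D) F i x.
Proof.
move=> mD iF; elim: s => [|i s [ih1 ih2]].
  split; last first.
    rewrite big_nil; under eq_Rintegral do rewrite big_nil.
    by rewrite Rintegral_cst// mul0r.
  rewrite (_ : _ \o _ = cst 0%E); first exact: integrable0.
  by apply/funext => x /=; rewrite big_nil.
split.
  rewrite (_ : _ \o _ = (EFin \o F i) \+ (EFin \o (fun x => (\sum_(j <- s) F j x)%R)))%E.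
    exact: integrableD.
  by apply/funext => x /=; rewrite big_cons EFinD.
rewrite big_cons -ih2 -RintegralD//.
by apply: eq_Rintegral => x _; rewrite big_cons.
Qed.

(** * Averages along a segment and the divergence theorem *)

Section translate_average.
Context {R : realType} {n : nat}.
Local Notation V := 'rV[R]_n.+1.
Local Notation mu := (@lebesgue_measure R).
Local Notation U := (`[0, 1]%classic : set R).

(* The field (Tr g v) v has divergence g - g(. - v). *)
Definition Tr (g : V -> R) (v x : V) : R := \int[mu]_(t in U) g (x - t *: v).

Lemma segment_cont (g : V -> R) (v x : V) : continuous g ->
  continuous (fun t : R => g (x - t *: v)).
Proof.
move=> cg; apply: (@cont_comp _ _ _ (fun t : R => x - t *: v)) => // t.
apply: cvgB; first exact: cst_continuous.
exact: (@scalel_continuous R V v t).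
Qed.

Lemma segment_integrable (g : V -> R) (v x : V) : continuous g ->
  mu.-integrable U (EFin \o (fun t : R => g (x - t *: v))).
Proof.
move=> cg; apply: continuous_compact_integrable; first exact: segment_compact.
apply: continuous_subspaceT; exact: segment_cont.
Qed.

Let muU : fine (mu U) = 1.
Proof. by rewrite lebesgue_measure_itv/= lte01 oppr0 adde0. Qed.

Lemma Tr_bounds (g : V -> R) (v x : V) : continuous g -> (forall y, 0 <= g y <= 1) ->
  0 <= Tr g v x <= 1.
Proof.
move=> cg g01; apply/andP; split.
  by apply: Rintegral_ge0 => t _; case/andP: (g01 (x - t *: v)).
rewrite -[leRHS]mul1r -[X in _ <= _ * X]muU -Rintegral_cst//; apply: le_Rintegral => //.
- exact: segment_integrable.
- by apply: continuous_compact_integrable; [exact: segment_compact|apply: continuous_subspaceT; exact: cst_continuous].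
- by move=> t _ /=; have /andP[_ h1] := g01 (x - t *: v).
Qed.

(** The support is swept by [K] as it moves along the segment from 0 to [v]. *)
Lemma Tr_support (g : V -> R) (v : V) (K : set V) : compact K ->
  (forall x, ~ K x -> g x = 0) ->
  compact [set z.1 + z.2 *: v | z in K `*` U] /\
  forall x, ~ [set z.1 + z.2 *: v | z in K `*` U] x -> Tr g v x = 0.
Proof.
move=> cK gK; split.
  apply: continuous_compact.
    apply: continuous_subspaceT => z.
    apply: cvgD; first exact: cvg_fst.
    by apply: cvgZr_tmp; exact: cvg_snd.
  by apply: compact_setX => //; exact: segment_compact.
move=> x nx; rewrite /Tr (@eq_Rintegral _ _ _ _ _ (fun=> 0)).
  by rewrite Rintegral_cst// mul0r.
move=> t tU; apply: gK => Kt; apply: nx; exists (x - t *: v, t) => /=; last by rewrite subrK.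
by split => //; exact: set_mem.
Qed.

Let line_bound (x v : V) (t : R) : U t -> `|x - t *: v| <= `|x| + `|v|.
Proof.
rewrite /= in_itv/= => /andP[t0 t1]; apply: le_trans (ler_normB _ _) _.
by rewrite lerD2l normrZ ger0_norm// ler_piMl.
Qed.

Let Tr_cont (g : V -> R) (v : V) : smooth g -> continuous (Tr g v).
Proof.
move=> sg x; have cg := smooth_cont sg.
have [L L0 hL] := smooth_lipschitz (`|x| + 1 + `|v|) sg.
apply/(@cvgrPdist_le R R^o V (nbhs x)) => e e0.
have m0 : 0 < Num.min 1 (e / (L + 1)) by rewrite lt_min ltr01/= divr_gt0// ltr_wpDl.
have := @nbhsx_ballx R V x _ m0; apply: filterS => y.
rewrite -ball_normE /= => /ltW yx.
have yx1 : `|x - y| <= 1 by rewrite (le_trans yx)// ge_min lexx.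
have yxe : `|x - y| <= e / (L + 1) by rewrite (le_trans yx)// ge_min lexx orbT.
rewrite /Tr -RintegralB//; try exact: segment_integrable.
have i2 : mu.-integrable U (EFin \o (fun t : R => g (x - t *: v) - g (y - t *: v))).
  apply: continuous_compact_integrable; first exact: segment_compact.
  by apply: continuous_subspaceT; apply: contB; exact: segment_cont.
apply: le_trans (le_normr_Rintegral _ i2) _ => //.
rewrite -[leRHS]mulr1 -[X in _ <= _ * X]muU -Rintegral_cst//.
apply: le_Rintegral => //.
- apply: continuous_compact_integrable; first exact: segment_compact.
  apply: continuous_subspaceT => t; apply: (@cvg_norm _ R^o).
  by apply: (@contB R R^o); exact: segment_cont.
- by apply: continuous_compact_integrable; [exact: segment_compact|apply: continuous_subspaceT; exact: cst_continuous].
- move=> t tU; have nx := line_bound x v tU; have ny := line_bound y v tU.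
  have yn : `|y| <= `|x| + 1.
    rewrite -(subrK x y); apply: le_trans (ler_normD _ _) _.
    by rewrite addrC lerD2l distrC.
  have h1 : `|x - t *: v| <= `|x| + 1 + `|v| by rewrite (le_trans nx)// -addrA lerD2l lerDr.
  have h2 : `|y - t *: v| <= `|x| + 1 + `|v| by rewrite (le_trans ny)// lerD2r.
  apply: le_trans (hL _ _ h1 h2) _.
  rewrite (_ : _ - _ - _ = x - y); last by rewrite opprB addrA subrK.
  apply: (@le_trans _ _ (L * (e / (L + 1)))); first exact: ler_wpM2l.
  have L1 : 0 < L + 1 by rewrite ltr_wpDl.
  by rewrite mulrA ler_pdivrMr// mulrDr mulr1 mulrC lerDl ltW.
Qed.

Let Tr_derive (g : V -> R) (v x : V) i : smooth g ->
  is_derive x (delta_mx 0 i) (Tr g v) (Tr (pderiv i g) v x).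
Proof.
move=> sg; apply/is_derive_line.
pose f (t s : R) := g (x + t *: delta_mx 0 i - s *: v).
have sp := smooth_pderiv i sg.
have df (t s : R) : is_derive t (1 : R) (f ^~ s) (pderiv i g (x + t *: delta_mx 0 i - s *: v)).
  have := smooth_is_derive (x - s *: v + t *: delta_mx 0 i) i sg.
  move/is_derive_lineE; rewrite /f.
  rewrite (_ : x - s *: v + _ = x + t *: delta_mx 0 i - s *: v); last by rewrite addrAC.
  by under eq_fun do rewrite addrAC.
have [M M0 hM] := cont_bounded (`|x| + `|delta_mx 0 i : V| + `|v|) (smooth_cont sp).
have Ia : `](-1), 1[%classic (0 : R) by rewrite /= in_itv/= ltrN10 ltr01.
have intf t : `](-1), 1[%classic t -> mu.-integrable U (EFin \o f t).
  by move=> _; apply: segment_integrable; exact: smooth_cont.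
have derf1 t s : `](-1), 1[%classic t -> U s -> derivable (f ^~ s) t 1.
  by move=> _ _; have := df t s => d; exact: ex_derive.
have d1 t s : partial1of2 f t s = pderiv i g (x + t *: delta_mx 0 i - s *: v).
  by rewrite partial1of2E; have := df t s => d; exact: derive_val.
have G_ub t s : `](-1), 1[%classic t -> U s -> `|partial1of2 f t s| <= cst M s.
  rewrite /= in_itv/= => /andP[t0 t1] sU; rewrite d1; apply: hM.
  apply: le_trans (line_bound _ _ sU) _; rewrite lerD2r.
  apply: le_trans (ler_normD _ _) _; rewrite lerD2l normrZ ler_piMl//.
  by rewrite ler_norml; apply/andP; split; exact: ltW.
have iG : mu.-integrable U (EFin \o cst M).
  by apply: continuous_compact_integrable; [exact: segment_compact|apply: continuous_subspaceT; exact: cst_continuous].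
have mU : measurable (U : set (measurableTypeR R)) by [].
have D1 := @derivable_under_integral R _ _ mu f U mU 0 (-1) 1 Ia intf derf1 (cst M) (fun=> M0) iG G_ub.
have D2 := @differentiation_under_integral R _ _ mu f U mU 0 (-1) 1 Ia intf derf1 (cst M) (fun=> M0) iG G_ub.
apply: DeriveDef; first exact: D1.
rewrite -derive1E D2 /Tr; apply: eq_Rintegral => s _.
by rewrite d1 scale0r addr0.
Qed.

Lemma smooth_Tr (g : V -> R) (v : V) : smooth g -> smooth (Tr g v).
Proof.
move=> sg; apply: (@smooth_coind _ _ (fun h => exists2 g, smooth g & h = Tr g v)).
- by move=> _ [h sh ->]; exact: Tr_cont.
- move=> _ i [h sh ->]; exists (Tr (pderiv i h) v); last by move=> x; exact: Tr_derive.
  by exists (pderiv i h) => //; exact: smooth_pderiv.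
- by exists g.
Qed.

Lemma pderiv_Tr (g : V -> R) (v x : V) i : smooth g ->
  pderiv i (Tr g v) x = Tr (pderiv i g) v x.
Proof. by move=> sg; have := Tr_derive v x i sg => d; exact: derive_val. Qed.

(** The sum is the integral over [0, 1] of the derivative of t |-> - g (x - t v). *)
Lemma Tr_telescope (g : V -> R) (v x : V) : smooth g ->
  \sum_i v 0 i * pderiv i (Tr g v) x = g x - g (x - v).
Proof.
move=> sg.
pose dg (t : R) := \sum_i v 0 i * pderiv i g (x - t *: v).
have cp i : continuous (fun t : R => v 0 i * pderiv i g (x - t *: v)).
  apply: (@contM R R^o); first exact: cst_continuous.
  by apply: segment_cont; apply: smooth_cont; exact: smooth_pderiv.
have ip i : mu.-integrable U (EFin \o (fun t : R => v 0 i * pderiv i g (x - t *: v))).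
  by apply: continuous_compact_integrable; [exact: segment_compact|apply: continuous_subspaceT; exact: cp].
have [_ e] := Rintegral_sum (index_enum 'I_n.+1) (measurable_itv _ : measurable (U : set (measurableTypeR R))) ip.
transitivity (\int[mu]_(t in U) dg t).
  rewrite /dg e; apply: eq_bigr => i _; rewrite pderiv_Tr// /Tr RintegralZl//.
  by apply: segment_integrable; apply: smooth_cont; exact: smooth_pderiv.
pose h (t : R) := - g (x - t *: v).
have dh t : is_derive t (1 : R) h (dg t).
  have := is_derive_dir (x + t *: (- v)) (- v) sg.
  move/is_derive_lineE => d; have := is_deriveN d.
  rewrite -sumrN /dg; under eq_bigr do rewrite mxE mulNr opprK scalerN.
  by under eq_fun do rewrite scalerN.
have ch : continuous h := is_derive_cont dh.
have := @continuous_FTC2 R dg h 0 1 ltr01.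
have cdg : continuous dg.
  rewrite /dg => t; apply: (@cvg_sum_seq R R^o _ (index_enum 'I_n.+1) (fun i (t : R) => v 0 i * pderiv i g (x - t *: v)) _ (nbhs t)).
  by move=> i; exact: cp.
move=> /(_ (continuous_subspaceT cdg)) ftc.
rewrite /Rintegral ftc.
- by rewrite /= /h scale1r scale0r subr0 opprK addrC.
- split; first by move=> t _; have := dh t => d; exact: ex_derive.
  + exact/cvg_at_right_filter/ch.
  + exact/cvg_at_left_filter/ch.
- by move=> t _; rewrite derive1E; have := dh t => d; exact: derive_val.
Qed.

End translate_average.

(** * Integrals of continuous functions with compact support *)

Section integrals.
Context {R : realType} {n : nat}.
Local Notation V := 'rV[R]_n.+1.
Local Notation T := (caratheodory_type (@lebesgue_outer R n)).
Local Notation lm := (@lebesgue R n).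

Definition Int (E : set V) (f : V -> R) : R := \int[lm]_(x in E) f x.

(** Such functions are integrable on every measurable set, of finite measure or not. *)
Definition cc (U : set V) (f : V -> R) : Prop := continuous f /\
  exists K, [/\ compact K, K `<=` U & forall x, ~ K x -> f x = 0].

Lemma compact_lebesgue_measurable (K : set V) : compact K -> lebesgue_measurable K.
Proof. by move=> cK; apply: closed_lebesgue_measurable; apply: compact_closed => //; exact: norm_hausdorff. Qed.

Lemma mfin_compact (K : set V) : compact K -> mfin K.
Proof.
by move=> cK; apply: mfin_bounded; [exact: compact_bounded|exact: compact_lebesgue_measurable].
Qed.

Lemma cc_integrable U E f : cc U f -> lebesgue_measurable E -> lm.-integrable E (EFin \o f).
Proof.
move=> [cf [K [cK KU f0]]] mE; apply: (@integrableS _ _ _ lm setT) => //.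
have fK := mfin_compact cK.
have iK : lm.-integrable K (EFin \o f).
  apply: measurable_bounded_integrable; [by case: fK|by case: fK| |].
    by apply: measurable_funTS; exact: continuous_measurable.
  have := continuous_compact (continuous_subspaceT cf) cK.
  move=> /compact_bounded[M [Mr hM]]; exists M; split => // N MN x Kx /=.
  by apply: hM => //; exists x.
have := iffLR (@integrable_mkcond _ T R lm K (EFin \o f : T -> \bar R) (proj1 fK)) iK.
apply: eq_integrable => // x _; rewrite patchE; case: ifPn => //= /negP nK.
by rewrite f0// => Kx; apply: nK; exact: mem_set.
Qed.

Lemma ccW U U' f : U `<=` U' -> cc U f -> cc U' f.
Proof.
by move=> UU' [cf [K [cK KU f0]]]; split => //; exists K; split => //; exact: subset_trans UU'.
Qed.

Lemma cc_add U (f g : V -> R) : cc U f -> cc U g -> cc U (fun x => f x + g x).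
Proof.
move=> [cf [K [cK KU f0]]] [cg [L [cL LU g0]]]; split; first exact: contD.
exists (K `|` L); split; [exact: compactU|by move=> x [/KU|/LU]|].
by move=> x /not_orP[/f0 -> /g0 ->]; rewrite addr0.
Qed.

Lemma cc_mul U (f g : V -> R) : continuous f -> cc U g -> cc U (fun x => f x * g x).
Proof.
move=> cf [cg [L [cL LU g0]]]; split; first exact: contM.
by exists L; split => // x /g0 ->; rewrite mulr0.
Qed.

Lemma cc_scale U (c : R) g : cc U g -> cc U (fun x => c * g x).
Proof. by apply: cc_mul; exact: cst_continuous. Qed.

Lemma Int_add U E f g : lebesgue_measurable E -> cc U f -> cc U g ->
  Int E (fun x => f x + g x) = Int E f + Int E g.
Proof. by move=> mE cf cg; rewrite /Int RintegralD//; [exact: cc_integrable cf mE|exact: cc_integrable cg mE]. Qed.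

Lemma Int_sub U E f g : lebesgue_measurable E -> cc U f -> cc U g ->
  Int E (fun x => f x - g x) = Int E f - Int E g.
Proof. by move=> mE cf cg; rewrite /Int RintegralB//; [exact: cc_integrable cf mE|exact: cc_integrable cg mE]. Qed.

Lemma Int_scale U E c f : lebesgue_measurable E -> cc U f ->
  Int E (fun x => c * f x) = c * Int E f.
Proof. by move=> mE cf; rewrite /Int RintegralZl//; exact: cc_integrable cf mE. Qed.

Lemma Int_setI E D f : (forall x, ~ D x -> f x = 0) -> Int (E `&` D) f = Int E f.
Proof.
move=> f0; rewrite /Int Rintegral_mkcondr; apply: eq_Rintegral => x _.
by rewrite patchE; case: ifPn => // /negP nD; rewrite f0// => Dx; apply: nD; exact: mem_set.
Qed.

Lemma Int_setU U E D f : lebesgue_measurable E -> lebesgue_measurable D -> cc U f ->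
  Int E f = Int (E `&` D) f + Int (E `\` D) f.
Proof.
move=> mE mD cf; rewrite /Int -Rintegral_setU//; first by rewrite setUIDK.
- exact: measurableI.
- exact: measurableD.
- by rewrite setUIDK; exact: cc_integrable cf mE.
- by apply/disj_setPS => x [[_ Dx] [_]].
Qed.

Lemma Int_vol_le U E f (c : R) : mfin E -> cc U f -> 0 <= c -> (forall x, E x -> f x <= c) ->
  Int E f <= c * vol E.
Proof.
move=> fE cf c0 fc; rewrite /vol -Rintegral_cst; last by case: fE.
apply: le_Rintegral => //; [by case: fE|by apply: cc_integrable cf _; case: fE|].
apply: measurable_bounded_integrable; [by case: fE|by case: fE|exact: measurable_cst|].
by exists `|c|; split; [exact: num_real|move=> M cM x _ /=; exact: ltW].
Qed.

(** Nonnegative functions come first, through the pushforward measure, which is a multiple of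
    Lebesgue measure; [Int_aff] then splits [f] as (|f| + f) - |f|. *)
Let integral_aff_ge0 c mu (F : set V) (f : V -> \bar R) : 0 < mu ->
  lebesgue_measurable F -> measurable_fun setT (f : T -> \bar R) -> (forall x, 0 <= f x)%E ->
  (\int[lm]_(x in F) f (aff c mu x) = (mu ^- n.+1)%:E * \int[lm]_(x in aff c mu @` F) f x)%E.
Proof.
move=> m0 mF mf f0.
have mm : measurable_fun setT (aff c mu : T -> T).
  move=> _ A mA; rewrite setTI aff_preimage//; apply: measurable_aff => //.
  by rewrite invr_gt0.
have k0 : 0 <= mu ^- n.+1 by rewrite invr_ge0 exprn_ge0// ltW.
have := @ge0_integral_pushforward _ _ T T R (aff c mu) mm lm (aff c mu @` F) f.
rewrite (_ : aff c mu @^-1` (aff c mu @` F) = F); last first.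
  rewrite aff_preimage// image_comp (_ : _ \o _ = id) ?image_id//.
  by apply/funext => x /=; rewrite affK.
move=> <-//; last 2 first.
- exact: measurable_aff.
- exact: measurable_funTS.
rewrite -[in RHS](ge0_integral_mscale lm (measurable_aff c m0 mF) (NngNum k0))//; last first.
  exact: measurable_funTS.
apply: eq_measure_integral => A mA _.
change (lm (aff c mu @^-1` A) = (mu ^- n.+1)%:E * lm A)%E; rewrite aff_preimage//.
by rewrite [LHS]lebesgue_aff ?invr_gt0// exprVn.
Qed.

Lemma cc_comp_aff U c mu f : 0 < mu -> cc U f ->
  cc (aff c mu @^-1` U) (fun x => f (aff c mu x)).
Proof.
move=> m0 [cf [K [cK KU f0]]]; split.
  by apply: cont_comp => //; exact: aff_continuous.
exists (aff c mu @^-1` K); split; last by move=> x; exact: f0.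
  rewrite aff_preimage//; apply: continuous_compact => //.
  by apply: continuous_subspaceT; exact: aff_continuous.
by move=> x /KU.
Qed.

Let Int_aff_ge0 U c mu (F : set V) (f : V -> R) : 0 < mu -> lebesgue_measurable F -> cc U f ->
  (forall x, 0 <= f x) ->
  Int (aff c mu @` F) f = mu ^+ n.+1 * Int F (fun x => f (aff c mu x)).
Proof.
move=> m0 mF cf f0.
have mf : measurable_fun setT ((EFin \o f) : T -> \bar R).
  by apply/measurable_EFinP; apply: continuous_measurable; case: cf.
have mu0 : mu ^+ n.+1 != 0 by rewrite expf_neq0// gt_eqF.
apply: (mulfI (invr_neq0 mu0)); rewrite mulrA mulVf// mul1r /Int /Rintegral.
have fi := integrable_fin_num (measurable_aff c m0 mF) (cc_integrable cf (measurable_aff c m0 mF)).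
rewrite [RHS](f_equal fine (@integral_aff_ge0 c mu F (EFin \o f) m0 mF mf f0)).
by rewrite fineM.
Qed.

Lemma Int_aff U c mu (F : set V) (f : V -> R) : 0 < mu -> lebesgue_measurable F -> cc U f ->
  Int (aff c mu @` F) f = mu ^+ n.+1 * Int F (fun x => f (aff c mu x)).
Proof.
move=> m0 mF cf.
pose p (x : V) := (`|f x| + f x); pose q (x : V) := `|f x|.
have cn : cc U q.
  case: cf => cf [K [cK KU f0]]; split.
    by apply: (@cont_comp _ _ _ f) => //; exact: norm_continuous.
  by exists K; split => // x nK; rewrite /q f0// normr0.
have cp : cc U p by exact: cc_add.
have fpq : f = (fun x => p x - q x) by apply/funext => x; rewrite /p /q addrC addrA addNr add0r.
have mA := measurable_aff c m0 mF.
rewrite fpq (Int_sub mA cp cn) (Int_sub mF (cc_comp_aff c m0 cp) (cc_comp_aff c m0 cn)).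
have p0 x : 0 <= p x by rewrite /p addrC -lerBlDl sub0r -normrN; exact: ler_norm.
have q0 x : 0 <= q x by exact: normr_ge0.
by rewrite (Int_aff_ge0 c m0 mF cp p0) (Int_aff_ge0 c m0 mF cn q0) mulrBr.
Qed.

End integrals.

(** * Perimeter *)

Section enorm.
Context {R : realType} {n : nat}.
Implicit Types x y : 'rV[R]_n.

Lemma dot_ge0 x : 0 <= dot x x.
Proof. by apply: sumr_ge0 => i _; rewrite -expr2 sqr_ge0. Qed.

Lemma enorm_ge0 x : 0 <= enorm x.
Proof. exact: sqrtr_ge0. Qed.

Lemma enorm_sqr x : enorm x ^+ 2 = dot x x.
Proof. by rewrite sqr_sqrtr// dot_ge0. Qed.

Lemma enormZ (a : R) x : enorm (a *: x) = `|a| * enorm x.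
Proof.
rewrite /enorm (_ : dot _ _ = a ^+ 2 * dot x x).
  by rewrite sqrtrM ?sqr_ge0// sqrtr_sqr.
by rewrite /dot mulr_sumr; apply: eq_bigr => i _; rewrite !mxE; ring.
Qed.

Lemma enorm0 : enorm (0 : 'rV[R]_n) = 0.
Proof. by rewrite -(scale0r 0) enormZ normr0 mul0r. Qed.

Lemma enormN x : enorm (- x) = enorm x.
Proof. by rewrite -scaleN1r enormZ normrN1 mul1r. Qed.

Lemma coord_le_enorm x i : `|x 0 i| <= enorm x.
Proof.
rewrite -sqrtr_sqr ler_sqrt ?dot_ge0// /dot (bigD1 i)//= expr2 lerDl.
by apply: sumr_ge0 => j _; rewrite -expr2 sqr_ge0.
Qed.

Lemma enorm_le_coord x (M : R) : 0 <= M -> (forall i, `|x 0 i| <= M) -> enorm x <= n%:R * M.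
Proof.
move=> M0 h; rewrite -[leRHS]ger0_norm ?mulr_ge0// -sqrtr_sqr ler_sqrt ?sqr_ge0//.
apply: (@le_trans _ _ (\sum_(i < n) M ^+ 2)).
  by apply: ler_sum => i _; rewrite -expr2 -[x 0 i ^+ 2]real_normK ?num_real// lerXn2r ?nnegrE.
rewrite sumr_const card_ord -[leLHS]mulr_natl [leRHS]exprMn; apply: ler_wpM2r; first exact: sqr_ge0.
by rewrite expr2 -natrM ler_nat; case: (n) => // k; rewrite leq_pmulr.
Qed.

Lemma enorm_eq0 x : enorm x = 0 -> x = 0.
Proof.
move=> x0; apply/rowP => i; rewrite mxE; apply/eqP; rewrite -normr_eq0 eq_le normr_ge0 andbT.
by rewrite -x0 coord_le_enorm.
Qed.

Lemma enorm_le1 x : (enorm x <= 1) = (dot x x <= 1).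
Proof. by rewrite -enorm_sqr expr_le1// enorm_ge0. Qed.

End enorm.

Section fields.
Context {R : realType} {n : nat}.
Local Notation V := 'rV[R]_n.+1.
Local Notation lm := (@lebesgue R n).

Implicit Types (f g phi : V -> R) (xi eta : V -> V) (x v : V) (E : set V).

Definition supported (W : lmodType R) (U : set V) (f : V -> W) : Prop :=
  exists K, [/\ compact K, K `<=` U & forall x, ~ K x -> f x = 0].

Definition field (U : set V) (xi : V -> V) : Prop :=
  smooth_field xi /\ supported U xi.

Definition unit_field (U : set V) (xi : V -> V) : Prop :=
  field U xi /\ forall x, enorm (xi x) <= 1.

Lemma fieldW U U' xi : U `<=` U' -> field U xi -> field U' xi.
Proof. by move=> UU' [sx [K [cK KU f0]]]; split => //; exists K; split => //; exact: subset_trans UU'. Qed.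

Lemma field0 U : field U (fun=> 0).
Proof.
split; last by exists set0; split => //; exact: compact0.
by move=> i; rewrite (_ : (fun _ => _) = fun=> 0); [exact: smooth_cst|apply/funext => x; rewrite mxE].
Qed.

Lemma unit_field0 U : unit_field U (fun=> 0).
Proof. by split; [exact: field0|move=> x; rewrite enorm0]. Qed.

Lemma field_add U xi eta : field U xi -> field U eta -> field U (fun x => xi x + eta x).
Proof.
move=> [sx [K [cK KU f0]]] [se [L [cL LU g0]]]; split.
  move=> i; rewrite (_ : (fun _ => _) = (fun x => xi x 0 i + eta x 0 i)); first exact: smoothD.
  by apply/funext => x; rewrite mxE.
exists (K `|` L); split; [exact: compactU|by move=> x [/KU|/LU]|].
by move=> x /not_orP[/f0 -> /g0 ->]; rewrite addr0.
Qed.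

Lemma field_mul U phi xi : smooth phi -> field U xi -> field U (fun x => phi x *: xi x).
Proof.
move=> sp [sx [K [cK KU f0]]]; split.
  move=> i; rewrite (_ : (fun _ => _) = (fun x => phi x * xi x 0 i)); first exact: smoothM.
  by apply/funext => x; rewrite mxE.
by exists K; split => // x /f0 ->; rewrite scaler0.
Qed.

Lemma field_dir U (g : V -> R) v : smooth g -> supported U (g : V -> R^o) -> field U (fun x => g x *: v).
Proof.
move=> sg [K [cK KU g0]]; split.
  move=> i; rewrite (_ : (fun _ => _) = (fun x => g x * v 0 i)).
    by apply: smoothM => //; exact: smooth_cst.
  by apply/funext => x; rewrite mxE.
by exists K; split => // x /g0 ->; rewrite scale0r.
Qed.

Lemma pderivD f g i x : smooth f -> smooth g ->
  pderiv i (fun y => f y + g y) x = pderiv i f x + pderiv i g x :> R.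
Proof.
move=> sf sg; have df := smooth_is_derive x i sf; have dg := smooth_is_derive x i sg.
have d := is_deriveD df dg; exact: (@derive_val _ _ _ _ _ _ _ d).
Qed.

Lemma pderivM f g i x : smooth f -> smooth g ->
  pderiv i (fun y => f y * g y) x = f x * pderiv i g x + g x * pderiv i f x :> R.
Proof.
move=> sf sg; have df := smooth_is_derive x i sf; have dg := smooth_is_derive x i sg.
have d := is_deriveM df dg; exact: (@derive_val _ _ _ _ _ _ _ d).
Qed.

Lemma pderiv_cst (c : R) i (x : V) : pderiv i (fun=> c) x = 0.
Proof. have d := is_derive_cst c x (delta_mx 0 i : V); exact: (@derive_val _ _ _ _ _ _ _ d). Qed.

Lemma div_add xi eta x : smooth_field xi -> smooth_field eta ->
  div (fun y => xi y + eta y) x = div xi x + div eta x :> R.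
Proof.
move=> sx se; rewrite /div -big_split/=; apply: eq_bigr => i _; rewrite -pderivD//.
by congr (pderiv i _ x); apply/funext => y; rewrite mxE.
Qed.

Lemma div_mul phi xi x : smooth phi -> smooth_field xi ->
  div (fun y => phi y *: xi y) x = phi x * div xi x + \sum_i pderiv i phi x * xi x 0 i :> R.
Proof.
move=> sp sx; rewrite /div mulr_sumr -big_split/=; apply: eq_bigr => i _.
rewrite [X in _ + X]mulrC -pderivM//.
by congr (pderiv i _ x); apply/funext => y; rewrite mxE.
Qed.

Lemma div_dir (g : V -> R) v x : smooth g ->
  div (fun y => g y *: v) x = \sum_i v 0 i * pderiv i g x.
Proof.
move=> sg; rewrite /div; apply: eq_bigr => i _.
rewrite (_ : (fun y => _) = (fun y => g y * v 0 i)); last by apply/funext => y; rewrite mxE.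
rewrite pderivM//; last exact: smooth_cst.
by rewrite pderiv_cst mulr0 add0r.
Qed.

Lemma div_scale (c : R) xi x : smooth_field xi -> div (fun y => c *: xi y) x = c * div xi x.
Proof.
move=> sx; rewrite (div_mul x (smooth_cst c) sx) big1 ?addr0// => i _.
by rewrite pderiv_cst mul0r.
Qed.

Lemma pderiv_supported (f : V -> R) i (K : set V) x : closed K -> (forall y, ~ K y -> f y = 0) ->
  ~ K x -> pderiv i f x = 0.
Proof.
move=> cK f0 nK; rewrite /pderiv (@near_eq_derive _ _ _ f (cst 0)); first exact: derive_cst.
have : nbhs x (~` K) by apply: open_nbhs_nbhs; split => //; rewrite openC.
by apply: filterS => y; exact: f0.
Qed.

Lemma cc_div U xi : field U xi -> cc U (div xi).
Proof.
move=> [sx [K [cK KU f0]]]; split.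
  move=> x; apply: (@cvg_sum_seq R V _ (index_enum 'I_n.+1) (fun i y => pderiv i (fun y => xi y 0 i) y) _ (nbhs x)).
  by move=> i; apply: smooth_cont; apply: smooth_pderiv; exact: sx.
exists K; split => // x nK; rewrite /div big1// => i _.
apply: (@pderiv_supported _ i K x _ _ nK).
  by apply: compact_closed => //; exact: norm_hausdorff.
by move=> y /f0 ->; rewrite mxE.
Qed.

(* The relative perimeter of E in the open set U is at most p. *)
Definition pb (U E : set V) (p : R) : Prop :=
  forall xi, unit_field U xi -> Int E (div xi) <= p.

Lemma admissible_unit_field C xi : admissible_field C xi <-> unit_field C° xi.
Proof.
split=> [[sx cx xC x1]|[[sx [K [cK KU f0]]] x1]].
  split => //; split => //; exists (field_support xi); split => // x nx.
  by apply/eqP; apply: contrapT => /negP x0; apply: nx; exact: subset_closure.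
have clK : closed K by apply: compact_closed => //; exact: norm_hausdorff.
have sK : field_support xi `<=` K.
  rewrite /field_support [X in _ `<=` X](closure_id K).1//; apply: closureS.
  by move=> x /= /eqP x0; apply: contrapT => /f0.
split => //.
- by apply: subclosed_compact cK sK; exact: closed_closure.
- exact: subset_trans KU.
Qed.

Lemma perimeter_pb C E p : lebesgue_measurable E ->
  (perimeter C E <= p%:E)%E <-> pb C° E p.
Proof.
move=> mE; have e xi : unit_field C° xi ->
    (\int[lm]_(x in E) (div xi x)%:E)%E = (Int E (div xi))%:E.
  move=> [/cc_div cx _]; rewrite /Int /Rintegral fineK//.
  exact: (integrable_fin_num mE (cc_integrable cx mE)).
split=> [h xi ux|h].
  rewrite -lee_fin -e//; apply: le_trans h; apply: ereal_sup_ubound.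
  by exists xi => //; apply/admissible_unit_field.
apply: ge_ereal_sup => _ [xi /admissible_unit_field ux <-].
by rewrite e// lee_fin; exact: h.
Qed.

Lemma pbW U U' E p : U `<=` U' -> pb U' E p -> pb U E p.
Proof. by move=> UU' h xi [fx x1]; apply: h; split => //; exact: fieldW fx. Qed.

Lemma pb_ge0 U E p : lebesgue_measurable E -> pb U E p -> 0 <= p.
Proof.
move=> mE /(_ _ (unit_field0 U)); apply: le_trans.
rewrite (_ : Int _ _ = 0)//; rewrite /Int (@eq_Rintegral _ _ _ _ _ (fun=> 0)).
  by rewrite Rintegral_cst// mul0r.
move=> x _; rewrite /div big1// => i _.
by rewrite (_ : (fun y => _) = fun=> 0) ?pderiv_cst//; apply/funext => y; rewrite mxE.
Qed.

(** The supremum of an unbounded set is 0 by convention, so this is the perimeter only when some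
    bound [pb U E p] is known; the lemmas carry that hypothesis. *)
Definition Per (U E : set V) : R := sup [set Int E (div xi) | xi in unit_field U].

Lemma Per_pb U E p : pb U E p -> pb U E (Per U E).
Proof.
move=> h xi ux; apply: ub_le_sup; last by exists xi.
by exists p => _ [eta ue <-]; exact: h.
Qed.

Lemma Per_le U E p : pb U E p -> Per U E <= p.
Proof.
move=> h; apply: ge_sup; first by exists (Int E (div (fun=> 0))), (fun=> 0) => //; exact: unit_field0.
by move=> _ [eta ue <-]; exact: h.
Qed.

Lemma Per_ge0 U E p : lebesgue_measurable E -> pb U E p -> 0 <= Per U E.
Proof. by move=> mE /Per_pb; exact: pb_ge0. Qed.

Lemma Int_div_add U E xi eta : lebesgue_measurable E -> field U xi -> field U eta ->
  Int E (div (fun x => xi x + eta x)) = Int E (div xi) + Int E (div eta).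
Proof.
move=> mE fx fe; rewrite -(Int_add mE (cc_div fx) (cc_div fe)).
by congr Int; apply/funext => x; apply: div_add; [case: fx|case: fe].
Qed.

Lemma Int_div_scale U E (c : R) xi : lebesgue_measurable E -> field U xi ->
  Int E (div (fun x => c *: xi x)) = c * Int E (div xi).
Proof.
move=> mE fx; rewrite -(Int_scale c mE (cc_div fx)).
by congr Int; apply/funext => x; apply: div_scale; case: fx.
Qed.

(** Unit fields supported in disjoint open sets add up to a unit field. *)
Lemma Per_super U U1 U2 E p : lebesgue_measurable E -> U1 `<=` U -> U2 `<=` U ->
  U1 `&` U2 = set0 -> pb U E p -> Per U1 E + Per U2 E <= p.
Proof.
move=> mE U1U U2U U12 h.
have key xi eta : unit_field U1 xi -> unit_field U2 eta ->
    Int E (div xi) + Int E (div eta) <= p.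
  move=> [fx x1] [fe e1].
  have fx' := fieldW U1U fx; have fe' := fieldW U2U fe.
  rewrite -(Int_div_add mE fx' fe'); apply: h; split; first exact: field_add.
  case: fx => _ [K [cK KU x0]]; case: fe => _ [L [cL LU e0]] x.
  have [Kx|nK] := pselect (K x); last by rewrite x0// add0r.
  rewrite (e0 x) ?addr0// => Lx.
  have : (U1 `&` U2) x by split; [exact: KU|exact: LU].
  by rewrite U12.
rewrite -lerBrDr; apply: Per_le => xi ux.
rewrite lerBrDr addrC -lerBrDr; apply: Per_le => eta ue.
by rewrite lerBrDr addrC; exact: key.
Qed.

Lemma Per_super_bigcup U E p (D : nat -> set V) k : lebesgue_measurable E ->
  (forall j, D j `<=` U) -> (forall i j, (i < j)%N -> D i `&` D j = set0) ->
  pb U E p -> \sum_(j < k) Per (D j) E <= p.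
Proof.
move=> mE DU Dd h.
suff : \sum_(j < k) Per (D j) E <= Per (\bigcup_(j < k) D j) E.
  move=> /le_trans; apply; apply: Per_le; apply: pbW h.
  by move=> x [j _ /DU].
elim: k => [|k ih].
  by rewrite big_ord0; apply: (Per_ge0 (p := p)) => //; apply: pbW h => x [].
rewrite big_ord_recr/=.
have hk : pb (\bigcup_(j < k.+1) D j) E (Per (\bigcup_(j < k.+1) D j) E).
  by apply: (Per_pb (p := p)); apply: pbW h => x [j _ /DU].
apply: le_trans (lerD ih (lexx _)) _.
apply: Per_super hk => //.
- by move=> x [j /= jk Dx]; exists j => //=; exact: ltnW.
- by move=> x Dx; exists k => //=.
- apply/seteqP; split => // x [[j /= jk Dx] Dkx].
  by have : (D j `&` D k) x by []; rewrite (Dd _ _ jk).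
Qed.

(** One [g] serves all [E], because its distance to the indicator of [S] is controlled by an open
    set slightly larger than [S]. It will be tested on a region and on a translate of it at once. *)
Lemma smooth_indicator (U S : set V) (eta : R) : open U -> S `<=` U -> mfin S -> 0 < eta ->
  exists g, [/\ smooth g, supported U (g : V -> R^o), forall x, 0 <= g x <= 1
    & forall E, lebesgue_measurable E -> vol (E `&` S) - eta <= Int E g <= vol (E `&` S) + eta].
Proof.
move=> oU SU fS eta0; have eta2 : 0 < eta / 2 by lra.
have [W [oW SO hO]] := outer_regular (proj2 fS) eta2.
pose P := W `&` U; have oP : open P by exact: openI.
have mP : lebesgue_measurable P by exact: open_lebesgue_measurable.
have SP : S `<=` P by move=> x Sx; split; [exact: SO|exact: SU].
have hP : (lm P <= lm S + (eta / 2)%:E)%E.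
  by apply: le_trans hO; apply: lebesgue_outer_le => x [].
have fP : mfin P.
  split => //; apply: le_lt_trans hP _.
  by rewrite volE// -EFinD ltey.
have volPS : vol P <= vol S + eta / 2 by move: hP; rewrite !volE// -EFinD lee_fin.
have [g [sg g01 gK glim]] := open_smooth_approx oP.
have ccg m : cc P (g m) by split; [exact: smooth_cont|exact: gK].
have lim : (fun m => Int P (g m)) @ \oo --> vol P.
  apply: fine_cvg; rewrite /vol fineK; last by rewrite volE.
  have -> : lm P = (\int[lm]_(x in P) (cst 1%E) x)%E by rewrite integral_cst// mul1e.
  apply: (@dominated_cvg _ _ _ lm P mP _ _ (cst 1%E)) => //.
  - by move=> m; apply/measurable_EFinP; apply: measurable_funTS; apply: continuous_measurable; exact: smooth_cont.
  - by move=> x Px; apply/fine_cvgP; split; [exact: nearW|exact: glim].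
  - have := @measurable_bounded_integrable _ _ R lm (cst (1 : R)) P mP; apply; [by case: fP|exact: measurable_cst|].
    by exists 1; split; [exact: num_real|move=> M cM x _ /=; rewrite normr1 ltW].
  - by move=> m x _; rewrite lee_fin; have /andP[? ?] := g01 m x; rewrite ger0_norm.
have : \forall m \near \oo, vol P - eta / 2 <= Int P (g m).
  have := lim; move/cvgrPdist_le => /(_ _ eta2); apply: filterS => m.
  by rewrite ler_norml => /andP[]; lra.
move=> [m _ /(_ m (leqnn m))] hm.
exists (g m); split => //.
- have [K [cK KP g0]] := gK m; exists K; split => // x /KP; by case.
move=> E mE.
have g0 x : ~ P x -> g m x = 0.
  by have [K [_ KP g0]] := gK m => nP; apply: g0 => /KP.
rewrite -(Int_setI E g0) (setIC E P).
have mPE : lebesgue_measurable (P `&` E) by exact: measurableI.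
have gle (x : V) : g m x <= 1 by case/andP: (g01 m x).
have fPE : mfin (P `&` E) by exact: mfinI.
have fPD : mfin (P `\` E) by exact: mfinD.
have up : Int (P `&` E) (g m) <= vol (P `&` E).
  by rewrite -[leRHS]mul1r; apply: Int_vol_le (ccg m) _ _.
have up2 : Int (P `\` E) (g m) <= vol (P `\` E).
  by rewrite -[leRHS]mul1r; apply: Int_vol_le (ccg m) _ _.
have e1 := Int_setU mP mE (ccg m).
have e2 := volID fP mE.
have e3 := volID fP (proj1 fS); rewrite (setIidr SP) in e3.
have e4 := volID fPE (proj1 fS).
have e5 : P `&` E `&` S = E `&` S by rewrite setIC setIA (setIidl SP) setIC.
have e6 : vol (P `&` E `\` S) <= vol (P `\` S).
  by apply: vol_le; [apply: mfinD => //; case: fS|move=> x [[]]].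
rewrite e5 in e4; have := vol_ge0 (P `&` E `\` S) => e7; apply/andP; split; lra.
Qed.

End fields.

(** * Translations and the relative isoperimetric inequality *)

Definition rootn {R : realType} (k : nat) (a : R) : R := a `^ (k%:R^-1).

Lemma rootn_ge0 {R : realType} k (a : R) : 0 <= rootn k a.
Proof. exact: powR_ge0. Qed.

Lemma rootnK {R : realType} k (a : R) : (0 < k)%N -> 0 <= a -> rootn k a ^+ k = a.
Proof.
move=> k0 a0; rewrite /rootn -powR_mulrn ?powR_ge0// -powRrM mulVf ?powRr1//.
by rewrite pnatr_eq0 -lt0n.
Qed.

Section translation.
Context {R : realType} {n : nat}.
Local Notation V := 'rV[R]_n.+1.
Local Notation lm := (@lebesgue R n).
Implicit Types (g : V -> R) (x v : V) (E : set V).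

Lemma aff1E c x : aff c 1 x = x + c :> V.
Proof. by rewrite /aff scale1r addrC. Qed.

Lemma measurable_shift E v : lebesgue_measurable E -> lebesgue_measurable [set x | E (x + v)].
Proof.
move=> mE; rewrite (_ : [set x | _] = aff v 1 @^-1` E).
  by rewrite aff_preimage//; apply: measurable_aff => //; rewrite invr1.
by apply/seteqP; split => x /=; rewrite aff1E.
Qed.

Lemma open_shift E v : open E -> open [set x | E (x + v)].
Proof.
move=> oE; rewrite (_ : [set x | _] = aff v 1 @^-1` E).
  by apply: open_comp => // x _; exact: aff_continuous.
by apply/seteqP; split => x /=; rewrite aff1E.
Qed.

Lemma shift_image E v : [set x | E (x + v)] = aff (- v) 1 @` E.
Proof.
rewrite aff_image// invr1; apply/seteqP; split => x /=; by rewrite aff1E scale1r opprK.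
Qed.

Lemma vol_shift E v : vol [set x | E (x + v)] = vol E.
Proof. by rewrite shift_image vol_aff// expr1n mul1r. Qed.

Lemma mfin_shift E v : mfin E -> mfin [set x | E (x + v)].
Proof. by move=> fE; rewrite shift_image; exact: mfin_aff. Qed.

Lemma Int_shift U E g v : lebesgue_measurable E -> cc U g ->
  Int E (fun x => g (x - v)) = Int [set x | E (x + v)] g.
Proof.
move=> mE cg; rewrite shift_image (Int_aff (- v) ltr01 mE cg) expr1n mul1r.
by congr Int; apply/funext => x; rewrite aff1E.
Qed.

Lemma Tr_supported (W U : set V) g v : supported W (g : V -> R^o) ->
  (forall x t, W x -> 0 <= t -> t <= 1 -> U (x + t *: v)) ->
  supported U (Tr g v : V -> R^o).
Proof.
move=> [K [cK KW g0]] sw; have [cT T0] := Tr_support v cK g0.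
exists [set z.1 + z.2 *: v | z in K `*` `[0, 1]%classic]; split => //.
move=> y [[x t] [/= Kx tU] <-]; move: tU; rewrite in_itv/= => /andP[t0 t1].
by apply: sw => //; exact: KW.
Qed.

Lemma Int_div_Tr (W U : set V) E g v (c : R) : lebesgue_measurable E ->
  smooth g -> supported W (g : V -> R^o) ->
  (forall x t, W x -> 0 <= t -> t <= 1 -> U (x + t *: v)) ->
  let xi := fun x => Tr g v x *: (c *: v) in
  field U xi /\
  Int E (div xi) = c * (Int E g - Int [set x | E (x + v)] g).
Proof.
move=> mE sg gW sw xi.
have fxi : field U xi.
  by apply: field_dir; [exact: smooth_Tr|exact: Tr_supported gW sw].
split => //.
have cg : cc W g by split => //; exact: smooth_cont.
have mS := measurable_shift v mE.
rewrite -(Int_shift v mE cg).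
have cg' : cc (aff (- v) 1 @^-1` W) (fun x => g (x - v)).
  rewrite (_ : (fun x => _) = (fun x => g (aff (- v) 1 x))); first exact: cc_comp_aff.
  by apply/funext => x; rewrite aff1E.
have cg1 := ccW (@subsetT _ W) cg.
have cg2 := ccW (@subsetT _ _) cg'.
rewrite -(Int_sub mE cg1 cg2) -(Int_scale (U := setT) c mE); last first.
  rewrite (_ : (fun x => _) = (fun x => g x + (-1) * g (x - v))).
    by apply: cc_add => //; exact: cc_scale.
  by apply/funext => x; rewrite mulN1r.
congr Int; apply/funext => x; rewrite /xi div_dir; last exact: smooth_Tr.
rewrite -Tr_telescope// mulr_sumr; apply: eq_bigr => i _.
by rewrite mxE mulrA.
Qed.

(** The field is (Tr g v) v / |v| with [g] close to the indicator of the set [S] of escaping points: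
    [E] contains [S] and its translate by - v misses it, so the flux is nearly vol(S) / |v|.
    Convexity keeps the swept segments inside [D]. *)
Lemma translation_estimate (D E : set V) v (p : R) : open D -> cvx D -> mfin D ->
  lebesgue_measurable E -> pb D E p ->
  vol [set x | [/\ D x, D (x + v), E x & ~ E (x + v)]] <= enorm v * p.
Proof.
move=> oD cD fD mE hp.
set S := [set x | _].
have [v0|v0] := eqVneq (enorm v) 0.
  rewrite v0 mul0r (_ : S = set0) ?vol0//; apply/seteqP; split => // x [_ _ Ex].
  by rewrite (enorm_eq0 v0) addr0.
have {}v0 : 0 < enorm v by rewrite lt_neqAle eq_sym v0 enorm_ge0.
pose W := D `&` [set x | D (x + v)].
have oW : open W by apply: openI => //; exact: open_shift.
have mS : lebesgue_measurable S.
  rewrite (_ : S = D `&` [set x | D (x + v)] `&` E `&` ~` [set x | E (x + v)]); last first.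
    by apply/seteqP; split => [x [? ? ? ?]|x [[[? ?] ?] ?]].
  apply: measurableI; last by apply: measurableC; exact: measurable_shift.
  by apply: measurableI => //; exact: open_lebesgue_measurable.
have SW : S `<=` W by move=> x [].
have fS : mfin S by apply: mfinS fD _ _ => // x [].
apply/ler_addgt0Pr => e e0; have e2 : 0 < e / 2 by lra.
have [g [sg gW g01 gI]] := smooth_indicator oW SW fS e2.
have sw x t : W x -> 0 <= t -> t <= 1 -> D (x + t *: v).
  move=> [Dx Dxv] t0 t1; have := cD x (x + v) t Dx Dxv t0 t1.
  by rewrite scalerDr addrA -scalerDl subrK scale1r.
have [fxi e1] := Int_div_Tr (enorm v)^-1 mE sg gW sw.
have ux : unit_field D (fun x => Tr g v x *: ((enorm v)^-1 *: v)).
  split => // x; rewrite !enormZ [`|_^-1|]ger0_norm ?invr_ge0 ?enorm_ge0// mulVf ?gt_eqF// mulr1.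
  have /andP[t0 t1] := Tr_bounds v x (smooth_cont sg) g01.
  by rewrite ger0_norm.
have := hp _ ux; rewrite e1 ler_pdivrMl// => h.
have /andP[h1 _] := gI E mE.
have /andP[_ h2] := gI _ (measurable_shift v mE).
have e3 : E `&` S = S by apply/setIidPr => x [].
have e4 : [set x | E (x + v)] `&` S = set0.
  by apply/seteqP; split => // x [/= Ex [_ _ _]].
rewrite e3 in h1; rewrite e4 vol0 in h2.
lra.
Qed.

Lemma ccube_scale (d r : R) : 0 < r -> ccube 0 (r * d) = aff 0 r @` ccube (0 : V) d.
Proof.
move=> r0; rewrite aff_image//; apply/seteqP; split => x h i; have := h i; rewrite !mxE !subr0;
  rewrite mulr0 oppr0 add0r normrM gtr0_norm ?invr_gt0//.
  by rewrite ler_pdivrMl.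
by rewrite ler_pdivrMl.
Qed.

(** The contraction of [D] towards a point of [S] with ratio [rho] stays in [D] and has twice the
    volume of [S]; so translations of size at most rho d lead from that point to a volume at least
    vol(S) of [D] outside [S]. Double counting against the translation bound gives the inequality.
    The hypothesis is on translations rather than perimeter so that it applies to a region and to
    its complement alike, and the root [s] of the volume avoids fractional powers. *)
Lemma isoperimetric (d v0 : R) : (0 < n)%N -> 0 < d -> 0 < v0 -> exists2 kappa, 0 < kappa &
  forall (D S : set V) (p s : R), open D -> cvx D -> mfin D -> v0 <= vol D ->
    (forall x y i, D x -> D y -> `|x 0 i - y 0 i| <= d) ->
    lebesgue_measurable S -> S `<=` D -> 2 * vol S <= vol D -> 0 <= p ->
    (forall v, vol [set x | [/\ D x, D (x + v), S x & ~ S (x + v)]] <= enorm v * p) ->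
    0 <= s -> s ^+ n.+1 = vol S -> s ^+ n <= kappa * p.
Proof.
move=> n0 d0 v00; pose r0 := rootn n.+1 (2 / v0).
have r00 : 0 < r0 by rewrite powR_gt0// divr_gt0.
have r0N : r0 ^+ n.+1 = 2 / v0 by rewrite rootnK// divr_ge0 ?ltW.
pose B : set V := ccube 0 d.
have fB : mfin B by apply: mfin_compact; exact: compact_ccube.
pose kappa := 2 * (n.+1%:R * (d * (vol B * r0))) / v0.
exists (kappa + 1).
  by rewrite ltr_wpDl// /kappa !mulr_ge0 ?vol_ge0 ?invr_ge0// ltW.
move=> D S p s oD cD fD vD dD mS SD S2 p0 hS s0 sN.
have [->|sn0] := eqVneq s 0.
  by rewrite expr0n; case: n n0 {sN} => //= k _; rewrite mulr_ge0// addr_ge0// /kappa !mulr_ge0 ?vol_ge0 ?invr_ge0// ltW.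
have {}s0 : 0 < s by rewrite lt_neqAle eq_sym sn0.
have vS0 : 0 < vol S by rewrite -sN exprn_gt0.
have vD0 : 0 < vol D by exact: lt_le_trans vD.
pose rho := rootn n.+1 (2 * vol S / vol D).
have rhoN : rho ^+ n.+1 = 2 * vol S / vol D by rewrite rootnK// divr_ge0 ?mulr_ge0 ?vol_ge0.
have rho0 : 0 < rho by rewrite powR_gt0// divr_gt0// mulr_gt0.
have rho1 : rho <= 1.
  have : rho ^+ n.+1 <= 1 by rewrite rhoN ler_pdivrMr// mul1r.
  by rewrite expr_le1// ltW.
have rhos : rho <= s * r0.
  have : rho ^+ n.+1 <= (s * r0) ^+ n.+1.
    rewrite exprMn rhoN r0N sN [leRHS](_ : _ = 2 * vol S / v0); last first.
      by rewrite mulrA (mulrC (vol S)).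
    by rewrite ler_wpM2l ?mulr_ge0 ?vol_ge0// lef_pV2 ?posrE.
  by rewrite ler_pXn2r// nnegrE ?mulr_ge0// ltW.
have fS : mfin S by exact: mfinS fD mS SD.
have [S0 [bS0 SS0 nS0]] := borel_approx mS (proj2 fS).
have mS0 := borel_measurable bS0.
have fS0 : mfin S0.
  rewrite (_ : S0 = S `|` (S0 `\` S)); last first.
    apply/seteqP; split => [x S0x|x [/SS0|[]]//].
    by have [Sx|nSx] := pselect (S x); [left|right].
  by apply: mfinU => //; apply: (mfin_null _ nS0).1; exact: measurableD.
have vS0E : vol S0 = vol S.
  rewrite (volID fS0 mS) (setIidr SS0).
  by have [_ ->] := mfin_null (measurableD mS0 mS) nS0; rewrite addr0.
have bDS : borel (D `\` S0).
  rewrite /borel; apply: (@measurableD _ (g_sigma_algebraType (@open V))) => //.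
  exact: sub_sigma_algebra.
have mB' : lebesgue_measurable (ccube 0 (rho * d) : set V).
  by apply: closed_lebesgue_measurable; exact: closed_ccube.
have fB' : mfin (ccube 0 (rho * d) : set V) by apply: mfin_compact; exact: compact_ccube.
have c0 : (0 <= (n.+1%:R * (rho * d) * p)%:E)%E.
  by rewrite lee_fin !mulr_ge0// ltW.
have := @double_counting R n S (ccube 0 (rho * d)) (D `\` S0) (vol S)%:E
  (n.+1%:R * (rho * d) * p)%:E mS mB' bDS _ c0.
rewrite lee_fin vol_ge0 => /(_ isT).
have hA x : S x -> ((vol S)%:E <= lm (ccube 0 (rho * d) `&` [set v | (D `\` S0) (x + v)%R]))%E.
  move=> Sx; have Dx := SD _ Sx.
  pose Q := aff ((1 - rho) *: x) rho @` D.
  have fQ : mfin Q by exact: mfin_aff.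
  apply: (@le_trans _ _ (lm [set v | (Q `\` S0) (v + x)%R])); last first.
    apply: lebesgue_outer_le => v [[w Dw]]; rewrite /aff => e nS0v; split.
      move=> i; have := congr1 (fun y : V => y 0 i) e; rewrite /= !mxE subr0 => ei.
      rewrite (_ : v 0 i = rho * (w 0 i - x 0 i)); last by lra.
      by rewrite normrM gtr0_norm//; apply: ler_wpM2l; [exact: ltW|exact: dD].
    rewrite /= addrC; split => //; rewrite -e.
    by apply: cD => //; exact: ltW.
  rewrite -[X in (_ <= X)%E]/(lm _) volE; last by apply: mfin_shift; exact: mfinD.
  rewrite lee_fin vol_shift.
  have e1 := volID fQ mS0.
  have e2 : vol Q = 2 * vol S by rewrite vol_aff// rhoN; field; rewrite gt_eqF.
  have e3 : vol (Q `&` S0) <= vol S by rewrite -vS0E; apply: vol_le => // y [].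
  lra.
have hB v : ccube 0 (rho * d) v ->
    (lm (S `&` [set x | (D `\` S0) (x + v)%R]) <= (n.+1%:R * (rho * d) * p)%:E)%E.
  move=> vB; have fX : mfin (S `&` [set x | (D `\` S0) (x + v)%R]).
    apply: mfinI => //; apply: measurable_shift; apply: measurableD => //.
    exact: open_lebesgue_measurable.
  rewrite volE// lee_fin; apply: (@le_trans _ _ (enorm v * p)).
    apply: le_trans (hS v); apply: vol_le.
      apply: mfinS fS _ _; last by move=> x [].
      rewrite (_ : [set x | _] = D `&` [set x | D (x + v)] `&` S `&` ~` [set x | S (x + v)]); last first.
        by apply/seteqP; split => [x [? ? ? ?]|x [[[? ?] ?] ?]].
      have mD := open_lebesgue_measurable oD.
      apply: measurableI; last by apply: measurableC; exact: measurable_shift.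
      by apply: measurableI => //; apply: measurableI => //; exact: measurable_shift.
    by move=> x [Sx [Dxv nS]]; split => //; [exact: SD|move=> Sxv; apply: nS; exact: SS0].
  apply: ler_wpM2r => //; apply: enorm_le_coord; first by rewrite mulr_ge0 ?ltW.
  by move=> i; have := vB i; rewrite mxE subr0.
move=> /(_ hA hB); rewrite !volE// -!EFinM lee_fin ccube_scale// vol_aff// rhoN => h.
have {}h : vol S * vol D <= n.+1%:R * (rho * d) * p * (2 * vol B).
  rewrite -(ler_pM2l vS0).
  have {}h := ler_wpM2r (ltW vD0) h.
  rewrite [leLHS]mulrA; apply: le_trans h _.
  by rewrite le_eqVlt; apply/orP; left; apply/eqP; rewrite -/B; field; rewrite gt_eqF.
have {}h : s ^+ n.+1 * v0 <= (kappa * v0) * p * s.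
  rewrite sN; apply: (@le_trans _ _ (vol S * vol D)); first by rewrite ler_wpM2l// ltW.
  apply: le_trans h _.
  rewrite (_ : _ * _ = (n.+1%:R * d * p * (2 * vol B)) * rho); last by ring.
  rewrite (_ : _ * s = (n.+1%:R * d * p * (2 * vol B)) * (s * r0)); last first.
    by rewrite /kappa; field; rewrite gt_eqF.
  by rewrite ler_wpM2l// !mulr_ge0 ?vol_ge0// ltW.
rewrite mulrDl mul1r; apply: (@le_trans _ _ (kappa * p)); last by rewrite lerDl.
rewrite -(ler_pM2l s0) -exprS -(ler_pM2r v00); apply: le_trans h _.
by rewrite le_eqVlt; apply/orP; left; apply/eqP; ring.
Qed.

End translation.

(** * Perimeter under restriction, complement, homothety and cutting *)

Section perimeter_comparison.
Context {R : realType} {n : nat}.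
Local Notation V := 'rV[R]_n.+1.
Implicit Types (f g phi : V -> R) (xi : V -> V) (x v : V) (E U : set V).

Lemma Int_norm_le E f (c : R) : mfin E -> cc setT f -> 0 <= c -> (forall x, E x -> `|f x| <= c) ->
  `|Int E f| <= c * vol E.
Proof.
move=> fE cf c0 h; have mE := proj1 fE.
have cNf : cc setT (fun x => -1 * f x) by exact: cc_scale.
rewrite ler_norml; apply/andP; split.
  rewrite lerNl -mulN1r -(Int_scale _ mE cf); apply: (Int_vol_le fE cNf c0) => x Ex.
  by rewrite mulN1r (le_trans _ (h x Ex))// -normrN ler_norm.
by apply: (Int_vol_le fE cf c0) => x Ex; rewrite (le_trans _ (h x Ex))// ler_norm.
Qed.

(** By translation invariance the integrals of the difference quotients vanish, and the quotients
    converge uniformly on a fixed cube because the partial derivative is Lipschitz. *)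
Let Int_pderiv_eq0 f i : smooth f -> supported setT (f : V -> R^o) -> Int setT (pderiv i f) = 0.
Proof.
move=> sf [K [cK _ f0]].
have clK : closed K by apply: compact_closed => //; exact: norm_hausdorff.
have sp := smooth_pderiv i sf.
have [M [_ hM]] := compact_bounded cK.
pose r := `|M| + 1.
have Kr x : K x -> `|x| <= r.
  by apply: hM; rewrite (le_lt_trans (ler_norm _))// ltrDl.
have r0 : 0 <= r by rewrite addr_ge0.
pose e : V := delta_mx 0 i.
have ne : `|e| <= 1.
  apply: norm_le_coord => // j; rewrite mxE eqxx/=.
  by case: eqP => _; rewrite ?normr1 ?normr0.
have [L L0 hL] := smooth_lipschitz (r + 2) sp.
have cpf : cc setT (pderiv i f).
  split; first exact: smooth_cont.
  by exists K; split => // x; exact: pderiv_supported.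
have cf : cc setT f by split; [exact: smooth_cont|exists K].
pose B : set V := ccube 0 (r + 1).
have fB : mfin B by apply: mfin_compact; exact: compact_ccube.
apply/eqP; rewrite -normr_le0; apply/ler_addgt0Pr => eps eps0; rewrite add0r.
pose h := Num.min 1 (eps / (L * vol B + 1)).
have LB0 : 0 < L * vol B + 1 by rewrite ltr_wpDl// mulr_ge0// vol_ge0.
have h0 : 0 < h by rewrite lt_min ltr01 divr_gt0.
have h1 : h <= 1 by rewrite ge_min lexx.
have hh : h * (L * vol B) <= eps.
  apply: (@le_trans _ _ (eps / (L * vol B + 1) * (L * vol B))).
    by rewrite ler_wpM2r ?mulr_ge0 ?vol_ge0// ge_min lexx orbT.
  by rewrite -mulrA ler_piMr ?(ltW eps0)// [leLHS]mulrC ler_pdivrMr// mul1r lerDl.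
have mT : lebesgue_measurable (setT : set V) by exact: measurableT.
pose q x := h^-1 * (f x - f (x - h *: e)).
have cfs : cc setT (fun x => f (x - h *: e)).
  have := cc_comp_aff (- (h *: e)) ltr01 cf; rewrite preimage_setT.
  by rewrite (_ : (fun x => f (aff _ _ x)) = (fun x => f (x - h *: e)))//; apply/funext => x; rewrite aff1E.
have cd : cc setT (fun x => f x - f (x - h *: e)).
  rewrite (_ : (fun x => _) = (fun x => f x + (-1) * f (x - h *: e))).
    by apply: cc_add => //; exact: cc_scale.
  by apply/funext => x; rewrite mulN1r.
have cq : cc setT q by exact: cc_scale.
have sT : [set x | [set: V] (x + h *: e)] = setT by apply/seteqP; split.
have q0 : Int setT q = 0.
  by rewrite (Int_scale _ mT cd) (Int_sub mT cf cfs) (Int_shift _ mT cf) sT subrr mulr0.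
rewrite -[Int _ _]subr0 -q0 -(Int_sub mT cpf cq).
have key x : `|pderiv i f x - q x| <= L * h.
  have [xr|xr] := leP `|x| (r + 1).
    have [th hth e1] := mvt_coord i x (- h) sf.
    have -> : q x = pderiv i f (x + th *: e).
      have -> : q x = - h^-1 * (f (x + - h *: e) - f x) by rewrite /q scaleNr; ring.
      by rewrite e1 mulrA mulrNN mulVf ?mul1r// gt_eqF.
    have the : `|th *: e| <= h.
      rewrite normrZ; apply: le_trans (_ : h * 1 <= _); last by rewrite mulr1.
      apply: ler_pM => //; apply: le_trans hth _.
      by rewrite normrN gtr0_norm.
    apply: le_trans (hL _ _ _ _) _.
    - by apply: le_trans xr _; rewrite lerD2l; lra.
    - apply: le_trans (ler_normD _ _) _; lra.
    - by apply: ler_wpM2l => //; rewrite opprD addrA subrr sub0r normrN.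
  have nKx : ~ K x by move=> /Kr; lra.
  have nKs : ~ K (x - h *: e).
    move=> /Kr; apply/negP; rewrite -ltNge.
    have : `|h *: e| <= 1.
      by rewrite normrZ gtr0_norm// (le_trans _ h1)// ler_piMr// ltW.
    have := lerB_normD x (h *: e) => _ n1.
    have : `|x| <= `|x - h *: e| + `|h *: e| by rewrite -{1}(subrK (h *: e) x) ler_normD.
    lra.
  rewrite (pderiv_supported _ clK f0 nKx) /q f0// f0// subrr mulr0 subrr normr0.
  by rewrite mulr_ge0// ltW.
have cB : forall x, ~ B x -> pderiv i f x - q x = 0.
  move=> x nB; have nr : ~ `|x| <= r + 1.
    move=> xr; apply: nB => j; rewrite mxE subr0; exact: le_trans (coord_le_norm _ _) xr.
  have nKx : ~ K x by move=> /Kr hx; apply: nr; lra.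
  have nKs : ~ K (x - h *: e).
    move=> /Kr hx; apply: nr; rewrite -(subrK (h *: e) x).
    apply: le_trans (ler_normD _ _) _; apply: lerD => //.
    by rewrite normrZ gtr0_norm// (le_trans _ h1)// ler_piMr// ltW.
  by rewrite (pderiv_supported _ clK f0 nKx) /q f0// f0// subrr mulr0 subrr.
have cpq : cc setT (fun x => pderiv i f x - q x).
  rewrite (_ : (fun x => _) = (fun x => pderiv i f x + (-1) * q x)).
    by apply: cc_add => //; exact: cc_scale.
  by apply/funext => x; rewrite mulN1r.
rewrite -(Int_setI setT cB) setTI.
apply: le_trans (Int_norm_le fB cpq _ (fun x _ => key x)) _; first by rewrite mulr_ge0// ltW.
by rewrite [leLHS](_ : _ = h * (L * vol B))//; ring.
Qed.

Lemma field_div_eq0 U xi x : field U xi -> ~ U x -> div xi x = 0.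
Proof.
move=> [sx [K [cK KU x0]]] nU.
have clK : closed K by apply: compact_closed => //; exact: norm_hausdorff.
rewrite /div big1// => i _; apply: (@pderiv_supported _ _ _ i K) => //.
  by move=> y /x0 ->; rewrite mxE.
by move=> /KU.
Qed.

Lemma Int_div_eq0 U E xi : lebesgue_measurable E -> U `<=` E -> field U xi -> Int E (div xi) = 0.
Proof.
move=> mE UE [sx [K [cK KU x0]]].
have clK : closed K by apply: compact_closed => //; exact: norm_hausdorff.
have fx : field U xi by split => //; exists K.
have d0 x : ~ E x -> div xi x = 0.
  by move=> nE; apply: (field_div_eq0 fx) => /UE.
rewrite -[E]setTI (Int_setI _ d0).
have mT : lebesgue_measurable (setT : set V) by exact: measurableT.
have ci i : cc setT (fun y => pderiv i (fun z => xi z 0 i) y).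
  split; first by apply: smooth_cont; apply: smooth_pderiv; exact: sx.
  exists K; split => // x; apply: pderiv_supported => // y /x0 ->; by rewrite mxE.
have [_ e] := Rintegral_sum (index_enum 'I_n.+1) mT (fun i => cc_integrable (ci i) mT).
rewrite /Int /div e big1// => i _; apply: Int_pderiv_eq0; first exact: sx.
by exists K; split => // y /x0 ->; rewrite mxE.
Qed.

Lemma pb_restrict U C E (p : R) : U `<=` C -> pb U E p -> pb U (E `&` C) p.
Proof.
move=> UC h xi ux; rewrite Int_setI; first exact: h.
by move=> x nC; apply: (field_div_eq0 (proj1 ux)) => /UC.
Qed.

(** The flux of a field through all of [C] is 0, so its flux through the complement of [E] is that
    of the opposite field through [E]. *)
Lemma pb_compl U (C E : set V) (p : R) : lebesgue_measurable C -> lebesgue_measurable E -> E `<=` C ->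
  U `<=` C -> pb U E p -> pb U (C `\` E) p.
Proof.
move=> mC mE EC UC h xi [fx x1].
have cx := cc_div fx.
have := Int_setU mC mE cx; rewrite (Int_div_eq0 mC UC fx) (setIidr EC) => e.
have fN : field U (fun x => (-1) *: xi x) by apply: field_mul => //; exact: smooth_cst.
have := h (fun x => (-1) *: xi x).
rewrite (Int_div_scale _ mE fx) mulN1r => h'.
apply: le_trans (h' _); first by rewrite -subr_le0 opprK addrC -e.
by split => // x; rewrite scaleN1r enormN.
Qed.

(** The condition on [U] says that pulling a field back keeps its support in [U]. It holds for
    expanding homotheties centred in the interior of [C], and for downward translations. *)
Lemma pb_aff U F c mu (p : R) : 0 < mu -> lebesgue_measurable F ->
  (forall x, U (aff c mu x) -> U x) ->
  pb U F p -> pb U (aff c mu @` F) (mu ^+ n * p).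
Proof.
move=> m0 mF hU h xi [fx x1].
have cx := cc_div fx.
rewrite (Int_aff c m0 mF cx).
case: (fx) => sx [K [cK KU x0]].
pose eta x := xi (aff c mu x).
have fe : field U eta.
  split; first by move=> i; apply: (smooth_comp_aff c mu (sx i)).
  exists (aff c mu @^-1` K); split.
  - rewrite aff_preimage//; apply: continuous_compact => //.
    by apply: continuous_subspaceT; exact: aff_continuous.
  - by move=> x /KU; exact: hU.
  - by move=> x; exact: x0.
have e x : div eta x = mu * div xi (aff c mu x).
  rewrite /div mulr_sumr; apply: eq_bigr => i _.
  have si := sx i.
  have d1 := smooth_is_derive (aff c mu x) i si.
  have d2 : is_derive x (delta_mx 0 i) (fun y => eta y 0 i) (mu * pderiv i (fun y => xi y 0 i) (aff c mu x)).
    apply/is_derive_line; move/is_derive_line : d1 => d1.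
    rewrite (_ : (fun t => _) = ((fun t => xi (aff c mu x + t *: delta_mx 0 i) 0 i) \o (fun t : R => mu *: t))); last first.
      by apply/funext => t /=; rewrite /eta; congr (xi _ 0 i); rewrite /aff scalerDr scalerA addrA.
    have dl : is_derive (0:R) (1:R) (fun t : R => mu *: t) mu.
      by apply: is_derive_eq; rewrite scaler1.
    have dg' : is_derive (mu *: (0:R)) 1 (fun t => xi (aff c mu x + t *: delta_mx 0 i) 0 i)
        (pderiv i (fun y => xi y 0 i) (aff c mu x)) by rewrite scaler0.
    by have := @is_derive1_comp R _ _ 0 _ _ dg' dl; rewrite mulrC.
  exact: (@derive_val _ _ _ _ _ _ _ d2).
have ce := cc_div fe.
have := h eta (conj fe (fun x => x1 _)).
rewrite (_ : Int F (div eta) = mu * Int F (fun x => div xi (aff c mu x))); last first.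
  rewrite -(Int_scale mu mF (cc_comp_aff c m0 cx)).
  by congr Int; apply/funext => x; exact: e.
by move=> h1; rewrite exprSr -mulrA ler_wpM2l// exprn_ge0// ltW.
Qed.

End perimeter_comparison.

Section cut.
Context {R : realType} {n : nat}.
Local Notation V := 'rV[R]_n.+1.
Implicit Types (f g phi : V -> R) (xi : V -> V) (x v : V) (E U : set V).

Lemma Tr_ge g v x (c : R) : continuous g ->
  (forall t, 0 <= t -> t <= 1 -> c <= g (x - t *: v)) -> c <= Tr g v x.
Proof.
move=> cg h.
have -> : c = \int[@lebesgue_measure R]_(t in `[0, 1]%classic) c.
  have mU : fine (@lebesgue_measure R `[0, 1]%classic) = 1.
    by rewrite lebesgue_measure_itv/= lte01 oppr0 adde0.
  by rewrite Rintegral_cst// [X in _ * X]mU mulr1.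
apply: le_Rintegral => //.
- by apply: continuous_compact_integrable; [exact: segment_compact|apply: continuous_subspaceT; exact: cst_continuous].
- exact: segment_integrable.
- by move=> t; rewrite /= in_itv/= => /andP[t0 t1]; exact: h.
Qed.

Lemma Tr_eq0 g v x : (forall t, 0 <= t -> t <= 1 -> g (x - t *: v) = 0) -> Tr g v x = 0.
Proof.
move=> h; rewrite /Tr (@eq_Rintegral _ _ _ _ _ (fun=> 0)).
  by rewrite Rintegral_cst// mul0r.
by move=> t; rewrite inE /= in_itv/= => /andP[t0 t1]; exact: h.
Qed.

Lemma cc_bounded U f : cc U f -> exists2 M, 0 <= M & forall x, `|f x| <= M.
Proof.
move=> [cf [K [cK KU f0]]]; have [r [_ hr]] := compact_bounded cK.
have [M M0 hM] := cont_bounded (`|r| + 1) cf.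
exists M => // x; have [Kx|nK] := pselect (K x); last by rewrite f0// normr0.
by apply: hM; apply: hr => //; rewrite (le_lt_trans (ler_norm _))// ltrDl.
Qed.

Lemma cc_sub U f g : cc U f -> cc U g -> cc U (fun x => f x - g x).
Proof.
move=> cf cg; rewrite (_ : (fun x => _) = (fun x => f x + (-1) * g x)).
  by apply: cc_add => //; exact: cc_scale.
by apply/funext => x; rewrite mulN1r.
Qed.

Lemma vertD x y : vert (x + y) = vert x + vert y :> R.
Proof. by rewrite /vert mxE. Qed.

Lemma vertZ (a : R) x : vert (a *: x) = a * vert x.
Proof. by rewrite /vert mxE. Qed.

Lemma vertN x : vert (- x) = - vert x :> R.
Proof. by rewrite /vert mxE. Qed.

Lemma vert_e : vert (e_vert : V) = 1 :> R.
Proof. by rewrite /vert mxE !eqxx. Qed.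

Lemma vert_continuous : continuous (vert : V -> R).
Proof. exact: coord_continuous. Qed.

Lemma kvert_continuous (k : R) : continuous (fun x : V => k * vert x).
Proof. by apply: contM; [exact: cst_continuous|exact: vert_continuous]. Qed.

Lemma open_kvert (k s : R) : open [set x : V | k * vert x < s].
Proof.
apply: (@open_comp _ _ (fun x : V => k * vert x) [set r | r < s]); last exact: open_lt.
by move=> x _; exact: kvert_continuous.
Qed.

Lemma closed_kvert (k s : R) : closed [set x : V | k * vert x <= s].
Proof.
apply: (@closed_comp _ _ (fun x : V => k * vert x) [set r | r <= s]); last exact: closed_le.
by move=> x _; exact: kvert_continuous.
Qed.

Let dist1 (e a b : R) : 1 - e <= a -> a <= 1 -> 1 - e <= b -> b <= 1 -> `|a - b| <= e.
Proof. by move=> *; rewrite ler_norml; apply/andP; split; lra. Qed.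

Let sub1_le (e p : R) : 1 - e <= p -> 1 - p <= e.
Proof. by move=> *; lra. Qed.

Let onem_expr (u : R) k : 0 <= u -> u < 1 -> 0 <= 1 - (1 - u) ^+ k <= 1.
Proof.
move=> u0 u1; have : 0 <= (1 - u) ^+ k by rewrite exprn_ge0//; lra.
have : (1 - u) ^+ k <= 1 by rewrite exprn_ile1//; lra.
by move=> ? ?; apply/andP; split; lra.
Qed.

Let onem_le (a u : R) k : a <= u -> u < 1 -> (1 - u) ^+ k.+1 <= (1 - a) ^+ k \/ a < 0.
Proof.
move=> au u1; have [a0|a0] := leP 0 a; last by right.
left; apply: (@le_trans _ _ ((1 - u) ^+ k)).
  by rewrite exprS ler_piMl// ?exprn_ge0//; lra.
by apply: lerXn2r; rewrite ?nnegrE; lra.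
Qed.

Let expr_small (a e : R) : 0 < a -> a < 1 -> 0 < e -> exists m, (1 - a) ^+ m <= e.
Proof.
move=> a0 a1 e0.
have lim0 : (fun m => (1 - a) ^+ m) @ \oo --> (0 : R).
  by apply: cvg_expr; rewrite ger0_norm; lra.
move/cvgrPdist_le : lim0 => /(_ _ e0) [m _ /(_ m (leqnn m))].
by rewrite sub0r normrN => hm; exists m; apply: le_trans hm; exact: ler_norm.
Qed.

Let theta_bound (k d th e : R) : 0 < d -> 0 < th -> th <= 2^-1 -> 0 < e -> k * th <= e / 8 ->
  k * d <= (k + e / 4) * (d * (1 - th)).
Proof.
move=> dp th0 th2 e0 kth.
have -> : (k + e / 4) * (d * (1 - th)) = k * d + d * (e / 4 * (1 - th) - k * th) by ring.
rewrite lerDl mulr_ge0 ?(ltW dp)//.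
have : e / 4 * 2^-1 <= e / 4 * (1 - th) by rewrite ler_wpM2l; lra.
lra.
Qed.

Let final_sum (a b c e k q : R) : a <= e / 4 + (k + e / 4) -> b <= e / 4 -> 0 < e -> c <= q ->
  a + b + c <= q + k + e.
Proof. by move=> *; lra. Qed.

Let lt_gap (z s eta : R) : z <= s - eta / 2 -> 0 < eta -> z < s.
Proof. by move=> *; lra. Qed.

Let shift_le (z s eta d d' t : R) : z <= s - d -> d' + eta = d -> 0 < d' -> t <= 1 ->
  z + t * d' <= s - eta.
Proof.
move=> h e d0 t1; have : t * d' <= d' by rewrite ler_piMl// ltW.
lra. Qed.

(* Cutting E at height s costs at most the rate k at which volume accumulates
   just below s.  For kp = -1 the part of E above the height - s is kept. *)
Lemma cut_perimeter (kp s q k : R) U E : kp = 1 \/ kp = -1 -> open U ->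
  lebesgue_measurable E -> pb (U `&` [set x | kp * vert x < s]) E q -> 0 <= k ->
  (forall d0, 0 < d0 -> exists d, [/\ 0 < d, d <= d0,
     mfin (U `&` E `&` [set x | s - d <= kp * vert x < s]) &
     vol (U `&` E `&` [set x | s - d <= kp * vert x < s]) <= k * d]) ->
  pb U (E `&` [set x | kp * vert x < s]) (q + k).
Proof.
move=> kpE oU mE hq k0 hk xi [fxi x1].
have kp2 : kp * kp = 1 by case: kpE => ->; ring.
have nkp : `|kp| = 1 by case: kpE => ->; rewrite ?normrN normr1.
set H := [set x | kp * vert x < s].
have mH : lebesgue_measurable H by apply: open_lebesgue_measurable; exact: open_kvert.
have mF : lebesgue_measurable (E `&` H) by exact: measurableI.
have cD := cc_div fxi.
have [M M0 hM] := cc_bounded cD.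
case: (fxi) => sxi [K [cK KU xi0]].
have fK := mfin_compact cK.
apply/ler_addgt0Pr => e e0.
(* A layer so thin that the term (1 - phi) div xi costs at most e / 4 on it. *)
pose d0 := e / (4 * (M * k + 1)).
have Mk0 : 0 < M * k + 1 by rewrite ltr_wpDl// mulr_ge0.
have d00 : 0 < d0 by rewrite divr_gt0// mulr_gt0.
have [d [dp dd0 fX vX]] := hk _ d00.
set X := (X in vol X) in fX vX.
have Mkd : M * k * d <= e / 4.
  apply: (@le_trans _ _ ((M * k + 1) * d0)).
    apply: ler_pM => //; [exact: mulr_ge0|exact: ltW|by rewrite lerDl].
  by rewrite /d0 le_eqVlt; apply/orP; left; apply/eqP; field; rewrite gt_eqF.
(* The height d of the layer is split: the cutoff falls over d' = d (1 - th), and [eta] leaves room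
   for the smooth step [b]. The bound on [th] makes the slope 1 / d' cost at most e / 4 more than 1
   / d. *)
pose th := Num.min 2^-1 (e / (8 * (k + 1))).
have k10 : 0 < k + 1 by rewrite ltr_wpDl.
have th0 : 0 < th by rewrite lt_min invr_gt0 ltr0n/= divr_gt0// mulr_gt0.
have th2 : th <= 2^-1 by rewrite ge_min lexx.
have the : th * (k + 1) <= e / 8.
  apply: (@le_trans _ _ (e / (8 * (k + 1)) * (k + 1))).
    by apply: ler_wpM2r; [exact: ltW|rewrite ge_min lexx orbT].
  by rewrite le_eqVlt; apply/orP; left; apply/eqP; field; rewrite gt_eqF.
pose d' := d * (1 - th); pose eta := d * th.
have dde : d' + eta = d by rewrite /d' /eta; ring.
have d'0 : 0 < d' by rewrite mulr_gt0// subr_gt0 (le_lt_trans th2)// invf_lt1 ?ltr1n.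
have eta0 : 0 < eta by exact: mulr_gt0.
have inv2 : k * d / d' <= k + e / 4.
  rewrite ler_pdivrMr// /d'; apply: theta_bound => //.
  by apply: le_trans the; rewrite mulrDr mulr1 mulrC lerDl ltW.
pose a := flat 0 (eta / 2).
have a0 : 0 < a by rewrite flat0_gt0 divr_gt0.
have a1 : a < 1 by exact: flat0_lt1.
pose Q := (M + d'^-1) * vol K + 1.
have Md0 : 0 <= M + d'^-1 by rewrite addr_ge0// invr_ge0 ltW.
have Q0 : 0 < Q by rewrite ltr_wpDl// mulr_ge0// vol_ge0.
have [m hm] : exists m, (1 - a) ^+ m <= e / 4 / Q by apply: expr_small => //; rewrite !divr_gt0.
pose em := (1 - a) ^+ m.
have em0 : 0 <= em by rewrite exprn_ge0// subr_ge0 ltW.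
(* A smooth step in the height [kp * vert x]: 0 above s - eta / 2, within [em] of 1 below s -
   eta. *)
pose b x : R := 1 - (1 - flat 0 (- kp * x 0 ord_max + (s - eta / 2))) ^+ m.+1.
have sb : smooth b.
  apply: smoothB; first exact: smooth_cst.
  apply: smoothX; apply: smoothB; first exact: smooth_cst.
  exact: smooth_flat0.
have cb := smooth_cont sb.
have b01 x : 0 <= b x <= 1.
  by apply: onem_expr; [exact: flat_ge0|exact: flat0_lt1].
have b_hi x : s - eta / 2 <= kp * vert x -> b x = 0.
  move=> hx; rewrite /b (_ : flat _ _ = 0) ?subr0 ?expr1n ?subrr//.
  apply/eqP; rewrite eq_le flat_ge0 andbT leNgt flat0_gt0 -leNgt mulNr -/(vert x).
  by rewrite addrC subr_le0.
have b_lo x : kp * vert x <= s - eta -> 1 - em <= b x.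
  move=> hx; rewrite /b lerD2l lerN2.
  set u := flat _ _.
  have au : a <= u.
    apply: flat0_le; rewrite mulNr -/(vert x) addrC lerBrDr.
    by apply: le_trans (lerD (lexx _) hx) _; rewrite le_eqVlt; apply/orP; left; apply/eqP; field.
  have [//|a0'] := onem_le m au (flat0_lt1 _).
  by have := lt_trans a0 a0'; rewrite ltxx.
pose v : V := - (kp * d') *: e_vert.
have kv x t : kp * vert (x - t *: v) = kp * vert x + t * d'.
  rewrite vertD vertN vertZ /v vertZ vert_e mulr1 mulrDr; congr (_ + _).
  by rewrite (_ : kp * _ = kp * kp * (t * d')); [rewrite kp2 mul1r|ring].
(* Averaging the step over a height d' gives a cutoff whose slope is at most 1 / d' by the
   telescoping identity, with no bound on the derivative of [b]. *)
pose phi := Tr b v.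
have sphi : smooth phi by exact: smooth_Tr.
have phi01 x : 0 <= phi x <= 1 by exact: Tr_bounds.
have phi_hi x : s - eta / 2 <= kp * vert x -> phi x = 0.
  move=> hx; apply: Tr_eq0 => t t0 t1; apply: b_hi; rewrite kv.
  by apply: le_trans hx _; rewrite lerDl mulr_ge0// ltW.
have phi_lo x : kp * vert x <= s - d -> 1 - em <= phi x.
  move=> hx; apply: Tr_ge => // t t0 t1; apply: b_lo; rewrite kv.
  exact: shift_le hx dde d'0 t1.
pose sg x := \sum_i pderiv i phi x * xi x 0 i.
have sgE x : `|sg x| <= `|b x - b (x - v)| / d'.
  have pb0 i : i != ord_max -> pderiv i phi x = 0.
    move=> im; rewrite pderiv_Tr//; apply: Tr_eq0 => t _ _.
    have bc : is_derive (x - t *: v) (delta_mx 0 i) b 0.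
      apply/is_derive_line; rewrite (_ : (fun t => _) = cst (b (x - t *: v))); first exact: is_derive_cst.
      apply/funext => h; rewrite /b /= !mxE; do 4 congr (_ _).
      by rewrite (_ : (ord_max == i) = false) ?andbF ?mulr0 ?addr0//; apply/negbTE; rewrite eq_sym.
    exact: (@derive_val _ _ _ _ _ _ _ bc).
  have tel := Tr_telescope v x sb.
  rewrite (bigD1 ord_max)//= big1 in tel; last first.
    by move=> i im; rewrite -/phi pb0// mulr0.
  rewrite addr0 in tel.
  have vm : v 0 ord_max = - (kp * d') by rewrite /v mxE -/(vert e_vert) vert_e mulr1.
  rewrite /sg (bigD1 ord_max)//= big1 ?addr0; last by move=> i im; rewrite pb0// mul0r.
  rewrite -tel vm !normrM normrN normrM nkp mul1r (gtr0_norm d'0).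
  rewrite [d' * _]mulrC mulfK ?gt_eqF// -/phi ler_piMr//.
  exact: le_trans (coord_le_enorm _ _) (x1 x).
pose zeta x := phi x *: xi x.
have fz : field (U `&` H) zeta.
  split.
    by move=> i; have [sz _] := field_mul sphi fxi; exact: sz.
  exists (K `&` [set x | kp * vert x <= s - eta / 2]); split.
  - apply: (subclosed_compact _ cK) => [|x []//]; apply: closedI; last exact: closed_kvert.
    by apply: compact_closed => //; exact: norm_hausdorff.
  - by move=> x [/KU Ux /= hx]; split => //; exact: lt_gap hx eta0.
  - move=> x nx; rewrite /zeta.
    have [Kx|/xi0 ->] := pselect (K x); last by rewrite scaler0.
    rewrite phi_hi ?scale0r//; rewrite leNgt; apply/negP => hx; apply: nx; split => //=.
    exact: ltW.
have uz : unit_field (U `&` H) zeta.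
  split => // x; rewrite enormZ; have /andP[p0 p1] := phi01 x.
  by rewrite ger0_norm// mulr_ile1// enorm_ge0.
have cz := cc_div fz.
have cG := cc_sub cD (ccW (@subIsetl _ U H) cz).
(* What is lost in passing from xi to phi xi: at most M + 1 / d' on the layer, and next to nothing
   below it, where phi is nearly 1. *)
pose G x := div xi x - div zeta x.
have GE x : G x = (1 - phi x) * div xi x - sg x.
  by rewrite /G /zeta div_mul// -/(sg x); ring.
have e1 : Int (E `&` H) (div zeta) <= q.
  rewrite Int_setI; first exact: hq.
  by case: cz => _ [L [_ LU z0]] x nH; apply: z0 => /LU [].
have e2 : Int (E `&` H) (div xi) = Int (E `&` H) G + Int (E `&` H) (div zeta).
  by rewrite (Int_sub mF cD (ccW (@subIsetl _ U H) cz)) subrK.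
have mX : lebesgue_measurable X by case: fX.
have e3 := Int_setU mF mX cG; rewrite -/G in e3.
have XF : X `<=` E `&` H by move=> x [[_ Ex] /= /andP[_ hx]].
rewrite (setIidr XF) in e3.
have hX : Int X G <= (M + d'^-1) * vol X.
  apply: (Int_vol_le fX cG) => // x _; rewrite -/(G x) GE.
  have /andP[p0 p1] := phi01 x.
  have /andP[u0 u1] := b01 x; have /andP[w0 w1] := b01 (x - v).
  apply: le_trans (ler_norm _) _; apply: le_trans (ler_normB _ _) _; apply: lerD.
    rewrite normrM ger0_norm ?subr_ge0//.
    by apply: le_trans (hM x); rewrite ler_piMl// lerBlDl lerDr.
  apply: le_trans (sgE x) _; rewrite ler_pdivrMr// mulVf ?gt_eqF//.
  by apply: dist1; rewrite ?subrr.
have hFX : Int (E `&` H `\` X) G <= em * (M + d'^-1) * vol K.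
  have G0 x : ~ K x -> G x = 0.
    move=> nK; rewrite GE /sg big1 ?subr0.
      rewrite /div big1 ?mulr0// => i _; apply: (@pderiv_supported _ _ _ i K) => //.
        by apply: compact_closed => //; exact: norm_hausdorff.
      by move=> y /xi0 ->; rewrite mxE.
    by move=> i _; rewrite xi0// mxE mulr0.
  rewrite -(Int_setI _ G0).
  have fFK : mfin ((E `&` H `\` X) `&` K).
    by rewrite setIC; apply: mfinI => //; exact: measurableD.
  apply: (@le_trans _ _ (em * (M + d'^-1) * vol ((E `&` H `\` X) `&` K))).
    apply: (Int_vol_le fFK cG); first exact: mulr_ge0.
    move=> x [[[Ex Hx] nX] Kx].
    have hx : kp * vert x < s - d.
      rewrite ltNge; apply/negP => hx; apply: nX; split; first by split => //; exact: KU.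
      by rewrite /= hx.
    rewrite -/(G x) GE.
    have /andP[p0 p1] := phi01 x.
    have pl := phi_lo x (ltW hx).
    have bl1 : 1 - em <= b x.
      by apply: b_lo; have := shift_le (ltW hx) dde d'0 ler01; rewrite mul0r addr0.
    have bl2 : 1 - em <= b (x - v).
      by apply: b_lo; rewrite -[v]scale1r kv; exact: shift_le (ltW hx) dde d'0 _.
    have /andP[u0 u1] := b01 x; have /andP[w0 w1] := b01 (x - v).
    apply: le_trans (ler_norm _) _; apply: le_trans (ler_normB _ _) _; rewrite mulrDr; apply: lerD.
      rewrite normrM ger0_norm ?subr_ge0//.
      by apply: ler_pM => //; rewrite ?subr_ge0//; exact: sub1_le.
    apply: le_trans (sgE x) _; rewrite ler_wpM2r ?invr_ge0 ?(ltW d'0)//.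
    exact: dist1.
  apply: ler_wpM2l; first exact: mulr_ge0.
  by apply: vol_le => // x [].
have hX2 : (M + d'^-1) * vol X <= e / 4 + (k + e / 4).
  apply: (@le_trans _ _ ((M + d'^-1) * (k * d))); first exact: ler_wpM2l.
  by rewrite mulrDl; apply: lerD; [rewrite mulrA|rewrite mulrC].
have hF2 : em * (M + d'^-1) * vol K <= e / 4.
  apply: (@le_trans _ _ (e / 4 / Q * Q)); last by rewrite divfK// gt_eqF.
  rewrite -mulrA; apply: ler_pM => //; first by rewrite mulr_ge0// vol_ge0.
  by rewrite /Q lerDl.
rewrite e2 e3; apply: final_sum e0 e1; [exact: le_trans hX hX2|exact: le_trans hFX hF2].
Qed.

End cut.

(** * Geometry of the convex body *)

Section geometry.
Context {R : realType} {n : nat}.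
Local Notation V := 'rV[R]_n.+1.
Local Notation lm := (@lebesgue R n).
Implicit Types (x y v : V) (E U : set V).

Definition Z (a b : R) : set V := [set x | a < vert x < b].

Definition slab (C : set V) (a b : R) : set V := C° `&` Z a b.

Lemma ZE a b : Z a b = [set x | -1 * vert x < - a] `&` [set x | 1 * vert x < b].
Proof.
by apply/seteqP; split => x /=; rewrite mulN1r mul1r ltrN2 => /andP.
Qed.

Lemma open_Z a b : open (Z a b).
Proof. by rewrite ZE; apply: openI; exact: open_kvert. Qed.

Lemma measurable_Z a b : lebesgue_measurable (Z a b).
Proof. exact/open_lebesgue_measurable/open_Z. Qed.

Lemma measurable_vert_le b : lebesgue_measurable [set x : V | vert x <= b].
Proof. exact: measurable_halfspace. Qed.

Lemma measurable_vert_lt b : lebesgue_measurable [set x : V | vert x < b].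
Proof.
have := open_lebesgue_measurable (@open_kvert R n 1 b).
by rewrite (_ : [set x | _] = [set x : V | vert x < b])//; apply/seteqP; split => x /=; rewrite mul1r.
Qed.

Let conv_gt (a x y t : R) : a < x -> a < y -> 0 <= t -> t <= 1 -> a < (1 - t) * x + t * y.
Proof.
move=> ax ay t0 t1; have [xy|xy] := leP x y.
  by apply: lt_le_trans ax _; have := mulr_ge0 t0 (_ : 0 <= y - x); rewrite subr_ge0 => /(_ xy); lra.
apply: lt_le_trans ay _; have := mulr_ge0 (_ : 0 <= 1 - t) (_ : 0 <= x - y).
by rewrite !subr_ge0 => /(_ t1 (ltW xy)); lra.
Qed.

Let conv_le (x y b t : R) : x <= b -> y <= b -> 0 <= t -> t <= 1 -> (1 - t) * x + t * y <= b.
Proof.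
move=> xb yb t0 t1; have t10 : 0 <= 1 - t by rewrite subr_ge0.
by have := ler_wpM2l t0 yb; have := ler_wpM2l t10 xb; lra.
Qed.

Lemma cvx_Z a b : cvx (Z a b).
Proof.
move=> x y t /= /andP[x1 x2] /andP[y1 y2] t0 t1; rewrite /Z /= vertD !vertZ.
rewrite conv_gt//= -[ltLHS]opprK ltrNl opprD -!mulrN; apply: conv_gt => //; by rewrite ltrN2.
Qed.

Lemma cvx_kvert_le (k b : R) : cvx [set x : V | k * vert x <= b].
Proof.
move=> x y t /= hx hy t0 t1; rewrite vertD !vertZ.
by rewrite (_ : _ * _ = (1 - t) * (k * vert x) + t * (k * vert y)); [exact: conv_le|ring].
Qed.

Lemma cvx_ccube (q : V) r : cvx (ccube q r).
Proof.
move=> x y t hx hy t0 t1 i; rewrite !mxE; have := hx i; have := hy i.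
rewrite (_ : (1 - t) * x 0 i + t * y 0 i - q 0 i = (1 - t) * (x 0 i - q 0 i) + t * (y 0 i - q 0 i)); last by ring.
rewrite !ler_norml => /andP[a1 a2] /andP[b1 b2]; apply/andP; split; last exact: conv_le.
by rewrite -[leRHS]opprK lerNl opprK opprD -!mulrN; apply: conv_le => //; rewrite lerNl.
Qed.

Lemma null_bigcup (A : nat -> set V) : (forall k, lm (A k) = 0%E) -> lm (\bigcup_k A k) = 0%E.
Proof.
move=> A0; apply/eqP; rewrite eq_le lebesgue_outer_ge0 andbT.
have mA k : lebesgue_measurable (A k) by exact: null_measurable.
apply: le_trans (measure_sigma_subadditive lm mA _ (@subset_refl _ _)) _.
  exact: bigcupT_measurable.
by rewrite eseries0 => [|k _ _]; [|exact: A0].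
Qed.

Lemma nullS (A B : set V) : A `<=` B -> lm B = 0%E -> lm A = 0%E.
Proof. by move=> AB B0; apply/eqP; rewrite eq_le lebesgue_outer_ge0 andbT -B0; exact: lebesgue_outer_le. Qed.

Lemma cover_ccube x : exists k : nat, ccube 0 k%:R x /\ cube 0 k.+1%:R x.
Proof.
have := archimedean.Num.Theory.truncnS_gt `|x|; set k := (Num.Def.truncn _).+1 => h.
have hi i : `|x 0 i - (0 : V) 0 i| <= k%:R.
  by rewrite mxE subr0; apply: le_trans (coord_le_norm _ _) (ltW h).
exists k; split=> // i; apply: le_lt_trans (hi i) _; by rewrite ltr_nat.
Qed.

(** Locally the plane is the flat face of a cube cut by a half-space; it lies in the boundary of a
    convex body, which [cvx_null] makes null. *)
Lemma plane_null (b : R) : lm [set x : V | vert x = b] = 0%E.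
Proof.
pose q : V := b *: e_vert.
have vq : vert q = b by rewrite vertZ vert_e mulr1.
pose A (k : nat) : set V := ccube q k.+1%:R `&` [set x | 1 * vert x <= b].
have A0 k : lm (A k `\` (A k)°) = 0%E.
  apply: (@cvx_null _ _ _ (q - 2^-1 *: e_vert)).
  - by apply: cvxI; [exact: cvx_ccube|exact: cvx_kvert_le].
  - apply/nbhs_cubeP; exists 2^-1; first by rewrite invr_gt0.
    move=> x hx; split.
      move=> i.
      have ei : `|(2^-1 *: e_vert : V) 0 i| <= 2^-1.
        rewrite mxE normrM gtr0_norm ?invr_gt0// ler_piMr// mxE.
        by case: (_ && _); rewrite ?normr1 ?normr0.
      rewrite (_ : x 0 i - q 0 i = (x 0 i - (q - 2^-1 *: e_vert) 0 i) - (2^-1 *: e_vert : V) 0 i); last first.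
        by rewrite !mxE; ring.
      apply: le_trans (ler_normB _ _) _; apply: le_trans (lerD (ltW (hx i)) ei) _.
      have : (1 : R) <= k.+1%:R by rewrite ler1n.
      lra.
    have := hx ord_max; rewrite -/(vert x) -/(vert _) vertD vq vertN vertZ vert_e.
    by rewrite /= mul1r ltr_norml => /andP[]; lra.
  - apply: mfin_compact; apply: (subclosed_compact _ (@compact_ccube R n q k.+1%:R)) => [|x []//].
    by apply: closedI; [exact: closed_ccube|exact: closed_kvert].
apply: nullS (null_bigcup A0) => x xb.
have [k [hk _]] := cover_ccube (x - q).
exists k => //; split.
  split; last by rewrite /= mul1r xb.
  move=> i; have := hk i; rewrite !mxE subr0 => /le_trans; apply.
  by rewrite ler_nat.
move=> /nbhs_cubeP[r r0 hr].
have [_ /=] : A k (x + (r / 2) *: e_vert).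
  apply: hr => i; rewrite (_ : _ - _ = r / 2 * (e_vert : V) 0 i); last by rewrite !mxE; ring.
  rewrite mxE; case: (_ && _); rewrite ?mulr1 ?mulr0 ?normr0// gtr0_norm; lra.
rewrite mul1r vertD vertZ vert_e xb mulr1; lra.
Qed.

Lemma vol_diff_null (A B : set V) : mfin A -> lebesgue_measurable B -> B `<=` A ->
  lm (A `\` B) = 0%E -> vol A = vol B.
Proof.
move=> fA mB BA AB0; rewrite (volID fA mB) (setIidr BA).
by have [_ ->] := mfin_null (measurableD (proj1 fA) mB) AB0; rewrite addr0.
Qed.

Lemma vol_Z_split E a b c : a <= b -> b <= c -> mfin (E `&` Z a c) ->
  lebesgue_measurable E ->
  vol (E `&` Z a c) = vol (E `&` Z a b) + vol (E `&` Z b c).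
Proof.
move=> ab bc fE mE.
have f1 : mfin (E `&` Z a b).
  apply: (mfinS fE); first by apply: measurableI => //; exact: measurable_Z.
  by move=> x [Ex /= /andP[h1 h2]]; split => //; apply/andP; split => //; exact: lt_le_trans h2 bc.
have f2 : mfin (E `&` Z b c).
  apply: (mfinS fE); first by apply: measurableI => //; exact: measurable_Z.
  by move=> x [Ex /= /andP[h1 h2]]; split => //; apply/andP; split => //; exact: le_lt_trans ab h1.
rewrite -volU//; last first.
  by apply/seteqP; split => // x [[_ /= /andP[_ h1]] [_ /= /andP[h2 _]]]; lra.
apply: vol_diff_null => //; first by apply: (proj1 (mfinU f1 f2)).
  move=> x [[Ex /= /andP[h1 h2]]|[Ex /= /andP[h1 h2]]]; split => //; apply/andP; split => //.
    exact: lt_le_trans bc.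
  exact: le_lt_trans h1.
apply: nullS (plane_null b) => x [[Ex /= /andP[h1 h2]] nx].
apply/eqP; rewrite eq_le; apply/andP; split; rewrite leNgt; apply/negP => h; apply: nx.
  by right; split => //; rewrite /Z /= h h2.
by left; split => //; rewrite /Z /= h1 h.
Qed.

End geometry.

Section body.
Context {R : realType} {n : nat}.
Local Notation V := 'rV[R]_n.+1.
Local Notation lm := (@lebesgue R n).
Implicit Types (x y v : V) (E U : set V).

(** All that is kept of the hypotheses on [C]: boundedness of the projection and absence of lines
    survive as [body_hor], [body_low] and [body_up]. *)
Record body (C : set V) (zb hb : R) (c0 : V) : Prop := Body {
  body_closed : closed C ;
  body_cvx : cvx C ;
  body_int : C° c0 ;
  body_up : forall x t, C x -> 0 <= t -> C (x + t *: e_vert) ;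
  body_low : forall x, C x -> zb <= vert x ;
  body_hor : forall x i, C x -> i != ord_max -> `|x 0 i| <= hb ;
  body_hb : 0 <= hb }.

(** The chord from [x] to a point very far in the direction [u] reaches the height [t] with a
    horizontal drift that tends to 0, as [C] is horizontally bounded. For [u = -1] this shows that
    heights unbounded below would produce a vertical line. *)
Let recession (C : set V) (u hb : R) : u = 1 \/ u = -1 -> closed C -> cvx C ->
  (forall x i, C x -> i != ord_max -> `|x 0 i| <= hb) -> 0 <= hb ->
  (forall M, exists2 x, C x & M < u * vert x) ->
  forall x t, C x -> 0 <= t -> C (x + t *: (u *: e_vert)).
Proof.
move=> uE cC vC hor hb0 unb x t Cx t0.
have uu : u * u = 1 by case: uE => ->; ring.
apply: cC => B /nbhs_cubeP[r r0 hr].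
have [y Cy hy] := unb (u * vert x + t + (t * (2 * hb) / r + 1)).
pose dl := u * vert y - u * vert x.
have q0 : 0 <= t * (2 * hb) / r by rewrite divr_ge0 ?mulr_ge0// ltW.
have dl0 : 0 < dl by rewrite /dl; lra.
pose s := t / dl.
have s0 : 0 <= s by rewrite divr_ge0// ltW.
have s1 : s <= 1 by rewrite ler_pdivrMr// mul1r /dl; lra.
exists ((1 - s) *: x + s *: y); split; first exact: vC.
apply: hr => i.
rewrite (_ : _ - _ = s * (y 0 i - x 0 i) - t * u * (e_vert : V) 0 i); last by rewrite !mxE; ring.
have [->|im] := eqVneq i ord_max.
  rewrite -!/(vert _) vert_e mulr1 (_ : s * (vert y - vert x) = t * u) ?subrr ?normr0//.
  rewrite (_ : vert y - vert x = u * dl); last by rewrite /dl -mulrBr mulrA uu mul1r.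
  by rewrite mulrCA /s divfK ?gt_eqF// mulrC.
have -> : (e_vert : V) 0 i = 0 by rewrite /e_vert mxE (negbTE im) andbF.
rewrite mulr0 subr0 normrM ger0_norm//.
have : `|y 0 i - x 0 i| <= 2 * hb.
  by apply: le_trans (ler_normB _ _) _; rewrite mulr_natl mulr2n; apply: lerD; exact: hor.
move=> /(ler_wpM2l s0) /le_lt_trans; apply.
have h2 : t * (2 * hb) / r < dl by rewrite /dl; lra.
by rewrite /s mulrAC ltr_pdivrMr// [ltRHS]mulrC -ltr_pdivrMr.
Qed.

Lemma body_of (C : set V) : cylindrically_bounded_convex_body C -> vertical_coordinates C ->
  exists zb hb c0, body C zb hb c0.
Proof.
move=> [cC nbC /convex_set_cvx vC [c0 Cc0] [_ nl]] [[M [_ hM]] unb].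
pose hb := `|M| + 1.
have hb0 : 0 <= hb by rewrite addr_ge0.
have hor x i : C x -> i != ord_max -> `|x 0 i| <= hb.
  move=> Cx im; have iN : (i < n)%N.
    by have := ltn_ord i; rewrite ltnS leq_eqVlt => /predU1P[e|//]; case/eqP: im; exact/val_inj.
  have := hM hb; rewrite (le_lt_trans (ler_norm M)) ?ltrDl// => /(_ isT (horiz x)).
  move=> /(_ (ex_intro2 _ _ x Cx erefl)) hx.
  have -> : x 0 i = horiz x 0 (Ordinal iN) by rewrite mxE; congr (x 0 _); exact: val_inj.
  by apply: le_trans hx; rewrite [leRHS]mx_normrE; apply/bigmax_geP; right => /=; exists (0, Ordinal iN).
have up x t : C x -> 0 <= t -> C (x + t *: e_vert).
  move=> Cx t0; rewrite -(scale1r e_vert); apply: (@recession C 1 hb) => //; first by left.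
  by move=> m; have [y Cy hy] := unb m; exists y => //; rewrite mul1r.
have [zb hzb] : exists zb, forall x, C x -> zb <= vert x.
  apply: contrapT => nb; apply: nl; exists c0, e_vert; split.
    apply/eqP => /(congr1 vert); rewrite vert_e /vert mxE => /eqP; by rewrite oner_eq0.
  have Cc := interior_subset Cc0.
  move=> s; have [s0|s0] := leP 0 s; first exact: up.
  have -> : s *: e_vert = (- s) *: (-1 *: e_vert : V) by rewrite scalerA mulrN1 opprK.
  apply: (@recession C (-1) hb) => //; [by right| |by rewrite oppr_ge0 ltW].
  move=> m; apply: contrapT => nm; apply: nb; exists (- m) => x Cx.
  rewrite leNgt; apply/negP => hx; apply: nm; exists x => //; lra.
by exists zb, hb, c0; split.
Qed.

Context {C : set V} {zb hb : R} {c0 : V} (bC : body C zb hb c0).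

Lemma body_up_int x t : C° x -> 0 <= t -> C° (x + t *: e_vert).
Proof.
move=> /nbhs_cubeP[r r0 h] t0; apply/nbhs_cubeP; exists r => // y hy.
rewrite -(subrK (t *: e_vert) y); apply: (body_up bC) => //; apply: h => i.
have := hy i; rewrite !mxE; congr (_ < _); congr `|_|; ring.
Qed.

Lemma body_low_bounded b : bounded_set (C `&` [set x | vert x <= b]).
Proof.
exists (hb + `|zb| + `|b|); split; first exact: num_real.
move=> M hM x [Cx /= xb]; apply: norm_le_coord.
  apply: le_trans (ltW hM); rewrite !addr_ge0//; exact: body_hb bC.
move=> i; apply: le_trans (ltW hM).
have := body_hb bC; have nz := ler_norm (- zb); have nb := ler_norm b; rewrite normrN in nz.
have b0 : 0 <= `|b| by []. have z0 : 0 <= `|zb| by [].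
have [->|im] := eqVneq i ord_max.
  have := body_low bC Cx; rewrite /vert in xb *; rewrite ler_norml => *; apply/andP; split; lra.
by have := body_hor bC Cx im; lra.
Qed.

Lemma body_measurable : lebesgue_measurable C.
Proof. exact/closed_lebesgue_measurable/(body_closed bC). Qed.

Lemma mfin_below E b : lebesgue_measurable E -> E `<=` C -> E `<=` [set x | vert x <= b] -> mfin E.
Proof.
move=> mE EC Eb; apply: (@mfinS _ _ (C `&` [set x | vert x <= b])) => //.
  apply: mfin_bounded; first exact: body_low_bounded.
  by apply: measurableI; [exact: body_measurable|exact: measurable_vert_le].
by move=> x Ex; split; [exact: EC|exact: Eb].
Qed.

(** [cvx_null] asks for finite volume, so [C] is exhausted by cubes that contain [c0] in their
    interior. *)
Lemma boundary_null : lm (C `\` C°) = 0%E.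
Proof.
have [k0 [_ hk0]] := cover_ccube c0.
pose A (k : nat) : set V := C `&` ccube 0 (k + k0).+1%:R.
have A0 k : lm (A k `\` (A k)°) = 0%E.
  apply: (@cvx_null _ _ _ c0).
  - by apply: cvxI; [exact: body_cvx bC|exact: cvx_ccube].
  - have : nbhs c0 (C° `&` cube 0 (k + k0).+1%:R).
      apply: open_nbhs_nbhs; split; first by apply: openI; [exact: open_interior|exact: open_cube].
      split; first exact: body_int bC.
      by move=> i; apply: lt_le_trans (hk0 i) _; rewrite ler_nat ltnS leq_addl.
    apply: filterS => x [/interior_subset Cx hx]; split => // i; exact: ltW.
  - apply: mfin_compact; apply: (subclosed_compact _ (@compact_ccube R n 0 (k + k0).+1%:R)) => [|x []//].
    by apply: closedI; [exact: body_closed bC|exact: closed_ccube].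
apply: nullS (null_bigcup A0) => x [Cx nx].
have [k [_ hk]] := cover_ccube x.
exists k => //; split.
  by split => // i; apply: le_trans (ltW (hk i)) _; rewrite ler_nat ltnS leq_addr.
by move=> hx; apply: nx; apply: filterS hx => y [].
Qed.

Lemma vol_interior E : mfin E -> E `<=` C -> vol E = vol (E `&` C°).
Proof.
move=> fE EC; have mI : lebesgue_measurable C° by exact/open_lebesgue_measurable/open_interior.
apply: vol_diff_null => //; first by apply: measurableI => //; case: fE.
apply: nullS boundary_null => x [Ex nx]; split; first exact: EC.
by move=> Ix; apply: nx.
Qed.

Lemma open_slab a b : open (slab C a b).
Proof. by apply: openI; [exact: open_interior|exact: open_Z]. Qed.

Lemma cvx_slab a b : cvx (slab C a b).
Proof. by apply: cvxI; [exact: cvx_interior_cvx (body_cvx bC)|exact: cvx_Z]. Qed.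

Lemma slab_sub a b : slab C a b `<=` C.
Proof. by move=> x [/interior_subset]. Qed.

Lemma mfin_slab a b : mfin (slab C a b).
Proof.
apply: (@mfin_below _ b); first exact/open_lebesgue_measurable/open_slab.
- exact: slab_sub.
- by move=> x [_ /= /andP[_ /ltW]].
Qed.

(** Upward translations map the interior of [C] into itself. *)
Lemma vol_slab_mono a a' l : a <= a' -> vol (slab C a (a + l)) <= vol (slab C a' (a' + l)).
Proof.
move=> aa'; rewrite -(vol_shift (slab C a' _) ((a' - a) *: e_vert)).
apply: vol_le; first by apply: mfin_shift; exact: mfin_slab.
move=> x [Cx /= /andP[h1 h2]]; split; first by apply: body_up_int => //; rewrite subr_ge0.
by rewrite /= /Z /= vertD vertZ vert_e mulr1; apply/andP; split; lra.
Qed.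

Lemma vol_slab_split a b c : a <= b -> b <= c ->
  vol (slab C a c) = vol (slab C a b) + vol (slab C b c).
Proof.
move=> ab bc; apply: vol_Z_split => //; first exact: mfin_slab.
exact/open_lebesgue_measurable/open_interior.
Qed.

(** This stands for the n-dimensional volume of the base [K]; as a supremum of slab volumes it needs
    no measure on the base. *)
Definition slab_sup : R := sup [set vol (slab C a (a + 1)) | a in [set: R]].

Let slab_bound a : vol (slab C a (a + 1)) <= vol (ccube (0 : V) (hb + 1)).
Proof.
rewrite -(vol_shift _ (a *: e_vert)); apply: vol_le.
  by apply: mfin_compact; exact: compact_ccube.
move=> x [/interior_subset Cx]; rewrite /= /Z /= vertD vertZ vert_e mulr1 => /andP[h1 h2] i.
rewrite mxE subr0; have [->|im] := eqVneq i ord_max.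
  by rewrite -/(vert x) ler_norml; have := body_hb bC => ?; apply/andP; split; lra.
have := body_hor bC Cx im; rewrite !mxE (negbTE im) andbF mulr0 addr0; lra.
Qed.

Lemma slab_sup_ub a : vol (slab C a (a + 1)) <= slab_sup.
Proof.
apply: ub_le_sup; last by exists a.
by exists (vol (ccube (0 : V) (hb + 1))) => _ [b _ <-]; exact: slab_bound.
Qed.

Lemma slab_sup_lim e : 0 < e -> exists a0, forall a, a0 <= a -> slab_sup - e <= vol (slab C a (a + 1)).
Proof.
move=> e0; have hs : has_sup [set vol (slab C a (a + 1)) | a in [set: R]].
  split; first by exists (vol (slab C 0 (0 + 1))), 0.
  by exists (vol (ccube (0 : V) (hb + 1))) => _ [b _ <-]; exact: slab_bound.
have [_ [a0 _ <-] h] := sup_adherent e0 hs.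
exists a0 => a aa; apply: le_trans (ltW h) _; exact: vol_slab_mono.
Qed.

Lemma slab_nonempty a b : vert c0 <= a -> a < b -> slab C a b !=set0.
Proof.
move=> ca ab; exists (c0 + ((a + b) / 2 - vert c0) *: e_vert); split.
  by apply: body_up_int; [exact: body_int bC|lra].
by rewrite /= /Z /= vertD vertZ vert_e mulr1; apply/andP; split; lra.
Qed.

Lemma vol_slab_gt0 a b : vert c0 <= a -> a < b -> 0 < vol (slab C a b).
Proof. by move=> ca ab; apply: vol_gt0; [exact: mfin_slab|exact: open_slab|exact: slab_nonempty]. Qed.

Lemma slab_sup_gt0 : 0 < slab_sup.
Proof.
apply: lt_le_trans (slab_sup_ub (vert c0)); apply: vol_slab_gt0 => //; by rewrite ltrDl.
Qed.

Lemma vol_slab_iter a l (k : nat) : 0 <= l ->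
  k%:R * vol (slab C a (a + l)) <= vol (slab C a (a + k%:R * l)).
Proof.
move=> l0; elim: k => [|k ih]; first by rewrite mul0r vol_ge0.
have kl : 0 <= k%:R * l by rewrite mulr_ge0.
rewrite (@vol_slab_split a (a + k%:R * l) (a + k.+1%:R * l)); last 2 first.
- by rewrite lerDl.
- by rewrite lerD2l; rewrite ler_wpM2r // ler_nat.
rewrite -natr1 mulrDl mul1r; apply: lerD => //.
rewrite (_ : a + (k%:R + 1) * l = a + k%:R * l + l); last by ring.
by apply: vol_slab_mono; rewrite lerDl.
Qed.

Lemma vol_slab_iter_ge a l (k : nat) : 0 <= l ->
  vol (slab C (a - k%:R * l) a) <= k%:R * vol (slab C a (a + l)).
Proof.
move=> l0; elim: k => [|k ih].
  rewrite mul0r subr0 mul0r (_ : slab C a a = set0) ?vol0//.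
  by apply/seteqP; split => // x [_ /= /andP[h1 h2]]; lra.
have kl : 0 <= k%:R * l by rewrite mulr_ge0.
rewrite (@vol_slab_split (a - k.+1%:R * l) (a - k%:R * l) a); last 2 first.
- by rewrite lerD2l lerN2; rewrite ler_wpM2r // ler_nat.
- by rewrite gerBl.
rewrite -natr1 !mulrDl !mul1r [leLHS]addrC; apply: lerD => //.
rewrite (_ : a - k%:R * l = a - (k%:R * l + l) + l); last by ring.
apply: vol_slab_mono; rewrite gerBl addr_ge0//.
Qed.

Lemma vol_slab_frac a (k : nat) : vol (slab C a (a + k.+1%:R^-1)) <= slab_sup / k.+1%:R.
Proof.
rewrite ler_pdivlMr// mulrC; apply: le_trans (vol_slab_iter a k.+1 _) _.
  by rewrite invr_ge0.
by rewrite mulfV ?pnatr_eq0//; exact: slab_sup_ub.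
Qed.

(** The unit slab below [a] is covered by at most 2 / l slabs of height [l], none of which is larger
    than the one above [a]. *)
Lemma vol_slab_ge a l : 0 < l -> l <= 1 -> l / 2 * vol (slab C (a - 1) a) <= vol (slab C a (a + l)).
Proof.
move=> l0 l1.
have li0 : 0 < l^-1 by rewrite invr_gt0.
pose k := (Num.Def.truncn l^-1).+1.
have kl : l^-1 < k%:R by exact: archimedean.Num.Theory.truncnS_gt.
have kl2 : k%:R <= 2 / l.
  have : (Num.Def.truncn l^-1)%:R <= l^-1 by rewrite archimedean.Num.Theory.truncn_le ltW.
  have : 1 <= l^-1 by rewrite invf_ge1.
  by rewrite /k -natr1; lra.
have h := vol_slab_iter_ge a k (ltW l0).
have h2 : vol (slab C (a - 1) a) <= vol (slab C (a - k%:R * l) a).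
  apply: vol_le; first exact: mfin_slab.
  move=> x [Cx /= /andP[x1 x2]]; split => //; rewrite /Z /= x2 andbT.
  apply: le_lt_trans x1; rewrite lerD2l lerN2.
  by have := ler_wpM2r (ltW l0) (ltW kl); rewrite mulVf ?gt_eqF.
have h3 : vol (slab C (a - 1) a) <= 2 / l * vol (slab C a (a + l)).
  by apply: le_trans h2 _; apply: le_trans h _; rewrite ler_wpM2r// vol_ge0.
rewrite mulrC mulrA ler_pdivrMr// -ler_pdivlMr//; apply: le_trans h3 _.
by rewrite le_eqVlt; apply/orP; left; apply/eqP; ring.
Qed.

(** This is [cut_perimeter] for [E = C], whose relative perimeter is 0: all the perimeter comes from
    the cut, at a rate bounded by [vol_slab_frac]. *)
Lemma pb_lower_part s : pb C° (C `&` [set x | 1 * vert x < s]) slab_sup.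
Proof.
rewrite -[slab_sup]add0r; apply: cut_perimeter.
- by left.
- exact: open_interior.
- exact: body_measurable.
- move=> xi [fx _]; rewrite (Int_div_eq0 body_measurable _ fx)//.
  by move=> x [/interior_subset].
- exact/ltW/slab_sup_gt0.
move=> d0 d00; have [k hk] := ltr_add_invr d00; rewrite add0r in hk.
have fX : mfin (C° `&` C `&` [set x | s - k.+1%:R^-1 <= 1 * vert x < s]).
  apply: (@mfin_below _ s).
  - apply: measurableI; first by apply: measurableI; [exact/open_lebesgue_measurable/open_interior|exact: body_measurable].
    rewrite (_ : [set x | _] = [set x | vert x < s] `\` [set x | vert x < s - k.+1%:R^-1]).
      by apply: measurableD; exact: measurable_vert_lt.
    apply/seteqP; split => x /=; rewrite mul1r; first by move=> /andP[h1 ->]; split => //; apply/negP; rewrite -leNgt.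
    by move=> [-> /negP]; rewrite -leNgt => ->.
  - by move=> x [[]].
  - by move=> x [_ /= /andP[_]]; rewrite mul1r => /ltW.
exists k.+1%:R^-1; split => //; first exact: ltW.
apply: le_trans (vol_slab_frac (s - k.+1%:R^-1) k); rewrite subrK.
rewrite (@vol_diff_null _ _ _ (slab C (s - k.+1%:R^-1) s))//.
- exact/open_lebesgue_measurable/open_slab.
- move=> x [Cx /= /andP[h1 h2]]; split; last by rewrite /= mul1r h2 ltW.
  by split => //; exact: interior_subset.
apply: nullS (plane_null (s - k.+1%:R^-1)) => x [[[Ix Cx] /= /andP[h1 h2]] nx].
rewrite mul1r in h1 h2; apply/eqP; rewrite eq_le h1 andbT leNgt; apply/negP => h3; apply: nx.
by split => //; rewrite /Z /= h3 h2.
Qed.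

End body.

(** * Cells *)

Section cellular.
Context {R : realType} {n : nat}.
Local Notation V := 'rV[R]_n.+1.
Implicit Types (x y v : V) (E U D : set V).

Definition part (b : bool) E D : set V := if b then D `&` E else D `\` E.

(** The bounds [d] and [v0] are common to all cells, so that a single isoperimetric constant serves
    them all. *)
Definition cellular (d v0 : R) D : Prop :=
  [/\ open D, cvx D, mfin D, v0 <= vol D &
    forall x y i, D x -> D y -> `|x 0 i - y 0 i| <= d].

Lemma part_sub b E D : part b E D `<=` D.
Proof. by case: b => x []. Qed.

Lemma measurable_part b E D : lebesgue_measurable E -> lebesgue_measurable D ->
  lebesgue_measurable (part b E D).
Proof. by move=> mE mD; case: b; [exact: measurableI|exact: measurableD]. Qed.

(** For the complement the translation is reversed: entering [E] by [v] is leaving it by - v. *)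
Lemma part_translation b E D v (p : R) : open D -> cvx D -> mfin D ->
  lebesgue_measurable E -> pb D E p ->
  vol [set x | [/\ D x, D (x + v), part b E D x & ~ part b E D (x + v)]] <= enorm v * p.
Proof.
move=> oD cD fD mE hp; case: b.
  rewrite (_ : [set x | _] = [set x | [/\ D x, D (x + v), E x & ~ E (x + v)]]).
    exact: translation_estimate.
  apply/seteqP; split => x /=; first by move=> [h1 h2 [_ h3] h4]; split => // h5; exact: h4.
  by move=> [h1 h2 h3 h4]; split => //; case.
have := @translation_estimate _ _ D E (- v) p oD cD fD mE hp.
rewrite enormN -(vol_shift _ v); congr (vol _ <= _); apply/seteqP; split => x /=; rewrite addrK.
  by move=> [h1 h2 h3 h4]; split => //; case.
by move=> [h1 h2 [_ h3] h4]; split => //; apply: contrapT => h5; apply: h4.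
Qed.

Lemma cell_iso (d v0 : R) : (0 < n)%N -> 0 < d -> 0 < v0 -> exists2 kappa, 0 < kappa &
  forall b D E p s, cellular d v0 D -> lebesgue_measurable E -> pb D E p ->
    2 * vol (part b E D) <= vol D -> 0 <= s -> s ^+ n.+1 = vol (part b E D) ->
    s ^+ n <= kappa * p.
Proof.
move=> n0 d0 v00; have [k k0 hk] := isoperimetric n0 d0 v00.
exists k => // b D E p s [oD cD fD vD dD] mE hp h2 s0 hs.
apply: (hk D (part b E D)) => //.
- by apply: measurable_part => //; case: fD.
- exact: part_sub.
- exact: pb_ge0 hp.
- by move=> v; exact: part_translation.
Qed.

(** With the volume in a cell written as s^(n+1), one factor s is at most [t] and the other factor
    s^n is paid by the perimeter in the cell; the perimeters in disjoint cells add up to at most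
    [p]. *)
Lemma cells_iso (d v0 : R) : (0 < n)%N -> 0 < d -> 0 < v0 -> exists2 kappa, 0 < kappa &
  forall b U E p t k (D : nat -> set V), lebesgue_measurable E -> pb U E p ->
    (forall j, (j < k)%N -> cellular d v0 (D j)) -> (forall j, (j < k)%N -> D j `<=` U) ->
    (forall i j, (i < j)%N -> D i `&` D j = set0) -> 0 <= t -> 2 * t ^+ n.+1 <= v0 ->
    (forall j, (j < k)%N -> vol (part b E (D j)) <= t ^+ n.+1) ->
    \sum_(j < k) vol (part b E (D j)) <= t * (kappa * p).
Proof.
move=> n0 d0 v00; have [c c0 hc] := cell_iso n0 d0 v00.
exists c => // b U E p t k D mE hp cD DU dD t0 tv ht.
have hP j : (j < k)%N -> pb (D j) E (Per (D j) E).
  by move=> jk; exact: Per_pb (pbW (DU j jk) hp).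
apply: (@le_trans _ _ (\sum_(j < k) t * (c * Per (D j) E))).
  apply: ler_sum => j _; have jk := ltn_ord j; set a := vol _; have a0 : 0 <= a by exact: vol_ge0.
  have rK := @rootnK _ n.+1 a (ltn0Sn _) a0; have r0 := rootn_ge0 n.+1 a.
  rewrite -rK exprS; apply: ler_pM => //; first exact: exprn_ge0.
    by rewrite -(@ler_pXn2r _ n.+1)// ?nnegrE// rK ht.
  apply: (hc b (D j) E _ _ (cD j jk) mE (hP j jk)) => //; rewrite -/a.
  have [_ _ _ hv _] := cD j jk; apply: le_trans hv; apply: le_trans tv.
  by rewrite ler_pM2l// ht.
rewrite -!mulr_sumr; apply: ler_wpM2l => //; apply: ler_wpM2l; first exact: ltW.
(* Beyond [k] nothing places the cells inside [U], so they are replaced by the empty set. *)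
pose D' j := if (j < k)%N then D j else set0.
rewrite (eq_bigr (fun j : 'I_k => Per (D' j) E)) => [|j _]; last by rewrite /D' ltn_ord.
apply: (@Per_super_bigcup _ _ U E p D' k mE _ _ hp) => [j|i j ij]; first by rewrite /D'; case: ifP => [/DU//|_ x []].
by rewrite /D'; case: ifP => _; case: ifP => _; rewrite ?set0I ?setI0//; exact: dD.
Qed.

End cellular.

Section layers.
Context {R : realType} {n : nat}.
Local Notation V := 'rV[R]_n.+1.
Context {C : set V} {zb hb : R} {c0 : V} (bC : body C zb hb c0).
Local Notation A := (@slab_sup R n C).
Local Notation slab := (slab C).
Local Notation low := (slab (zb - 1)).
Implicit Types (x y v : V) (E U D : set V).

Lemma lowE s : low s = C° `&` [set x | vert x < s].
Proof.
apply/seteqP; split => x [Cx /=]; first by move=> /andP[].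
move=> h; split => //; apply/andP; split => //.
have := body_low bC (interior_subset Cx); lra.
Qed.

Lemma vol_slab_nat a (k : nat) : vol (slab a (a + k%:R)) <= k%:R * A.
Proof.
elim: k => [|k ih].
  rewrite mul0r addr0 (_ : slab a a = set0) ?vol0//.
  by apply/seteqP; split => // x [_ /= /andP[h1 h2]]; lra.
rewrite (vol_slab_split bC (b := a + k%:R)) ?lerDl ?lerD2l ?ler_nat//.
rewrite -natr1 mulrDl mul1r; apply: lerD => //.
by rewrite addrA; exact: (slab_sup_ub bC).
Qed.

(** An excess over A l would be multiplied by stacking [k] slabs, whereas the stack is covered by at
    most k l + 1 unit slabs: a contradiction for large [k]. *)
Lemma vol_slab_lin a b : a <= b -> vol (slab a b) <= A * (b - a).
Proof.
move=> ab; set l := b - a; have l0 : 0 <= l by rewrite subr_ge0.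
have -> : b = a + l by rewrite addrC subrK.
rewrite leNgt; apply/negP => h.
have x0 : 0 < vol (slab a (a + l)) - A * l by rewrite subr_gt0.
have A0 := ltW (slab_sup_gt0 bC).
pose k := (Num.Def.truncn (A / (vol (slab a (a + l)) - A * l))).+1.
have hk : A < k%:R * (vol (slab a (a + l)) - A * l).
  by rewrite -ltr_pdivrMr//; exact: archimedean.Num.Theory.truncnS_gt.
have kl0 : 0 <= k%:R * l by rewrite mulr_ge0.
have h1 := vol_slab_iter bC a k l0.
pose m := (Num.Def.truncn (k%:R * l)).+1.
have hm : k%:R * l < m%:R by exact: archimedean.Num.Theory.truncnS_gt.
have hm2 : m%:R <= k%:R * l + 1.
  by rewrite /m -natr1 lerD2r archimedean.Num.Theory.truncn_le.
have h2 : vol (slab a (a + k%:R * l)) <= vol (slab a (a + m%:R)).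
  apply: vol_le; first exact: (mfin_slab bC).
  move=> x [Cx /= /andP[x1 x2]]; split => //; rewrite /Z /= x1 /=.
  by apply: lt_trans x2 _; rewrite ltrD2l.
have h3 := vol_slab_nat a m.
have h4 : m%:R * A <= (k%:R * l + 1) * A by apply: ler_wpM2r.
have := le_trans (le_trans h1 h2) (le_trans h3 h4).
rewrite mulrBr in hk; lra.
Qed.

Lemma low_split a b : zb - 1 <= a -> a <= b -> vol (low b) = vol (low a) + vol (slab a b).
Proof. by move=> za ab; apply: (vol_slab_split bC). Qed.

Lemma low_cont : continuous (fun s => vol (low s)).
Proof.
have key a b : a <= b -> `|vol (low b) - vol (low a)| <= A * (b - a).
  move=> ab; have [za|za] := leP (zb - 1) a.
    by rewrite (low_split za ab) addrAC subrr add0r ger0_norm ?vol_ge0// vol_slab_lin.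
  have -> : low a = set0.
    by apply/seteqP; split => // x [_ /= /andP[h1 h2]]; lra.
  rewrite vol0 subr0 ger0_norm ?vol_ge0//.
  apply: le_trans (vol_slab_lin ab); apply: vol_le; first exact: (mfin_slab bC).
  by move=> x [Cx /= /andP[h1 h2]]; split => //; rewrite /Z /= h2 andbT; lra.
have A0 := slab_sup_gt0 bC.
move=> s; apply/cvgrPdist_le => e e0; near=> t.
have h : A * `|s - t| <= e.
  rewrite mulrC -ler_pdivlMr//; apply: ltW; near: t.
  by apply: (@nbhsx_ballx R R s); rewrite divr_gt0.
apply: le_trans h; have [st|st] := leP s t.
  by rewrite distrC [`|s - t|]distrC [`|t - s|]ger0_norm ?subr_ge0//; exact: key.
by rewrite [`|s - t|]ger0_norm ?subr_ge0; [apply: key|]; exact: ltW.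
Unshelve. all: by end_near. Qed.

Lemma low_height (v : R) : 0 <= v -> exists h, vol (low h) = v.
Proof.
move=> v0; pose a := Num.max (zb - 1) (vert c0).
have w0 : 0 < vol (slab a (a + 1)).
  by apply: (vol_slab_gt0 bC); rewrite ?ltrDl// le_max lexx orbT.
pose k := (Num.Def.truncn (v / vol (slab a (a + 1)))).+1.
have hk : v < vol (slab a (a + k%:R)).
  have h1 := vol_slab_iter bC a k (@ler01 R); rewrite mulr1 in h1.
  apply: lt_le_trans h1; rewrite -ltr_pdivrMr//; exact: archimedean.Num.Theory.truncnS_gt.
have l0 : low (zb - 1) = set0.
  by apply/seteqP; split => // x [_ /= /andP[h1 h2]]; lra.
have za : zb - 1 <= a by rewrite le_max lexx.
have zk : zb - 1 <= a + k%:R by rewrite (le_trans za)// lerDl.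
have [||h _ hh] := @IVT R (fun s => vol (low s)) (zb - 1) (a + k%:R) v zk.
- by apply: continuous_subspaceT; exact: low_cont.
- rewrite l0 vol0 ge_min v0 /= le_max (low_split za) ?lerDl//.
  apply/orP; right; apply: le_trans (ltW hk) _; rewrite lerDr vol_ge0//.
by exists h.
Qed.

Lemma low_unbounded M : exists2 v : R, 0 <= v & forall h, v < vol (low h) -> M < h.
Proof.
exists (vol (low M)); first exact: vol_ge0.
move=> h hv; rewrite ltNge; apply/negP => hM; move: hv; rewrite ltNge => /negP; apply.
apply: vol_le; first exact: (mfin_slab bC).
by move=> x; rewrite !lowE => -[Cx /= h1]; split => //; exact: lt_le_trans hM.
Qed.

(** The bottom of [C] may be pointed, and thin slabs there have no common lower bound on their
    volume: everything below [beta] forms one cell, and unit slabs start at [beta]. *)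
Definition cell (beta : R) (j : nat) : set V :=
  slab (if j is i.+1 then beta + i%:R else zb - 1) (beta + j%:R).

(** High enough for the bottom cell to contain the unit slab above [c0], whose volume is
    [cell_vol]. *)
Definition base : R := vert c0 + 1.
(** The term base + 2 - zb is the height of the bottom cell for the largest [beta] in use, base +
    1. *)
Definition cell_diam : R := 2 * hb + (base + 2 - zb).
Definition cell_vol : R := vol (slab (vert c0) (vert c0 + 1)).

Lemma zb_c0 : zb <= vert c0.
Proof. exact: (body_low bC (interior_subset (body_int bC))). Qed.

Lemma cell_vol_gt0 : 0 < cell_vol.
Proof. by apply: (vol_slab_gt0 bC) => //; rewrite ltrDl. Qed.

Lemma cell_diam_gt0 : 0 < cell_diam.
Proof. by have := body_hb bC; have := zb_c0; rewrite /cell_diam /base; lra. Qed.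

Lemma slab_diam a b x y i : b - a <= cell_diam -> slab a b x -> slab a b y ->
  `|x 0 i - y 0 i| <= cell_diam.
Proof.
move=> bd [/interior_subset Cx /= /andP[x1 x2]] [/interior_subset Cy /= /andP[y1 y2]].
have [->|im] := eqVneq i ord_max.
  by rewrite -!/(vert _) ler_norml; apply/andP; split; lra.
apply: le_trans (ler_normB _ _) _.
have := body_hor bC Cx im; have := body_hor bC Cy im; have := zb_c0.
rewrite /cell_diam /base; lra.
Qed.

Lemma slab_cellular a b : cell_vol <= vol (slab a b) -> b - a <= cell_diam ->
  cellular cell_diam cell_vol (slab a b).
Proof.
move=> hv hd; split => //.
- exact: open_slab.
- exact: (cvx_slab bC).
- exact: (mfin_slab bC).
- by move=> x y i; exact: slab_diam.
Qed.

Lemma unit_slab_cellular a : vert c0 <= a -> cellular cell_diam cell_vol (slab a (a + 1)).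
Proof.
move=> ca; apply: slab_cellular; first exact: (vol_slab_mono bC).
by have := body_hb bC; have := zb_c0; rewrite /cell_diam /base; lra.
Qed.

Lemma cell_cellular beta j : base <= beta -> beta <= base + 1 ->
  cellular cell_diam cell_vol (cell beta j).
Proof.
move=> b1 b2; have z0 := zb_c0; case: j => [|j] /=; last first.
  rewrite /cell -natr1 addrA; apply: unit_slab_cellular.
  by have : (0 : R) <= j%:R by []; move: b1; rewrite /base; lra.
rewrite /cell addr0; apply: slab_cellular.
  apply: vol_le; first exact: (mfin_slab bC).
  move=> x [Cx /= /andP[h1 h2]]; split => //; rewrite /Z /=; move: b1; rewrite /base => b1.
  by apply/andP; split; lra.
by have := body_hb bC; rewrite /cell_diam; lra.
Qed.

Lemma cell_disj beta i j : zb - 1 <= beta -> (i < j)%N -> cell beta i `&` cell beta j = set0.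
Proof.
move=> zbb; case: j => // j; rewrite ltnS => ij.
apply/seteqP; split => // x [[_ /= /andP[_ h1]] [_ /= /andP[h2 _]]].
have : (i%:R : R) <= j%:R by rewrite ler_nat.
lra.
Qed.

Lemma cells_sum E beta k : zb - 1 <= beta -> lebesgue_measurable E ->
  \sum_(j < k.+1) vol (E `&` cell beta j) = vol (E `&` low (beta + k%:R)).
Proof.
move=> zbb mE; elim: k => [|k ih]; first by rewrite big_ord_recl big_ord0 addr0.
rewrite big_ord_recr /= ih.
rewrite /cell /slab !setIA [RHS](@vol_Z_split _ _ (E `&` C°) _ (beta + k%:R))//.
- by rewrite (le_trans zbb)// lerDl.
- by rewrite lerD2l ler_nat.
- rewrite -setIA setIC; apply: mfinI => //; exact: (mfin_slab bC).
- by apply: measurableI => //; exact/open_lebesgue_measurable/open_interior.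
Qed.

End layers.

Lemma itv_integral_le {R : realType} (f : R -> R) (lo hi : R) : lo <= hi -> continuous f ->
  (forall s, 0 <= f s <= 1) -> (forall s, ~ `[lo, hi]%classic s -> f s = 0) ->
  \int[@lebesgue_measure R]_(s in `[0, 1]%classic) f s <= hi - lo.
Proof.
move=> lh cf f01 f0.
have m01 : (@lebesgue_measure R `[0%R, 1%R]%classic < +oo)%E.
  by rewrite lebesgue_measure_itv/= lte01 oppr0 adde0 ltry.
have i1 : (@lebesgue_measure R).-integrable `[0, 1]%classic (EFin \o f).
  apply: continuous_compact_integrable; first exact: segment_compact.
  exact: continuous_subspaceT.
have i2 : (@lebesgue_measure R).-integrable `[0, 1]%classic (EFin \o \1_`[lo, hi]%classic).
  by apply: (integrableS (E := setT)) => //; exact: integrable_indic_itv.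
apply: (@le_trans _ _ (\int[@lebesgue_measure R]_(s in `[0, 1]%classic) (\1_`[lo, hi]%classic s))).
  apply: le_Rintegral => // s _; rewrite indicE; case: (boolP (s \in `[lo, hi]%classic)) => hs.
    by case/andP: (f01 s).
  by rewrite f0// => /mem_set; exact/negP.
rewrite /Rintegral integral_indic//.
have e : fine (@lebesgue_measure R `[lo, hi]%classic) = hi - lo.
  rewrite lebesgue_measure_itv/= lte_fin; case: ltP => // hl.
  by rewrite (_ : hi = lo) ?subrr//; apply/eqP; rewrite eq_le hl.
rewrite -e; apply: fine_le.
- rewrite ge0_fin_numE ?measure_ge0//; apply: le_lt_trans m01.
  by apply: le_measure; rewrite ?inE//; exact: measurableI.
- by rewrite lebesgue_measure_itv/=; case: ifP.
- by apply: le_measure; rewrite ?inE//; exact: measurableI.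
Qed.

(** * Large regions of small perimeter *)

Section vertical_transport.
Context {R : realType} {n : nat}.
Local Notation V := 'rV[R]_n.+1.
Implicit Types (x y v : V) (E U D : set V).

(* Along a vertical line g is nonzero for at most a unit of height. *)
Lemma Tr_unit_height (g : V -> R) (a t T : R) x : continuous g -> (forall y, 0 <= g y <= 1) ->
  (forall y, ~ (a < vert y < a + 1) -> g y = 0) -> 0 < T -> t = T \/ t = - T ->
  T * Tr g (t *: e_vert) x <= 1.
Proof.
move=> cg g01 g0 T0 tT.
have [lo [hi [lh hlo hg]]] : exists lo hi, [/\ lo <= hi, hi - lo = T^-1 &
    forall s, ~ (`[lo, hi]%classic s) -> g (x - s *: (t *: e_vert)) = 0].
  case: tT => ->.
    exists ((vert x - a - 1) / T), ((vert x - a) / T); split.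
    - by rewrite ler_pM2r ?invr_gt0//; lra.
    - by rewrite -mulrBl (_ : _ - _ - _ = 1) ?mul1r//; ring.
    move=> s ns; apply: g0 => /andP[h1 h2]; apply: ns; rewrite /= in_itv/=.
    move: h1 h2; rewrite vertD vertN !vertZ vert_e mulr1 => h1 h2.
    by rewrite ler_pdivrMr// ler_pdivlMr//; apply/andP; split; lra.
  exists ((a - vert x) / T), ((a + 1 - vert x) / T); split.
  - by rewrite ler_pM2r ?invr_gt0//; lra.
  - by rewrite -mulrBl (_ : _ - _ - _ = 1) ?mul1r//; ring.
  move=> s ns; apply: g0 => /andP[h1 h2]; apply: ns; rewrite /= in_itv/=.
  move: h1 h2; rewrite vertD vertN !vertZ vert_e mulr1 => h1 h2.
  by rewrite ler_pdivrMr// ler_pdivlMr//; apply/andP; split; lra.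
rewrite -ler_pdivlMl// mulr1 -hlo.
apply: itv_integral_le => //; exact: (segment_cont (x := x) (v := t *: e_vert) cg).
Qed.

Lemma measurable_exit D U E w : lebesgue_measurable D -> lebesgue_measurable U ->
  lebesgue_measurable E ->
  lebesgue_measurable [set x | [/\ D x, U (x + w), E x & ~ E (x + w)]].
Proof.
move=> mD mU mE.
rewrite (_ : [set x | _] = D `&` [set x | U (x + w)] `&` E `&` ~` [set x | E (x + w)]); last first.
  by apply/seteqP; split => [x [? ? ? ?]|x [[[? ?] ?] ?]].
have m1 := measurable_shift w mU; have m2 := measurableC (measurable_shift w mE).
exact: (measurableI _ _ (measurableI _ _ (measurableI _ _ mD m1) mE) m2).
Qed.

(** The field of [translation_estimate], with its norm bound left open: in the applications it is
    added to another field. *)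
Lemma transit (D U E : set V) w (c eta : R) : open D -> D `<=` U -> open U -> cvx U ->
  mfin E -> 0 < eta -> 0 <= c ->
  exists g : V -> R, [/\ smooth g, (forall x, 0 <= g x <= 1), (forall x, ~ D x -> g x = 0),
    field U (fun x => Tr g w x *: (c *: w)) &
    c * (vol [set x | [/\ D x, U (x + w), E x & ~ E (x + w)]] - eta) <=
      Int E (div (fun x => Tr g w x *: (c *: w)))].
Proof.
move=> oD DU oU cU fE eta0 c00; set S := [set x | _]; have mE := proj1 fE.
pose W := D `&` [set x | U (x + w)].
have oW : open W by apply: openI => //; exact: open_shift.
have mS : lebesgue_measurable S by apply: measurable_exit => //; exact: open_lebesgue_measurable.
have SW : S `<=` W by move=> x [].
have fS : mfin S by apply: mfinS fE _ _ => // x [].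
have e2 : 0 < eta / 2 by lra.
have [g [sg gW g01 gI]] := smooth_indicator oW SW fS e2.
have sw x t : W x -> 0 <= t -> t <= 1 -> U (x + t *: w).
  move=> [/DU Dx Dxv] t0 t1; have := cU x (x + w) t Dx Dxv t0 t1.
  by rewrite scalerDr addrA -scalerDl subrK scale1r.
have [fxi e1] := Int_div_Tr c mE sg gW sw.
exists g; split => //.
  by case: gW => K [_ KW K0] x nx; apply: K0 => /KW [].
rewrite e1; apply: ler_wpM2l => //.
have /andP[h1 _] := gI E mE.
have /andP[_ h2] := gI _ (measurable_shift w mE).
have e3 : E `&` S = S by apply/setIidPr => x [].
have e4 : [set x | E (x + w)] `&` S = set0.
  by apply/seteqP; split => // x [/= Ex [_ _ _]].
rewrite e3 in h1; rewrite e4 vol0 in h2.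
lra.
Qed.

Lemma vert_vanish E (a e : R) : mfin E -> 0 < e ->
  exists k : nat, vol (E `&` [set x | a + k%:R < vert x]) <= e.
Proof.
move=> fE e0; pose F (k : nat) := E `&` [set x | a + k%:R < vert x].
have mF k : lebesgue_measurable (F k).
  apply: measurableI; first by case: fE.
  rewrite (_ : [set x | _] = ~` [set x | vert x <= a + k%:R]).
    by apply: measurableC; exact: measurable_vert_le.
  by apply/seteqP; split => x /=; [move=> h; apply/negP; rewrite -ltNge|move=> /negP; rewrite -ltNge].
have F0 : mfin (F 0%N) by apply: mfinS fE _ _ => // x [].
have nF : {homo F : i j / (i <= j)%N >-> (j <= i)%O}.
  move=> i j ij; apply/subsetPset => x [Ex /= hx]; split => //=.
  by apply: le_lt_trans hx; rewrite lerD2l ler_nat.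
have := vol_bigcap_cvg F0 mF nF.
rewrite (_ : \bigcap_i F i = set0); last first.
  apply/seteqP; split => // x hx.
  have [_ /=] := hx (Num.Def.truncn `|vert x - a|).+1 I.
  have h1 := archimedean.Num.Theory.truncnS_gt `|vert x - a|.
  have h2 := ler_norm (vert x - a); lra.
rewrite vol0 => /(@cvgrPdist_le R R^o nat \oo) /(_ e e0)[k _ hk].
by exists k; have := hk k (leqnn k); rewrite /= sub0r normrN ger0_norm ?vol_ge0.
Qed.

End vertical_transport.

Section near_full.
Context {R : realType} {n : nat}.
Local Notation V := 'rV[R]_n.+1.
Context {C : set V} {zb hb : R} {c0 : V} (bC : body C zb hb c0).
Local Notation A := (@slab_sup R n C).
Local Notation slab := (slab C).
Local Notation low := (slab (zb - 1)).
Implicit Types (x y v : V) (E U D : set V).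

Let oI : open C° := open_interior C.
Let mI : lebesgue_measurable C° := open_lebesgue_measurable oI.

(** Nothing bounds the height of [E] yet, while sums over cells are finite; the volume is recovered
    as a limit. *)
Lemma vol_exhaust E M (b : R) : mfin E -> E `<=` C ->
  (forall k : nat, vol (E `&` low (b + k%:R)) <= M) -> vol E <= M.
Proof.
move=> fE EC h; rewrite (vol_interior bC fE EC).
pose F (k : nat) := E `&` low (b + k%:R).
have uF : \bigcup_k F k = E `&` C°.
  apply/seteqP; split=> [x [k _ [Ex []]]//|x [Ex Cx]].
  exists (Num.Def.truncn `|vert x - b|).+1 => //; split => //.
  rewrite (lowE bC); split => //=.
  have h1 := archimedean.Num.Theory.truncnS_gt `|vert x - b|.
  have h2 := ler_norm (vert x - b); lra.
have mF k : lebesgue_measurable (F k).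
  apply: measurableI; first by case: fE.
  exact/open_lebesgue_measurable/open_slab.
have := @vol_bigcup_cvg _ _ F mF; rewrite uF => cF.
have {}cF : (fun i => vol (F i)) @ \oo --> vol (E `&` C°).
  apply: cF; last exact: mfinI.
  move=> i j ij; apply/subsetPset => x [Ex]; rewrite !(lowE bC) => -[Cx /= hx].
  by split => //; rewrite (lowE bC); split => //=; apply: lt_le_trans hx _; rewrite lerD2l ler_nat.
rewrite -(cvg_lim (@Rhausdorff R) cF).
apply: limr_le; first by apply/cvg_ex; exists (vol (E `&` C°)).
by near=> k; exact: h.
Unshelve. all: by end_near. Qed.

(** Otherwise every cell high up satisfies vol(E in the cell) <= K Per: either [E] is the smaller
    part there, or its complement is, but then the complement has volume more than e / 2 and hence a
    definite perimeter. Summing over the cells bounds the volume of [E]. *)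
Lemma near_full e : (0 < n)%N -> 0 < e -> exists v1 : R, forall E, mfin E -> E `<=` C ->
  pb C° E A -> v1 < vol E -> exists a, A - e <= vol (E `&` slab a (a + 1)).
Proof.
move=> n0 e0.
have [kp kp0 hkp] := cell_iso n0 (cell_diam_gt0 bC) (cell_vol_gt0 bC).
have A0 := slab_sup_gt0 bC.
have e2 : 0 < e / 2 by lra.
have [a0 ha0] := slab_sup_lim bC e2.
pose b := Num.max a0 (vert c0).
have za : zb - 1 <= b by rewrite le_max (_ : zb - 1 <= vert c0) ?orbT//; have := zb_c0 bC; lra.
(* As q <= 1, q^(n+1) <= q <= e / 2; so [q] is at most the root of the volume that is missing in a
   cell. *)
pose q := Num.min 1 (e / 2).
have q0 : 0 < q by rewrite lt_min ltr01 e2.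
pose K := ((1 + A) + A / q ^+ n) * kp.
have K0 : 0 <= K.
  by rewrite /K mulr_ge0 ?(ltW kp0)// addr_ge0 ?divr_ge0 ?exprn_ge0 ?addr_ge0 ?(ltW A0) ?(ltW q0).
exists (vol (low b) + K * A) => E fE EC pE hv; have mE := proj1 fE.
apply: contrapT => nf; move: hv; rewrite ltNge => /negP; apply.
apply: (vol_exhaust (b := b)) => // k.
rewrite -(cells_sum bC _ za)// big_ord_recl; apply: lerD.
  rewrite /cell addr0; apply: vol_le; first exact: (mfin_slab bC).
  by move=> x [].
pose D j := slab (b + j%:R) (b + j%:R + 1).
have cD j : cellular (cell_diam (zb := zb) (hb := hb) (c0 := c0)) (cell_vol (C := C) (c0 := c0)) (D j).
  apply: (unit_slab_cellular bC).
  have : vert c0 <= b by rewrite le_max lexx orbT.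
  have : (0 : R) <= j%:R by []. by move=> ? ?; lra.
have hP j : pb (D j) E (Per (D j) E) by apply: Per_pb; apply: pbW pE => x [].
have key j : vol (E `&` D j) <= K * Per (D j) E.
  have P0 := pb_ge0 mE (hP j).
  have fD := mfin_slab bC (b + j%:R) (b + j%:R + 1).
  have e1 := volID fD mE; rewrite -/(D j) in e1.
  have hA : vol (D j) <= A by exact: (slab_sup_ub bC).
  have hA2 : A - e / 2 <= vol (D j).
    apply: ha0; have : a0 <= b by rewrite le_max lexx.
    have : (0 : R) <= j%:R by []. by move=> ? ?; lra.
  have lt_e : vol (E `&` D j) < A - e.
    by rewrite ltNge; apply/negP => h; apply: nf; exists (b + j%:R).
  have b0 : 0 <= vol (D j `\` E) by exact: vol_ge0.
  rewrite setIC in lt_e *.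
  have a00 : 0 <= vol (D j `&` E) by exact: vol_ge0.
  set a := vol (D j `&` E) in e1 lt_e a00 *.
  have [h|h] := leP (2 * a) (vol (D j)).
    have r0 := rootn_ge0 n.+1 a; have rK := @rootnK _ n.+1 a (ltn0Sn _) a00.
    have hr := hkp true (D j) E (Per (D j) E) (rootn n.+1 a) (cD j) mE (hP j) h r0 rK.
    have r1 : rootn n.+1 a <= 1 + A.
      have [r1|r1] := leP (rootn n.+1 a) 1; first by lra.
      have : rootn n.+1 a <= rootn n.+1 a ^+ n.+1 by rewrite ler_eXnr ?ltW.
      by rewrite rK; lra.
    rewrite -[X in X <= _]rK exprS.
    apply: (@le_trans _ _ ((1 + A) * (kp * Per (D j) E))).
      by apply: ler_pM => //; exact: exprn_ge0.
    rewrite mulrA; apply: ler_wpM2r => //; apply: ler_wpM2r; first exact: ltW.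
    by rewrite lerDl divr_ge0 ?exprn_ge0 ?(ltW A0) ?(ltW q0).
  have h' : 2 * vol (part false E (D j)) <= vol (D j) by rewrite /part; lra.
  set bb := vol (D j `\` E) in e1 b0.
  have r0 := rootn_ge0 n.+1 bb; have rK := @rootnK _ n.+1 bb (ltn0Sn _) b0.
  have hr := hkp false (D j) E (Per (D j) E) (rootn n.+1 bb) (cD j) mE (hP j) h' r0 rK.
  have qr : q <= rootn n.+1 bb.
    rewrite -(@ler_pXn2r _ n.+1)// ?nnegrE// ?(ltW q0)// rK.
    apply: (@le_trans _ _ q); first by rewrite ler_iXnr ?(ltW q0)// ge_min lexx.
    by apply: (@le_trans _ _ (e / 2)); [rewrite ge_min lexx orbT|lra].
  have qn0 : 0 < q ^+ n by rewrite exprn_gt0.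
  have qP : q ^+ n <= kp * Per (D j) E.
    by apply: le_trans hr; rewrite lerXn2r ?nnegrE ?(ltW q0).
  apply: (@le_trans _ _ (A / q ^+ n * (kp * Per (D j) E))).
    apply: (@le_trans _ _ (A / q ^+ n * q ^+ n)); first by rewrite divfK ?gt_eqF//; lra.
    by apply: ler_wpM2l => //; rewrite divr_ge0 ?(ltW A0) ?(ltW qn0).
  rewrite mulrA; apply: ler_wpM2r => //; apply: ler_wpM2r; first exact: ltW.
  by rewrite lerDr; lra.
apply: (@le_trans _ _ (\sum_(j < k) K * Per (D j) E)).
  apply: ler_sum => j _; apply: le_trans (key j).
  by rewrite /cell /= /D /bump /= add1n -natr1 addrA.
rewrite -mulr_sumr; apply: ler_wpM2l => //.
apply: (@Per_super_bigcup _ _ C°) => //; first by move=> j x [].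
move=> i j ij; have := @cell_disj _ _ C zb b i.+1 j.+1 za ij.
by rewrite /cell -!natr1 !addrA.
Qed.

End near_full.

Section small_transport.
Context {R : realType} {n : nat}.
Local Notation V := 'rV[R]_n.+1.
Context {C : set V} {zb hb : R} {c0 : V} (bC : body C zb hb c0).
Local Notation A := (@slab_sup R n C).
Local Notation slab := (slab C).
Implicit Types (x y v w : V) (E U D : set V).

Let oI : open C° := open_interior C.

(* A vertical test field whose flux is within 2 s^2 of the largest possible
   perimeter: any field that can be combined with it has small flux. *)
Definition flux_saturated E (s : R) : Prop := exists psi : V -> R,
  [/\ field C° (fun x => psi x *: e_vert), forall x, 0 <= psi x <= 1 &
      A - 2 * s ^+ 2 <= Int E (div (fun x => psi x *: e_vert))].

(** The nearly full slab is moved up by a height [T] that clears [E] up to a volume s^2 / 4. The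
    flux is then nearly the volume of [E] in the slab, and the field has norm at most 1 because a
    vertical line meets the slab in at most unit length. *)
Lemma near_full_saturated E s a : mfin E -> 0 < s ->
  A - s ^+ 2 <= vol (E `&` slab a (a + 1)) -> flux_saturated E s.
Proof.
move=> fE s0 hE; have mE := proj1 fE.
set D := slab a (a + 1); have oD : open D by exact: open_slab.
have s2 : 0 < s ^+ 2 by rewrite exprn_gt0.
have e0 : 0 < s ^+ 2 / 4 by rewrite divr_gt0.
have [k hk] := vert_vanish a fE e0.
have fS : mfin (E `&` D) by apply: mfinI => //; exact: open_lebesgue_measurable.
have [g [sg gD g01 gI]] := smooth_indicator oD (@subIsetr _ E D) fS e0.
pose T : R := k.+1%:R; have T0 : 0 < T by rewrite ltr0n.
have sw x t : D x -> 0 <= t -> t <= 1 -> C° (x + t *: (T *: e_vert)).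
  move=> [Cx _] t0 t1; rewrite scalerA; apply: (body_up_int bC) => //.
  by rewrite mulr_ge0// ltW.
have [fxi e1] := Int_div_Tr 1 mE sg gD sw.
have ex : (fun x => Tr g (T *: e_vert) x *: (1 *: (T *: e_vert))) =
          (fun x => (T * Tr g (T *: e_vert) x) *: e_vert) :> (V -> V).
  by apply: funext => x; rewrite scale1r scalerA mulrC.
rewrite ex in fxi e1.
exists (fun x => T * Tr g (T *: e_vert) x); split => //.
  move=> x; have /andP[t0 _] := Tr_bounds (T *: e_vert) x (smooth_cont sg) g01.
  rewrite mulr_ge0 ?(ltW T0)//=; apply: (@Tr_unit_height _ _ g a T) => //; first exact: smooth_cont.
    move=> y ny; case: gD => K [_ KD K0]; apply: K0 => /KD [_ /=]; exact: ny.
  by left.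
rewrite e1 mul1r.
have /andP[h1 _] := gI E mE.
have /andP[_ h2] := gI _ (measurable_shift (T *: e_vert) mE).
rewrite setIA setIid in h1.
have h3 : vol ([set x | E (x + T *: e_vert)] `&` (E `&` D)) <= s ^+ 2 / 4.
  apply: le_trans hk; rewrite -(vol_shift (E `&` _) (T *: e_vert)); apply: vol_le.
    apply: mfin_shift; apply: mfinI => //.
    have := open_lebesgue_measurable (@open_kvert R n (-1) (- (a + k%:R))).
    rewrite (_ : [set x | _] = [set x : V | a + k%:R < vert x])//.
    by apply/seteqP; split => x /=; rewrite mulN1r ltrN2.
  move=> x [/= Ex [_ [_ /= /andP[x1 _]]]]; split => //=.
  rewrite vertD vertZ vert_e mulr1 /T -natr1; lra.
move: hE; rewrite -/D => hE.
move: s2 h1 h2 h3 hE; move: (Int E g) (Int _ g) (vol (E `&` D)) (vol _) (s ^+ 2) => *; lra.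
Qed.

Lemma enorm_e : enorm (e_vert : V) = 1.
Proof.
rewrite /enorm (_ : dot _ _ = 1) ?sqrtr1// /dot (bigD1 ord_max)//= big1 ?addr0.
  by rewrite -/(vert _) vert_e mulr1.
by move=> i im; rewrite /e_vert mxE (negbTE im) andbF mulr0.
Qed.

Let dist01 (p q : R) : 0 <= p -> p <= 1 -> 0 <= q -> q <= 1 -> `|p - q| <= 1.
Proof. by move=> *; rewrite ler_norml; apply/andP; split; lra. Qed.

(** The downward field is opposed to psi: both have size in [0, 1], so their sum is a unit field
    with no loss of weight, and the downward flux is at most the 2 s^2 that psi leaves. *)
Lemma drop_small E s a t : mfin E -> E `<=` C -> pb C° E A -> flux_saturated E s ->
  0 < t ->
  vol [set x | [/\ slab a (a + 1) x, C° (x - t *: e_vert), E x & ~ E (x - t *: e_vert)]]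
    <= 2 * s ^+ 2.
Proof.
move=> fE EC pE [psi [fpsi psi01 hpsi]] t0; have mE := proj1 fE.
rewrite -scaleNr; apply/ler_addgt0Pr => eta eta0.
have DU : slab a (a + 1) `<=` C° by move=> x [].
have [g [sg g01 g0 fxi hxi]] := transit (- t *: e_vert) (open_slab (C:=C) (a:=a) (b:=a+1)) DU oI
  (cvx_interior_cvx (body_cvx bC)) fE eta0 (@ler01 R).
set xi := (fun x => _ *: (1 *: _)) in fxi hxi.
have ux : unit_field C° (fun x => psi x *: e_vert + xi x).
  split; first exact: field_add.
  move=> x; rewrite /xi scale1r scalerA -scalerDl mulrN enormZ.
  rewrite enorm_e.
  rewrite mulr1; have /andP[p0 p1] := psi01 x.
  have /andP[q0 _] := Tr_bounds (- t *: e_vert) x (smooth_cont sg) g01.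
  have q1 : t * Tr g (- t *: e_vert) x <= 1.
    apply: (@Tr_unit_height _ _ g a (- t) t) => //; [exact: smooth_cont| |by right].
    move=> y ny; apply: g0 => -[_ /=]; exact: ny.
  have q2 : 0 <= t * Tr g (- t *: e_vert) x by rewrite mulr_ge0// ltW.
  rewrite mulrC; exact: dist01.
have := pE _ ux; rewrite (Int_div_add mE fpsi fxi) => h.
move: hxi h hpsi; rewrite mul1r; move: (Int E _) (Int E _) (vol _) (s ^+ 2) => *; lra.
Qed.

Let combine (a s e q W : R) : 0 < s -> 0 < e -> s <= 1 ->
  (1 - s ^+ 2) * (a - 2 * s ^+ 2) + 2 * s * (e^-1 * (W - q)) <= (1 + s ^+ 2) * a ->
  0 <= s ^+ 2 ->
  W <= e * (s * (a + 1)) + q.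
Proof.
move=> s0 e0 s1 h s2.
have h1 : 2 * s * (e^-1 * (W - q)) <= 2 * s * (s * (a + 1)).
  have : 0 <= s ^+ 2 * s ^+ 2 by rewrite mulr_ge0.
  have -> : 2 * s * (s * (a + 1)) = 2 * s ^+ 2 * (a + 1) by ring.
  lra.
have s20 : 0 < 2 * s by lra.
by move: h1; rewrite ler_pM2l// ler_pdivrMl//; lra.
Qed.

Let div_combine (a b q x y : R) : (a * x + b * y) / q = a / q * x + b / q * y.
Proof. ring. Qed.

(** A horizontal field is orthogonal to the vertical one, so weights with al^2 + be^2 = 1 keep the
    norm at most 1. A weight [be] close to 2 s lowers the vertical flux by order s^2 only, which
    leaves order s for the horizontal flux. *)
Lemma slide_small E s v : mfin E -> E `<=` C -> pb C° E A -> flux_saturated E s ->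
  0 < s -> s <= 1 -> vert v = 0 ->
  vol [set x | [/\ C° x, C° (x + v), E x & ~ E (x + v)]] <= enorm v * (s * (A + 1)).
Proof.
move=> fE EC pE [psi [fpsi psi01 hpsi]] s0 s1 v0; have mE := proj1 fE.
set S := [set x | _].
have [e0|e0] := eqVneq (enorm v) 0.
  rewrite e0 mul0r (_ : S = set0) ?vol0//; apply/seteqP; split => // x [_ _ Ex].
  by rewrite (enorm_eq0 e0) addr0.
have {}e0 : 0 < enorm v by rewrite lt_neqAle eq_sym e0 enorm_ge0.
apply/ler_addgt0Pr => eta eta0.
have ei0 : 0 <= (enorm v)^-1 by rewrite invr_ge0 ltW.
have [g [sg g01 g0 fxi hxi]] := transit v oI (@subset_refl _ C°) oI
  (cvx_interior_cvx (body_cvx bC)) fE eta0 ei0.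
rewrite -/S in hxi.
set xi := (fun x => _ *: (_ *: _)) in fxi hxi.
have q0 : 0 < 1 + s ^+ 2 by rewrite ltr_wpDr// sqr_ge0.
(* A rational parametrization of the circle, to avoid square roots. *)
pose al := (1 - s ^+ 2) / (1 + s ^+ 2); pose be := 2 * s / (1 + s ^+ 2).
have ab : al ^+ 2 + be ^+ 2 = 1 by rewrite /al /be; field; rewrite gt_eqF.
have f1 : field C° (fun x => al *: (psi x *: e_vert)).
  exact: (field_mul (smooth_cst al) fpsi).
have f2 : field C° (fun x => be *: xi x).
  exact: (field_mul (smooth_cst be) fxi).
have ux : unit_field C° (fun x => al *: (psi x *: e_vert) + be *: xi x).
  split; first exact: field_add.
  move=> x; rewrite enorm_le1 /xi.
  set w : V := _ *: v; set tau := Tr g v x.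
  have /andP[p0 p1] := psi01 x.
  have /andP[t0 t1] := Tr_bounds v x (smooth_cont sg) g01.
  have w0 : vert w = 0 by rewrite vertZ v0 mulr0.
  have w1 : dot w w = 1.
    by rewrite -enorm_sqr enormZ ger0_norm// mulVf ?gt_eqF// expr1n.
  rewrite [X in X <= _](_ : _ = al ^+ 2 * psi x ^+ 2 + be ^+ 2 * tau ^+ 2).
    rewrite -ab; apply: lerD.
      by rewrite ler_piMr ?sqr_ge0// expr_le1.
    by rewrite ler_piMr ?sqr_ge0// expr_le1.
  clearbody w al be tau; rewrite -[be ^+ 2 * _]mulr1 -w1 /dot (bigD1 ord_max)//= [in RHS](bigD1 ord_max)//=.
  rewrite -!/(vert _) w0 mulr0 add0r vertD !vertZ vert_e w0 !mulr0 addr0 mulr1.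
  rewrite (_ : al * psi x * (al * psi x) = al ^+ 2 * psi x ^+ 2); last by ring.
  congr (_ + _); rewrite mulr_sumr; apply: eq_bigr => i im.
  by rewrite /e_vert !mxE (negbTE im) andbF mulr0 mulr0 add0r; ring.
have := pE _ ux; rewrite (Int_div_add mE f1 f2) (Int_div_scale _ mE fpsi) (Int_div_scale _ mE fxi).
move=> h; apply: (@combine A s (enorm v) eta (vol S) s0 e0 s1); last exact: sqr_ge0.
have al0 : 0 <= 1 - s ^+ 2 by rewrite subr_ge0 expr_le1// ltW.
have h1 : (1 - s ^+ 2) * (A - 2 * s ^+ 2) <= (1 - s ^+ 2) * Int E (div (fun x => psi x *: e_vert)).
  exact: (ler_wpM2l al0 hpsi).
have h2 : 2 * s * ((enorm v)^-1 * (vol S - eta)) <= 2 * s * Int E (div xi).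
  by apply: ler_wpM2l => //; rewrite mulr_ge0 ?(ltW s0).
apply: le_trans (lerD h1 h2) _.
rewrite [leRHS]mulrC -ler_pdivrMr//; apply: le_trans h.
by rewrite div_combine.
Qed.

End small_transport.

(** * Excess above against holes below *)

Section balance.
Context {R : realType} {n : nat}.
Local Notation V := 'rV[R]_n.+1.
Local Notation lm := (@lebesgue R n).
Context {C : set V} {zb hb : R} {c0 : V} (bC : body C zb hb c0).
Local Notation A := (@slab_sup R n C).
Local Notation slab := (slab C).
Local Notation d := (@cell_diam R n zb hb c0).
Local Notation base := (@base R n c0).
Implicit Types (x y v w : V) (E U D : set V).

Let oI : open C° := open_interior C.
Let mI : lebesgue_measurable C° := open_lebesgue_measurable oI.

Definition upper (s : R) : set V := C° `&` [set x | s < vert x].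

Lemma open_upper s : open (upper s).
Proof.
apply: openI => //; have := @open_kvert R n (-1) (- s).
by rewrite (_ : [set x | _] = [set x : V | s < vert x])//; apply/seteqP; split => x /=; rewrite mulN1r ltrN2.
Qed.

Definition pair_const : R := vol (ccube (0 : V) d) * (n.+1%:R * d * (A + 1) + 2).

Lemma vol_setD_null D E E0 : mfin D -> lebesgue_measurable E -> lebesgue_measurable E0 ->
  E `<=` E0 -> lm (E0 `\` E) = 0%E -> vol (D `\` E0) = vol (D `\` E).
Proof.
move=> fD mE mE0 EE0 h; symmetry; apply: vol_diff_null.
- exact: mfinD.
- by apply: measurableD => //; case: fD.
- by move=> x [Dx nx]; split => // Ex; apply: nx; exact: EE0.
apply: nullS h => x [[Dx nx] nx2]; split => //; apply: contrapT => h; exact: nx2.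
Qed.

(* Any point of E in the upper slab and any point outside of E in the lower
   one are joined by a horizontal move followed by a vertical one. *)
Lemma pair_bound E s a a0 b0 : mfin E -> E `<=` C -> pb C° E A -> flux_saturated (C := C) E s ->
  0 < s -> s <= 1 -> a0 <= b0 -> b0 <= a -> b0 - a0 <= d ->
  vol (slab a0 b0 `\` E) * vol (E `&` slab a (a + 1)) <= pair_const * s.
Proof.
move=> fE EC pE hf s0 s1 ab0 ba bd; have mE := proj1 fE.
have A0 := slab_sup_gt0 bC.
have d0 := cell_diam_gt0 bC.
have d1 : 1 <= d by have := body_hb bC; have := zb_c0 bC; rewrite /cell_diam /base; lra.
have [E0 [bE0 EE0 nE0]] := borel_approx mE (proj2 fE).
have mE0 := borel_measurable bE0.
set D := slab a (a + 1); set D' := slab a0 b0.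
have fD' : mfin D' by exact: (mfin_slab bC).
pose G := D' `\` E0.
have bG : borel G.
  rewrite /borel /G; apply: (@measurableD _ (g_sigma_algebraType (@open V))) => //.
  by apply: sub_sigma_algebra; exact: open_slab.
have eG : vol G = vol (D' `\` E) by exact: vol_setD_null.
(* A cube centred at the vertical displacement a0 - a: it contains all translations from the upper
   slab to the lower one. *)
pose B := [set w | ccube (0 : V) d (w + (a - a0) *: e_vert)].
have fcc : mfin (ccube (0 : V) d) by apply: mfin_compact; exact: compact_ccube.
have fB : mfin B by exact: mfin_shift.
have vB : vol B = vol (ccube (0 : V) d) by exact: vol_shift.
have fA : mfin (E `&` D) by apply: mfinI => //; exact/open_lebesgue_measurable/open_slab.
have fG : mfin G by apply: mfinD.
pose om := n.+1%:R * d * (s * (A + 1)) + 2 * s ^+ 2.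
have om0 : 0 <= om.
  apply: addr_ge0; last by rewrite mulr_ge0 ?sqr_ge0.
  apply: mulr_ge0; first by rewrite mulr_ge0// ltW.
  by apply: mulr_ge0; [exact: ltW|rewrite addr_ge0// ltW].
have omB : om <= (n.+1%:R * d * (A + 1) + 2) * s.
  rewrite /om [leRHS]mulrDl; apply: lerD; first by rewrite le_eqVlt; apply/orP; left; apply/eqP; ring.
  by apply: ler_wpM2l => //; rewrite expr2 ler_piMl// ltW.
have mG := proj1 fG.
have h1 x : (E `&` D) x -> ((vol G)%:E <= lm (B `&` [set v | G (x + v)%R]))%E.
  move=> [Ex [Cx /= /andP[x1 x2]]].
  rewrite (_ : B `&` _ = [set v | G (v + x)]).
    by rewrite volE ?vol_shift//; exact: mfin_shift.
  apply/seteqP; split => v; first by move=> [_ /=]; rewrite addrC.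
  rewrite /= addrC => Gv; split => // i.
  have [[Cv /= /andP[v1 v2]] _] := Gv.
  have Cx' := interior_subset Cx; have Cv' := interior_subset Cv.
  have [->|im] := eqVneq i ord_max.
    have e1 := vertD x v; rewrite e1 in v1 v2.
    rewrite (_ : _ - _ = vert v + (a - a0)); last by rewrite [X in _ - X]mxE subr0 -/(vert _) vertD vertZ vert_e mulr1.
    by rewrite ler_norml; apply/andP; split; lra.
  rewrite (_ : _ - _ = (x + v) 0 i - x 0 i); last first.
    by rewrite !mxE (negbTE im) andbF mulr0; ring.
  apply: le_trans (ler_normB _ _) _.
  have := body_hor bC Cx' im; have := body_hor bC Cv' im; have := zb_c0 bC.
  by rewrite /cell_diam /base; lra.
have h2 w : B w -> (lm ((E `&` D) `&` [set x | G (x + w)%R]) <= om%:E)%E.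
  move=> Bw; set S := _ `&` _.
  have mS : lebesgue_measurable S.
    by apply: measurableI; [case: fA|exact: measurable_shift].
  have fS : mfin S by apply: (mfinS fA) => // x [].
  rewrite volE// lee_fin.
  have [w0|w0] := leP 0 (vert w).
    rewrite (_ : S = set0) ?vol0//; apply/seteqP; split => // x [[_ [_ /= /andP[x1 _]]] [[_ /= /andP[_ x2]] _]].
    by move: x2; rewrite vertD; lra.
  pose t := - vert w; have t0 : 0 < t by rewrite oppr_gt0.
  (* The horizontal move comes first, so that the intermediate point lies above [x + w] and hence in
     the interior of [C]. *)
  pose w' := w + t *: e_vert.
  have w'0 : vert w' = 0 by rewrite vertD vertZ vert_e mulr1 /t subrr.
  pose S1 := [set x | [/\ C° x, C° (x + w'), E x & ~ E (x + w')]].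
  pose S2 := [set x | [/\ slab a (a + 1) x, C° (x - t *: e_vert), E x & ~ E (x - t *: e_vert)]].
  have hS1 : vol S1 <= n.+1%:R * d * (s * (A + 1)).
    apply: le_trans (slide_small bC fE EC pE hf s0 s1 w'0) _.
    apply: ler_wpM2r; first by rewrite mulr_ge0 ?(ltW s0)// addr_ge0 ?(ltW A0).
    apply: enorm_le_coord; first exact: ltW.
    move=> i; have [->|im] := eqVneq i ord_max; first by rewrite -/(vert w') w'0 normr0 ltW.
    have := Bw i; rewrite !mxE (negbTE im) andbF !mulr0 !addr0 subr0; exact.
  have hS2 : vol S2 <= 2 * s ^+ 2 := drop_small bC a fE EC pE hf t0.
  have mslab : lebesgue_measurable (slab a (a + 1)) by exact/open_lebesgue_measurable/open_slab.
  have fS1 : mfin S1 by apply: (mfinS fE (measurable_exit w' mI mI mE)) => x [].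
  have fS2 : mfin S2.
    by apply: (mfinS fE (measurable_exit (- (t *: e_vert)) mslab mI mE)) => x [].
  have SS : S `<=` S1 `|` [set x | S2 (x + w')].
    move=> x [[Ex [Cx /= xD]] [[Cw wD] nE0x]].
    have Cw' : C° (x + w') by rewrite /w' addrA; apply: (body_up_int bC) => //; exact: ltW.
    have nEx : ~ E (x + w) by move=> h; apply: nE0x; exact: EE0.
    have [Ew'|nEw'] := pselect (E (x + w')); last by left.
    have ew : x + w' - t *: e_vert = x + w by rewrite /w' addrA addrK.
    have vw : vert (x + w') = vert x by rewrite vertD w'0 addr0.
    right; rewrite /S2 /= ew; split; [split|exact: Cw|exact: Ew'|exact: nEx].
      exact: Cw'.
    by rewrite /Z /= vw.
  apply: le_trans (vol_le _ SS) _; first by apply: mfinU => //; exact: mfin_shift.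
  apply: le_trans (volU_le fS1 (mfin_shift w' fS2)) _.
  by rewrite vol_shift; exact: lerD.
have v00 : (0 <= (vol G)%:E)%E by rewrite lee_fin vol_ge0.
have om0' : (0 <= om%:E)%E by rewrite lee_fin.
have := double_counting (proj1 fA) (proj1 fB) bG v00 om0' h1 h2.
rewrite !volE// -!EFinM lee_fin eG vB => h; apply: le_trans h _.
by rewrite /pair_const mulrC -mulrA; apply: ler_wpM2l => //; exact: vol_ge0.
Qed.

End balance.

Section half_cylinder.
Context {R : realType} {n : nat}.
Local Notation V := 'rV[R]_n.+1.
Context {C : set V} {zb hb : R} {c0 : V} (bC : body C zb hb c0).
Local Notation slab := (slab C).
Local Notation upper := (@upper R n C).
Local Notation cell := (@cell R n C zb).
Local Notation low := (slab (zb - 1)).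
Local Notation d := (@cell_diam R n zb hb c0).
Local Notation v0 := (@cell_vol R n C c0).
Local Notation base := (@base R n c0).
Implicit Types (x y v w : V) (E U D : set V).

Let oI : open C° := open_interior C.
Let mI : lebesgue_measurable C° := open_lebesgue_measurable oI.

Lemma upper_low s k : zb - 1 <= s -> 0 <= k -> upper s `&` low (s + k) = slab s (s + k).
Proof.
move=> zs k0; apply/seteqP; split=> x.
  by move=> [[Cx /= h] [_ /= /andP[_ h2]]]; split => //; rewrite /= /Z /= h h2.
move=> [Cx /= /andP[h1 h2]]; split; split => //.
by rewrite /= /Z /= h2 andbT; exact: le_lt_trans h1.
Qed.

(** Two uses of [cells_iso] with one constant: for [E] above [s] the cells start at [s], and for the
    holes below [s] they end there. *)
Lemma layers_iso : (0 < n)%N -> exists2 kappa, 0 < kappa &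
  (forall E s p t, mfin E -> E `<=` C -> base <= s -> pb (upper s) E p -> 0 <= t ->
    2 * t ^+ n.+1 <= v0 ->
    (forall a, s <= a -> vol (E `&` slab a (a + 1)) <= t ^+ n.+1) ->
    vol (E `&` upper s) <= t * (kappa * p)) /\
  (forall E s p t, lebesgue_measurable E -> base <= s -> pb (low s) E p -> 0 <= t ->
    2 * t ^+ n.+1 <= v0 ->
    (forall a b, a <= b -> b <= s -> b - a <= d -> vol (slab a b `\` E) <= t ^+ n.+1) ->
    vol (low s `\` E) <= t * (kappa * p)).
Proof.
move=> n0; have [kp kp0 hkp] := cells_iso n0 (cell_diam_gt0 bC) (cell_vol_gt0 bC).
have zc := zb_c0 bC; have h0 := body_hb bC.
exists kp => //; split => [E s p t fE EC bs pE t0 tv hE|E s p t mE bs pE t0 tv hE].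
  have mE := proj1 fE.
  have zs : zb - 1 <= s by move: bs; rewrite /base; lra.
  have mU : lebesgue_measurable (upper s) by exact/open_lebesgue_measurable/open_upper.
  have fEU : mfin (E `&` upper s) by exact: mfinI.
  apply: (vol_exhaust bC (b := s)) => //; first by move=> x [] /EC.
  move=> k; rewrite -setIA upper_low//.
  pose D j := slab (s + j%:R) (s + j%:R + 1).
  have -> : vol (E `&` slab s (s + k%:R)) = \sum_(j < k) vol (part true E (D j)).
    elim: k => [|k ih].
      rewrite big_ord0 addr0 (_ : slab s s = set0) ?setI0 ?vol0//.
      by apply/seteqP; split => // x [_ /= /andP[h1 h2]]; lra.
    rewrite big_ord_recr /= -ih /part [D k `&` E]setIC /D /slab !setIA.
    rewrite (@vol_Z_split _ _ (E `&` C°) _ (s + k%:R))//.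
    - by rewrite -natr1 addrA.
    - by rewrite lerDl.
    - by rewrite lerD2l ler_nat.
    - rewrite -setIA; apply: (mfinI fE); exact/open_lebesgue_measurable/open_slab.
    - exact: measurableI.
  apply: (hkp true _ _ _ _ _ _ mE pE) => //.
  - move=> j _; apply: (unit_slab_cellular bC).
    by have : (0 : R) <= j%:R by []; move: bs; rewrite /base; lra.
  - move=> j _ x [Cx /= /andP[h1 h2]]; split => //=; apply: le_lt_trans h1.
    by rewrite lerDl.
  - move=> i j ij; have := @cell_disj _ _ C zb s i.+1 j.+1 zs ij.
    by rewrite /cell -!natr1 !addrA.
  - by move=> j _; rewrite /part setIC; apply: hE; rewrite lerDl.
pose J := Num.Def.truncn (s - base).
have sb : 0 <= s - base by rewrite subr_ge0.
have /andP[J1 J2] := archimedean.Num.Theory.truncn_itv sb; rewrite -/J in J1 J2.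
(* The cells must end exactly at [s]; the bottom one absorbs the fractional part of s - base. *)
pose be := s - J%:R.
have sE : s = be + J%:R by rewrite subrK.
have be1 : base <= be by rewrite /be; lra.
have be2 : be <= base + 1 by rewrite /be; move: J2; rewrite -natr1; lra.
have zbe : zb - 1 <= be by move: be1; rewrite /base; lra.
have mCE : lebesgue_measurable (~` E) by exact: measurableC.
rewrite sE setDE setIC -(cells_sum bC _ zbe mCE).
rewrite (eq_bigr (fun j : 'I_J.+1 => vol (part false E (cell be j)))); last first.
  by move=> j _; rewrite /part setDE setIC.
have jJ j : (j <= J)%N -> be + j%:R <= s by move=> h; rewrite sE lerD2l ler_nat.
apply: (hkp false _ _ _ _ _ _ mE pE) => //.
- by move=> j _; apply: (cell_cellular bC).
- move=> j; rewrite ltnS => /jJ js x [Cx /= /andP[h1 h2]]; split => //.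
  rewrite /= /Z /= (lt_le_trans h2 js) andbT; apply: le_lt_trans h1.
  by case: j {h2 js} => // j; rewrite (le_trans zbe)// lerDl.
- by move=> i j ij; exact: cell_disj.
move=> j; rewrite ltnS => /jJ js; apply: hE => //.
  by case: j {js} => [|j]; rewrite ?addr0// lerD2l ler_nat.
case: j {js} => [|j]; first by rewrite addr0 /cell_diam; lra.
by rewrite -natr1 /cell_diam; move: be1; rewrite /base; lra.
Qed.

End half_cylinder.

Section defect.
Context {R : realType} {n : nat}.
Local Notation V := 'rV[R]_n.+1.
Context {C : set V} {zb hb : R} {c0 : V} (bC : body C zb hb c0).
Local Notation A := (@slab_sup R n C).
Local Notation slab := (slab C).
Local Notation upper := (@upper R n C).
Local Notation low := (slab (zb - 1)).
Local Notation v0 := (@cell_vol R n C c0).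
Local Notation base := (@base R n c0).
Implicit Types (x y v w : V) (E U D : set V).

Let oI : open C° := open_interior C.
Let mI : lebesgue_measurable C° := open_lebesgue_measurable oI.

Lemma measurable_slab a b : lebesgue_measurable (slab a b).
Proof. exact/open_lebesgue_measurable/open_slab. Qed.

Lemma measurable_upper s : lebesgue_measurable (upper s).
Proof. exact/open_lebesgue_measurable/open_upper. Qed.

Lemma vol_low_upper E s : mfin E -> E `<=` C -> vol E = vol (E `&` low s) + vol (E `&` upper s).
Proof.
move=> fE EC; have mE := proj1 fE.
have f1 : mfin (E `&` low s) by exact: (mfinI fE (measurable_slab _ _)).
have f2 : mfin (E `&` upper s) by exact: (mfinI fE (measurable_upper _)).
rewrite (vol_interior bC fE EC) -volU//; last first.
  by apply/seteqP; split => // x [[_ [_ /= /andP[_ h1]]] [_ [_ /= h2]]]; lra.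
apply: vol_diff_null; first exact: mfinI.
- by case: (mfinU f1 f2).
- by move=> x [[Ex []]|[Ex []]].
apply: nullS (plane_null s) => x [[Ex Cx] nx] /=.
apply/eqP; rewrite eq_le; apply/andP; split; rewrite leNgt; apply/negP => h; apply: nx.
  by right.
by left; split => //; rewrite (lowE bC).
Qed.

Lemma vol_defect E h : mfin E -> E `<=` C -> vol (low h) = vol E ->
  vol (low h `\` E) = vol (E `&` upper h).
Proof.
move=> fE EC eh; have mE := proj1 fE.
have e1 := vol_low_upper h fE EC.
have e2 := volID (mfin_slab bC (zb - 1) h) mE.
move: e1 e2; rewrite -eh setIC; move: (vol _) (vol _) (vol _) (vol _) => *; lra.
Qed.

(** If some unit slab above [h] holds more than t^(n+1) of [E], [pair_bound] keeps the holes of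
    every slab below [h] at most t^(n+1), and their total is small; if no slab does, the total above
    [h] is small. By [vol_defect] the two totals are equal. *)
Lemma small_defect dl : (0 < n)%N -> 0 < dl -> exists v1 : R, forall E h, mfin E -> E `<=` C ->
  pb C° E A -> v1 < vol E -> vol (low h) = vol E -> vol (E `&` upper h) <= dl.
Proof.
move=> n0 dl0; have [kp kp0 [htail hlow]] := layers_iso bC n0.
have A0 := slab_sup_gt0 bC; have v00 := cell_vol_gt0 bC; have d0 := cell_diam_gt0 bC.
pose t := Num.min (dl / (kp * A)) (Num.min 1 (v0 / 2)).
have kA : 0 < kp * A by exact: mulr_gt0.
have t0 : 0 < t by rewrite !lt_min ltr01 !divr_gt0.
have t1 : t <= 1 by rewrite !ge_min lexx !orbT.
have tv : 2 * t ^+ n.+1 <= v0.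
  rewrite mulrC -ler_pdivlMr//; apply: (@le_trans _ _ t); first by rewrite ler_iXnr// ltW.
  by rewrite !ge_min lexx !orbT.
have tdl : t * (kp * A) <= dl by rewrite -ler_pdivlMr// ge_min lexx.
have T0 : 0 < t ^+ n.+1 by rewrite exprn_gt0.
have M0 : 0 < 1 + @pair_const R n C zb hb c0.
  rewrite ltr_wpDr// mulr_ge0 ?vol_ge0// addr_ge0// mulr_ge0// ?addr_ge0 ?(ltW A0)//.
  by rewrite mulr_ge0// ltW.
(* The product in [pair_bound] becomes at most t^(2(n+1)), so that a factor above t^(n+1) forces the
   other below it. *)
pose s := Num.min 1 (t ^+ n.+1 * t ^+ n.+1 / (1 + @pair_const R n C zb hb c0)).
have s0 : 0 < s by rewrite lt_min ltr01 divr_gt0 ?mulr_gt0.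
have s1 : s <= 1 by rewrite ge_min lexx.
have sM : @pair_const R n C zb hb c0 * s <= t ^+ n.+1 * t ^+ n.+1.
  apply: (@le_trans _ _ ((1 + @pair_const R n C zb hb c0) * s)); first by rewrite ler_wpM2r ?(ltW s0)// lerDr.
  by rewrite mulrC -ler_pdivlMr// ge_min lexx orbT.
have [v1 hv1] := near_full bC n0 (exprn_gt0 2 s0).
have [v2 v20 hv2] := low_unbounded bC base.
exists (Num.max v1 v2) => E h fE EC pE; rewrite gt_max => /andP[l1 l2] eh.
have mE := proj1 fE.
have hb0 : base <= h by apply: ltW; apply: hv2; rewrite eh.
have [a ha] := hv1 E fE EC pE l1.
have hf := near_full_saturated bC fE s0 ha.
have [[a' [ha' hE]]|nE] := pselect (exists a', h <= a' /\ t ^+ n.+1 < vol (E `&` slab a' (a' + 1))).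
  rewrite -(vol_defect fE EC eh); apply: le_trans tdl.
  apply: hlow => //; [by apply: pbW pE => x []|exact: ltW|].
  move=> a0 b0 ab bh bd.
  have := pair_bound bC fE EC pE hf s0 s1 ab (le_trans bh ha') bd.
  move=> /le_trans/(_ sM) hp; rewrite -(ler_pM2r T0); apply: le_trans hp.
  by apply: ler_wpM2l; [exact: vol_ge0|exact: ltW].
apply: le_trans tdl; apply: htail => //; [by apply: pbW pE => x []|exact: ltW|].
move=> a' ha'; rewrite leNgt; apply/negP => hE; apply: nE; by exists a'.
Qed.

End defect.

(** * Vanishing in finite time *)

Section decay.
Context {R : realType}.

Lemma bernoulli_up (x : R) k : 0 <= x -> 2 * k%:R * x <= 1 -> (1 + x) ^+ k <= 1 + 2 * k%:R * x.
Proof.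
move=> x0; elim: k => [|k ih]; first by rewrite expr0 mulr0 mul0r addr0.
rewrite -natr1 => h; have kx0 : 0 <= k%:R * x by rewrite mulr_ge0.
have /ih {}ih : 2 * k%:R * x <= 1 by lra.
rewrite exprS; apply: (@le_trans _ _ ((1 + x) * (1 + 2 * k%:R * x))).
  by apply: ler_wpM2l => //; lra.
have : 2 * k%:R * x * x <= x by rewrite ler_piMl//; lra.
lra.
Qed.

Lemma expr_add_le (s y : R) k : 0 < s -> 0 <= y -> 2 * k.+1%:R * y <= s ->
  (s + y) ^+ k.+1 <= s ^+ k.+1 + 2 * k.+1%:R * s ^+ k * y.
Proof.
move=> s0 y0 h; have -> : s + y = s * (1 + y / s) by rewrite mulrDr mulr1 mulrC divfK ?gt_eqF.
rewrite exprMn.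
have -> : s ^+ k.+1 + 2 * k.+1%:R * s ^+ k * y = s ^+ k.+1 * (1 + 2 * k.+1%:R * (y / s)).
  by rewrite exprS; field; rewrite gt_eqF.
rewrite ler_pM2l ?exprn_gt0//; apply: bernoulli_up; first by rewrite divr_ge0// ltW.
by rewrite mulrA ler_pdivrMr// mul1r.
Qed.

Lemma rootn_le k (a b : R) : 0 <= a -> a <= b -> rootn k.+1 a <= rootn k.+1 b.
Proof.
move=> a0 ab; have b0 := le_trans a0 ab.
by rewrite -(@ler_pXn2r _ k.+1)// ?nnegrE ?rootn_ge0// !rootnK.
Qed.

Lemma rootn_gt0 k (a : R) : 0 < a -> 0 < rootn k.+1 a.
Proof.
move=> a0; rewrite lt_neqAle rootn_ge0 andbT eq_sym; apply/eqP => h.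
by have := @rootnK R k.+1 a isT (ltW a0); rewrite h expr0n /= => e; move: a0; rewrite -e ltxx.
Qed.

(* A differential inequality - m' >= c' m^(n/(n+1)), in a one-sided and
   integrated form that needs no regularity of m, makes m vanish in finite
   time. *)
Lemma decay n (m : R -> R) (a b c : R) : 0 < c -> a <= b -> (forall s, 0 <= m s) ->
  (forall s t, a <= s -> s <= t -> t <= b -> m t <= m s) ->
  (forall s k, a < s -> s <= b -> 0 < m s -> 0 <= k ->
    (forall d0, 0 < d0 -> exists d, [/\ 0 < d, d <= d0 & m (s - d) - m s <= k * d]) ->
    rootn n.+1 (m s) ^+ n <= c * k) ->
  0 < m b -> b - a <= 4 * n.+1%:R * c * rootn n.+1 (m a).
Proof.
move=> c0 ab m0 mono hk mb0.
pose sg s := rootn n.+1 (m s).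
have sgK s : sg s ^+ n.+1 = m s by apply: rootnK.
have sg_mono s t : a <= s -> s <= t -> t <= b -> sg t <= sg s.
  by move=> h1 h2 h3; apply: rootn_le => //; exact: mono.
have mpos s : a <= s -> s <= b -> 0 < m s.
  by move=> h1 h2; apply: lt_le_trans mb0 _; exact: mono.
(* A quarter of the rate 1 / ((n+1) c) at which the differential inequality would make the root [sg]
   decrease: one factor 2 is lost in the choice of [k], the other in [expr_add_le]. *)
pose e := (4 * n.+1%:R * c)^-1.
have N0 : (0 : R) < n.+1%:R by rewrite ltr0n.
have ec0 : 0 < 4 * n.+1%:R * c by rewrite !mulr_gt0.
have e0 : 0 < e by rewrite invr_gt0.
have step s : a < s -> s <= b -> exists2 d1, 0 < d1 &
    forall d, 0 < d -> d <= d1 -> sg s + e * d <= sg (s - d).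
  move=> h1 h2; have ms := mpos s (ltW h1) h2.
  have sg0 : 0 < sg s by exact: rootn_gt0.
  have sn0 : 0 < sg s ^+ n by exact: exprn_gt0.
  pose k := sg s ^+ n / (2 * c).
  have k0 : 0 < k by rewrite divr_gt0 ?mulr_gt0.
  have [d0 d00 hd0] : exists2 d0, 0 < d0 & forall d, 0 < d -> d <= d0 -> k * d < m (s - d) - m s.
    apply: contrapT => nd.
    have := hk s k h1 h2 ms (ltW k0); rewrite -/(sg s) => H.
    have : sg s ^+ n <= c * k.
      apply: H => d0 d00; apply: contrapT => nd2; apply: nd; exists d0 => // d dp dd.
      by rewrite ltNge; apply/negP => hh; apply: nd2; exists d.
    have -> : c * k = sg s ^+ n / 2 by rewrite /k; field; rewrite gt_eqF.
    by rewrite ler_pdivlMr//; move: sn0; lra.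
  pose d1 := Num.min d0 (sg s / (2 * n.+1%:R * e)).
  have ne0 : 0 < 2 * n.+1%:R * e by rewrite !mulr_gt0.
  exists d1; first by rewrite lt_min d00 divr_gt0.
  move=> d dp; rewrite le_min => /andP[dd0 dd1].
  rewrite -(@ler_pXn2r _ n.+1)// ?nnegrE ?rootn_ge0//; last first.
    by rewrite addr_ge0 ?rootn_ge0// mulr_ge0// ltW.
  rewrite sgK; apply: (@le_trans _ _ (sg s ^+ n.+1 + 2 * n.+1%:R * sg s ^+ n * (e * d))).
    apply: expr_add_le => //; first by rewrite mulr_ge0// ltW.
    by rewrite mulrA mulrC -ler_pdivlMr.
  rewrite sgK; have := hd0 d dp dd0.
  have -> : 2 * n.+1%:R * sg s ^+ n * (e * d) = k * d.
    by rewrite /k /e; field; rewrite !gt_eqF.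
  by move=> hh; rewrite addrC -lerBrDr ltW.
(* Descent from [b]: the infimum of [S] satisfies the inequality as well, by monotonicity of [sg],
   and [step] would push it further down unless it is [a]. *)
pose S := [set s | [/\ a <= s, s <= b & sg b + e * b <= sg s + e * s]].
have Sb : S b by split.
have lS : lbound S a by move=> s [].
have hS : has_inf S by split; [exists b|exists a].
pose t := inf S.
have at_ : a <= t by apply: lb_le_inf => //; exists b.
have tb : t <= b by apply: ge_inf => //; exists a.
have St : sg b + e * b <= sg t + e * t.
  apply/ler_addgt0Pr => eta eta0.
  have [s [h1 h2 h3] h4] := inf_adherent (divr_gt0 eta0 e0) hS.
  have ts : t <= s by apply: ge_inf => //; exists a.
  apply: le_trans h3 _; rewrite -addrA; apply: lerD; first exact: sg_mono.
  have : e * s < e * (t + eta / e) by rewrite ltr_pM2l.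
  by rewrite mulrDr [e * (_ / _)]mulrC divfK ?gt_eqF// => /ltW.
have [at2|ta] := ltP a t; last first.
  have ta2 : t = a by apply/eqP; rewrite eq_le ta at_.
  rewrite ta2 in St.
  have h : e * (b - a) <= sg a.
    by rewrite mulrBr lerBlDr; apply: le_trans St; rewrite lerDr rootn_ge0.
  by rewrite -ler_pdivrMl.
have [d1 d10 hd] := step t at2 tb.
pose d := Num.min d1 (t - a).
have dp : 0 < d by rewrite lt_min d10 subr_gt0.
have da : d <= t - a by rewrite ge_min lexx orbT.
have hd1 : sg t + e * d <= sg (t - d) by apply: hd; rewrite // ge_min lexx.
have : t <= t - d.
  apply: ge_inf; first by exists a.
  split; [by rewrite lerBrDr addrC -lerBrDr|by rewrite lerBlDr (le_trans tb)// lerDl ltW|].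
  apply: le_trans St _; rewrite mulrBr addrA [leRHS]addrAC lerD2r.
  by rewrite lerBrDr.
by rewrite lerDl oppr_ge0 leNgt dp.
Qed.

End decay.

(** * Monotonicity of the profile *)

Section profile_monotone.
Context {R : realType} {n : nat}.
Local Notation V := 'rV[R]_n.+1.
Context {C : set V} {zb hb : R} {c0 : V} (bC : body C zb hb c0).
Local Notation A := (@slab_sup R n C).
Local Notation slab := (slab C).
Implicit Types (x y v w : V) (E F U D : set V).

Let oI : open C° := open_interior C.
Let mI : lebesgue_measurable C° := open_lebesgue_measurable oI.

Lemma nbhs_vert U x : nbhs x U -> exists k : nat, forall s, `|s| <= k.+1%:R^-1 -> U (x + s *: e_vert).
Proof.
move=> /nbhs_cubeP[r r0 hr]; have [k hk] := ltr_add_invr r0; rewrite add0r in hk.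
exists k => s hs; apply: hr => i; rewrite [X in `|X|](_ : _ = s * (e_vert : V) 0 i); last by rewrite !mxE; ring.
apply: le_lt_trans hk; apply: le_trans hs; rewrite /e_vert mxE.
by case: (_ && _); rewrite ?mulr1// mulr0 normr0.
Qed.

(** The points of [F] that stay in [C] when moved down by [t]. *)
Let W F (t : R) : set V := F `&` [set y | C (y + - (t *: e_vert))].

Let W_mono F s t : s <= t -> W F t `<=` W F s.
Proof.
move=> st y [Fy /= Cy]; split => //=.
have ts0 : 0 <= t - s by rewrite subr_ge0.
have := body_up bC Cy ts0; congr C.
by rewrite scalerBl -addrA addrA subrKA.
Qed.

Let mW F t : mfin F -> mfin (W F t).
Proof.
move=> fF; apply: mfinI => //; apply: measurable_shift; exact: (body_measurable bC).
Qed.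

(** The volume that stays in [C] is nonincreasing in [t], continuous from the left because [C] is
    closed and from the right because its boundary is null. So [v] is attained at the supremum of
    the [t] that keep at least [v]. *)
Lemma vol_level F (v : R) : mfin F -> F `<=` C -> 0 < v -> v <= vol F ->
  exists2 t, 0 <= t & vol (C `&` [set x | F (x + t *: e_vert)]) = v.
Proof.
move=> fF FC v0 vF.
have eW t : vol (C `&` [set x | F (x + t *: e_vert)]) = vol (W F t).
  rewrite -(vol_shift (W F t) (t *: e_vert)); congr vol.
  by apply/seteqP; split => x /=; rewrite /W /= addrK => -[].
have W0 : W F 0 = F.
  apply/seteqP; split => [x []//|x Fx]; split => //=.
  by rewrite scale0r oppr0 addr0; exact: FC.
pose S := [set t | v <= vol (W F t)].
have S0 : S 0 by rewrite /S /= W0.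
have [k hk] := vert_vanish zb fF (divr_gt0 v0 (ltr0n R 2)).
have mk : mfin (F `&` [set x | zb + k%:R < vert x]).
  apply: (mfinI fF); have := open_lebesgue_measurable (@open_kvert R n (-1) (- (zb + k%:R))).
  by rewrite (_ : [set x | _] = [set x : V | zb + k%:R < vert x])//; apply/seteqP; split => x /=; rewrite mulN1r ltrN2.
have ubS : ubound S (k%:R + 1).
  move=> t; rewrite /S /= => vt; rewrite leNgt; apply/negP => kt.
  have : vol (W F t) <= v / 2.
    apply: le_trans hk; apply: vol_le => // x [Fx /= /(body_low bC)].
    by rewrite vertD vertN vertZ vert_e mulr1 => h; split => //=; lra.
  by move: vt v0; lra.
have hS : has_sup S by split; [exists 0|exists (k%:R + 1)].
pose t := sup S.
have t0 : 0 <= t by apply: ub_le_sup => //; exists (k%:R + 1).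
exists t => //; rewrite eW; apply/eqP; rewrite eq_le; apply/andP; split.
  pose F' := F `&` [set y | C° (y + - (t *: e_vert))].
  have fF' : mfin F' := mfinI fF (measurable_shift (- (t *: e_vert)) mI).
  have -> : vol (W F t) = vol F'.
    apply: vol_diff_null; [exact: mW|by case: fF'| |].
      by move=> x [Fx /interior_subset].
    apply: (@nullS _ _ _ [set y | (C `\` C°) (y + - (t *: e_vert))]).
      by move=> x [[Fx /= Cx] nx]; split => // Ix; apply: nx; split.
    have mD : lebesgue_measurable (C `\` C°) by apply: null_measurable; exact: (boundary_null bC).
    have [fD vD] := mfin_null mD (boundary_null bC).
    by apply: vol_null; [rewrite vol_shift|exact: mfin_shift].
  pose Q (j : nat) := W F (t + j.+1%:R^-1).
  have FQ : F' `<=` \bigcup_j Q j.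
    move=> x [Fx /= /nbhs_vert[j hj]]; exists j => //; split => //=.
    have := hj (- j.+1%:R^-1); rewrite normrN ger0_norm ?invr_ge0// => /(_ (lexx _)).
    by rewrite scaleNr scalerDl opprD addrA.
  have fQ : mfin (\bigcup_j Q j).
    by apply: (mfin_bigcup fF) => j; [case: (mW (t + j.+1%:R^-1) fF)|move=> x []].
  apply: le_trans (vol_le fQ FQ) _.
  have cQ := @vol_bigcup_cvg _ _ Q (fun j => proj1 (mW (t + j.+1%:R^-1) fF)).
  have {}cQ : (fun i => vol (Q i)) @ \oo --> vol (\bigcup_j Q j).
    apply: cQ => // i j ij; apply/subsetPset; apply: W_mono.
    by rewrite lerD2l lef_pV2 ?posrE ?ltr0n// ler_nat.
  rewrite -(cvg_lim (@Rhausdorff R) cQ).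
  apply: limr_le; first by apply/cvg_ex; exists (vol (\bigcup_j Q j)).
  near=> j; rewrite leNgt; apply/negP => h.
  have : t + j.+1%:R^-1 <= t by apply: ub_le_sup; [exists (k%:R + 1)|exact: ltW].
  by rewrite gerDl leNgt invr_gt0 ltr0n.
pose Q (j : nat) := W F (t - j.+1%:R^-1).
have QW : \bigcap_j Q j `<=` W F t.
  move=> x hx; have [Fx _] := hx 0%N I; split => //=.
  apply: (body_closed bC) => B /nbhs_vert[j hj].
  exists (x + - (t *: e_vert) + j.+1%:R^-1 *: e_vert); split; last first.
    by apply: hj; rewrite ger0_norm ?invr_ge0.
  by have [_ /=] := hx j I; rewrite scalerBl opprB [_ *: _ - _]addrC addrA.
apply: (@le_trans _ _ (vol (\bigcap_j Q j))); last by apply: vol_le => //; exact: mW.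
have mQ j : lebesgue_measurable (Q j) by case: (mW (t - j.+1%:R^-1) fF).
have cQ := @vol_bigcap_cvg _ _ Q (mW (t - 1%:R^-1) fF) mQ.
have {}cQ : (fun i => vol (Q i)) @ \oo --> vol (\bigcap_j Q j).
  apply: cQ => i j ij; apply/subsetPset; apply: W_mono.
  by rewrite lerD2l lerN2 lef_pV2 ?posrE ?ltr0n// ler_nat.
rewrite -(cvg_lim (@Rhausdorff R) cQ).
apply: limr_ge; first by apply/cvg_ex; exists (vol (\bigcap_j Q j)).
near=> j.
have j0 : 0 < j.+1%:R^-1 :> R by rewrite invr_gt0 ltr0n.
have [s Ss ts] := sup_adherent j0 hS.
apply: le_trans Ss _; apply: vol_le; first exact: mW.
by apply: W_mono; exact: ltW.
Unshelve. all: by end_near. Qed.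

(** A competitor with too much volume is as good as one with the right volume: moved downwards it
    loses volume out of [C], and its relative perimeter does not grow. *)
Lemma isoperimetric_le E F (p : R) : isoperimetric_region C E -> mfin F -> F `<=` C ->
  vol E <= vol F -> pb C° F p -> pb C° E p.
Proof.
move=> [mE EC fE PE] fF FC vEF pF.
have p0 := pb_ge0 (proj1 fF) pF.
have {}fE : mfin E by split => //; rewrite ltey_eq fE.
have [F' [fF' F'C vF' pF']] : exists F', [/\ mfin F', F' `<=` C, vol F' = vol E & pb C° F' p].
  have := vol_ge0 E; rewrite le_eqVlt => /predU1P[v0|v0].
    exists set0; split; rewrite ?vol0 -?v0//; first exact: mfin0.
    by move=> xi _; rewrite /Int Rintegral_set0.
  have [t t0 vt] := vol_level fF FC v0 vEF.
  have fS := mfin_shift (t *: e_vert) fF.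
  exists (C `&` [set x | F (x + t *: e_vert)]); split => //.
  - by rewrite setIC; apply: mfinI => //; exact: (body_measurable bC).
  rewrite setIC; apply: pb_restrict; first exact: interior_subset.
  rewrite shift_image; have := @pb_aff _ _ C° F (- (t *: e_vert)) 1 p ltr01 (proj1 fF) _ pF.
  rewrite expr1n mul1r; apply.
  move=> x; rewrite aff1E => h; rewrite -(subrK (t *: e_vert) x).
  exact: (body_up_int bC).
apply/(perimeter_pb _ _ mE); rewrite PE.
have /(perimeter_pb _ _ (proj1 fF')) := pF'; apply: le_trans.
apply: ereal_inf_lbound; exists F' => //; split => //; first by case: fF'.
by rewrite volE// vF'.
Qed.

Lemma isoperimetric_pb E : isoperimetric_region C E -> pb C° E A.
Proof.
move=> iE; have [mE EC fE PE] := iE.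
have [h hh] := low_height bC (vol_ge0 E).
have fF : mfin (C `&` [set x | 1 * vert x < h]).
  apply: (@mfin_below _ _ _ _ _ _ bC _ h).
  - apply: measurableI; first exact: (body_measurable bC).
    exact/open_lebesgue_measurable/open_kvert.
  - by move=> x [].
  - by move=> x [_ /=]; rewrite mul1r => /ltW.
apply: (isoperimetric_le iE fF); [by move=> x []| |exact: (pb_lower_part bC)].
rewrite -hh; apply: vol_le => // x; rewrite (lowE bC) => -[/interior_subset Cx /= hx].
by split => //=; rewrite mul1r.
Qed.

End profile_monotone.

(** * Flatness of isoperimetric regions *)

Section dilation.
Context {R : realType} {n : nat}.
Local Notation V := 'rV[R]_n.+1.
Context {C : set V} {zb hb : R} {c0 : V} (bC : body C zb hb c0).
Local Notation A := (@slab_sup R n C).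
Local Notation slab := (slab C).
Local Notation upper := (@upper R n C).
Local Notation low := (slab (zb - 1)).
Local Notation base := (@base R n c0).
Implicit Types (x y v w : V) (E F U D : set V).

Let oI : open C° := open_interior C.
Let mI : lebesgue_measurable C° := open_lebesgue_measurable oI.

Lemma vol_setD_plane E b : mfin E -> vol E = vol (E `\` [set x | vert x = b]).
Proof.
move=> fE; have mP := null_measurable (@plane_null R n b).
apply: vol_diff_null => //; first by apply: measurableD => //; case: fE.
by apply: nullS (plane_null b) => x [Ex nx] /=; apply: contrapT => h; apply: nx.
Qed.

Lemma measurable_band k (a b : R) : lebesgue_measurable [set x : V | a <= k * vert x < b].
Proof.
rewrite (_ : [set x | _] = [set x | k * vert x < b] `\` [set x | k * vert x < a]).
  by apply: measurableD; exact/open_lebesgue_measurable/open_kvert.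
apply/seteqP; split => x /=; first by move=> /andP[h1 ->]; split => //; apply/negP; rewrite -leNgt.
by move=> [-> /negP]; rewrite -leNgt => ->.
Qed.

Lemma layer_above E s dt : mfin E -> 0 < dt ->
  let L := C° `&` E `&` [set x | s - dt <= 1 * vert x < s] in
  mfin L /\ vol L <= vol (E `&` upper (s - dt)) - vol (E `&` upper s).
Proof.
move=> fE d0 L; have fCE : mfin (C° `&` E) by rewrite setIC; exact: (mfinI fE mI).
have fL : mfin L by exact: (mfinI fCE (measurable_band _ _ _)).
have fU t : mfin (E `&` upper t) by exact: (mfinI fE (measurable_upper _)).
split=> //; rewrite lerBrDr (vol_setD_plane (s - dt) fL).
have fL' := mfinD fL (null_measurable (@plane_null R n (s - dt))).
rewrite -volU//; last first.
  by apply/seteqP; split => // x [[[_ /= /andP[_ h1]] _] [_ [_ /= h2]]]; lra.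
apply: vol_le => // x [[[[Cx Ex] /= /andP[h1 _]] nx]|[Ex [Cx /= h]]]; split => //; split => //=.
  by rewrite mul1r in h1; rewrite lt_neqAle h1 andbT; apply/eqP => e; apply: nx.
by lra.
Qed.

Lemma layer_below E s dt : lebesgue_measurable E -> 0 < dt ->
  let L := C° `&` (C `\` E) `&` [set x | - s - dt <= -1 * vert x < - s] in
  mfin L /\ vol L <= vol (low (s + dt) `\` E) - vol (low s `\` E).
Proof.
move=> mE d0 L.
have mL : lebesgue_measurable L.
  apply: (measurableI _ _ (measurableI _ _ mI _) (measurable_band _ _ _)).
  exact: (measurableD (body_measurable bC) mE).
have fL : mfin L.
  apply: (mfin_below bC (b := s + dt)) => //; first by move=> x [[/interior_subset]].
  by move=> x [_ /= /andP[h _]]; lra.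
have fU t : mfin (low t `\` E) by exact: (mfinD (mfin_slab bC _ _) mE).
split=> //; rewrite lerBrDr (vol_setD_plane (s + dt) fL).
have fL' := mfinD fL (null_measurable (@plane_null R n (s + dt))).
rewrite -volU//; last first.
  by apply/seteqP; split => // x [[[_ /= /andP[_ h1]] _] [[_ /= /andP[_ h2]] _]]; lra.
apply: vol_le => // x [[[[Cx [_ Ex]] /= /andP[h1 _]] nx]|[[Cx /= /andP[h1 h2]] Ex]]; split => //.
  rewrite (lowE bC); split => //=; rewrite lt_neqAle; apply/andP; split; last by lra.
  by apply/eqP => e; apply: nx.
by split => //=; rewrite /Z /= h1 /=; lra.
Qed.

Let dilation_factor (N : nat) (a S m : R) : (0 < N)%N -> 0 < a -> 0 < m -> m <= a / 16 -> 32 * N%:R <= S ->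
  let mu := 1 + 16 * m / (a * S) in
  [/\ 1 < mu, (mu ^+ N - 1) * a <= m, mu ^+ N <= 2 & (mu - 1) * S = 16 * m / a].
Proof.
move=> N0 a0 m0 ma hS mu; have N1 : 1 <= N%:R :> R by rewrite ler1n.
have S0 : 0 < S by lra.
have aS0 : 0 < a * S by rewrite mulr_gt0.
have x0 : 0 < 16 * m / (a * S) by rewrite divr_gt0// mulr_gt0.
have xS : 16 * m / (a * S) * S = 16 * m / a by field; rewrite !gt_eqF.
have xa : 16 * m / (a * S) * (a * S) = 16 * m by rewrite divfK ?gt_eqF.
move: x0 xS xa @mu; set x := 16 * m / (a * S) => x0 xS xa mu.
have h1 : 2 * N%:R * x * a <= m.
  have : (32 * N%:R) * (a * x) <= S * (a * x) by rewrite ler_wpM2r// mulr_ge0 ?(ltW a0) ?(ltW x0).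
  have : S * (a * x) = 16 * m by rewrite -xa; ring.
  have : 2 * N%:R * x * a = (32 * N%:R * (a * x)) / 16 by field.
  lra.
have h2 : 2 * N%:R * x <= 1.
  rewrite -(ler_pM2r a0) mul1r; apply: le_trans h1 _; lra.
have h3 := bernoulli_up (ltW x0) h2.
split; rewrite /mu; [by rewrite ltrDl| | |by rewrite addrC addKr].
  apply: le_trans h1; rewrite ler_pM2r//; lra.
lra.
Qed.

Let dilation_gain (v D w g M m a : R) : 1 <= M -> M <= 2 -> (M - 1) * a <= m -> 4 * m <= w ->
  0 <= D -> D <= a -> 0 <= m -> v + D + w <= g + M * (D + m) -> v <= g.
Proof.
move=> M1 M2 Ma mw D0 Da m0 h.
have : (M - 1) * D <= (M - 1) * a by rewrite ler_wpM2l// subr_ge0.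
have : M * m <= 2 * m by rewrite ler_wpM2r.
lra.
Qed.

(** The dilation about [c0] raises the plane at [s] by 16 m / A, which adds to [low s] a slab of
    volume at least 4 m. Of the raised part [G] can miss only the dilated holes. Before dilation
    these have volume vol(slab h s) + m; the slab grows by at most (mu^(n+1) - 1) A <= m and the
    term m becomes at most 2 m, so that 3 m suffice. The height of [s] above [c0] is what keeps [mu]
    close to 1. *)
Lemma dilation_volume E h s :
  let m := vol (E `&` upper s) in
  let mu := 1 + 16 * m / (A * (s - vert c0)) in
  let G := (aff ((1 - mu) *: c0) mu @` (E `&` [set x | 1 * vert x < s])) `&` C in
  mfin E -> E `<=` C -> vol (low h) = vol E -> h <= s -> s <= h + 1 -> zb - 1 <= h ->
  A / 2 <= vol (slab (s - 1) s) -> 0 < m -> m <= A / 16 -> 32 * n.+1%:R <= s - vert c0 ->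
  [/\ 1 < mu, (mu ^+ n.+1 - 1) * A <= m, mu ^+ n.+1 <= 2, mfin G & vol E <= vol G].
Proof.
move=> m mu G fE EC eh hs sh zh hA m0 mA hS; have mE := proj1 fE.
have A0 := slab_sup_gt0 bC.
have [mu1 muA mu2 muS] := dilation_factor (ltn0Sn n) A0 m0 mA hS; rewrite -/mu in mu1 muA mu2 muS.
have mu0 : 0 < mu by exact: lt_trans mu1.
set c := (1 - mu) *: c0 in G *.
pose F := E `&` [set x | 1 * vert x < s].
have fF : mfin F by apply: (mfinI fE); exact/open_lebesgue_measurable/open_kvert.
have fG : mfin G by apply: mfinI (body_measurable bC); exact: mfin_aff.
split => //.
pose l := 16 * m / A; pose s' := s + l.
have l0 : 0 < l by rewrite divr_gt0// mulr_gt0.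
have l1 : l <= 1 by rewrite ler_pdivrMr// mul1r; lra.
have cov : low s' `<=` G `|` aff c mu @` (low s `\` E).
  move=> y; rewrite (lowE bC) => -[Cy /= hy].
  pose x := mu^-1 *: (y - c).
  have xE : x = (1 - mu^-1) *: c0 + mu^-1 *: y.
    apply/rowP => i; rewrite /x /c !mxE; field; by rewrite gt_eqF.
  have ax : aff c mu x = y by rewrite /aff /x scalerA mulfV ?gt_eqF// scale1r addrC subrK.
  have mi1 : mu^-1 <= 1 by rewrite invf_le1// ltW.
  have Cx : C° x.
    rewrite xE; apply: (cvx_interior_cvx (body_cvx bC)) => //; first exact: (body_int bC).
    by rewrite invr_ge0 ltW.
  have vx : vert x < s.
    rewrite xE vertD !vertZ.
    rewrite (_ : _ + _ = vert c0 + (vert y - vert c0) / mu); last by ring.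
    rewrite -ltrBrDl ltr_pdivrMr//.
    have e1 : (s - vert c0) * mu = s' - vert c0.
      by rewrite /s' /l -muS; ring.
    by rewrite e1; lra.
  have [Ex|nEx] := pselect (E x).
    by left; split; [exists x => //; split => //=; rewrite mul1r|exact: interior_subset].
  by right; exists x => //; split => //; rewrite (lowE bC).
have fLE : mfin (low s `\` E) by exact: (mfinD (mfin_slab bC _ _) mE).
have h1 : vol (low s') <= vol G + mu ^+ n.+1 * vol (low s `\` E).
  rewrite -(vol_aff c _ mu0); have fa := mfin_aff c mu0 fLE.
  exact: le_trans (vol_le (mfinU fG fa) cov) (volU_le fG fa).
have zs := le_trans zh hs.
have ss' : s <= s' by rewrite /s' lerDl ltW.
have h2 := low_split bC zs ss'.
have h3 : 4 * m <= vol (slab s s').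
  apply: le_trans (vol_slab_ge bC s l0 l1).
  apply: (@le_trans _ _ (l / 2 * (A / 2))).
    rewrite (_ : l / 2 * (A / 2) = 4 * m)//; rewrite /l; field; exact: lt0r_neq0.
  by apply: ler_wpM2l => //; rewrite divr_ge0// ltW.
have h4 := volID (mfin_slab bC (zb - 1) s) mE.
have h5 := vol_low_upper bC s fE EC; rewrite -/m setIC in h5.
have h6 := low_split bC zh hs.
have h7 : vol (slab h s) <= A.
  by apply: le_trans (vol_slab_lin bC hs) _; rewrite ler_piMr// ?(ltW A0)//; lra.
rewrite -eh in h5 *.
have M1 : 1 <= mu ^+ n.+1 by rewrite exprn_ege1// ltW.
apply: (dilation_gain M1 mu2 muA h3 (vol_ge0 (slab h s)) h7 (ltW m0)); rewrite -h6 -h2.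
rewrite (_ : vol (slab h s) + m = vol (low s `\` E)) => [|]; first exact: h1.
by move: h4 h5 h6; move: (vol _) (vol _) (vol _) (vol _) (vol _) => *; lra.
Qed.

End dilation.

Section vanish.
Context {R : realType} {n : nat}.
Local Notation V := 'rV[R]_n.+1.
Context {C : set V} {zb hb : R} {c0 : V} (bC : body C zb hb c0).
Local Notation A := (@slab_sup R n C).
Local Notation slab := (slab C).
Local Notation upper := (@upper R n C).
Local Notation low := (slab (zb - 1)).
Local Notation d := (@cell_diam R n zb hb c0).
Local Notation v0 := (@cell_vol R n C c0).
Local Notation base := (@base R n c0).
Implicit Types (x y v w : V) (E F U D : set V).

Let oI : open C° := open_interior C.

Lemma aff_center_interior mu x : 1 <= mu -> C° (aff ((1 - mu) *: c0) mu x) -> C° x.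
Proof.
move=> mu1; have mu0 : 0 < mu by exact: lt_le_trans mu1.
set y := aff _ _ _ => Cy.
have -> : x = (1 - mu^-1) *: c0 + mu^-1 *: y.
  by apply/rowP => i; rewrite /y /aff !mxE; field; rewrite gt_eqF.
apply: (cvx_interior_cvx (body_cvx bC)) => //; first exact: (body_int bC).
  by rewrite invr_ge0 ltW.
by rewrite invf_le1.
Qed.

(** For [E] against its dilated lower part: the perimeter [q] below the cut occurs on both sides and
    cancels up to (M - 1) q, at most m, which leaves m + 2 k for the perimeter [p] above. *)
Let excess_bound (q p M M1 k a m : R) : 0 <= q -> q <= a -> 1 <= M -> M <= M1 -> M1 <= 2 ->
  (M1 - 1) * a <= m -> 0 <= k -> q + p <= M * (q + k) -> p <= m + 2 * k.
Proof.
move=> q0 qa M1' MM M2 Ma k0 h.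
have : (M - 1) * q <= (M1 - 1) * a by apply: ler_pM => //; lra.
have : M * k <= 2 * k by rewrite ler_wpM2r//; lra.
lra.
Qed.

(** With m = s sn, the isoperimetric inequality reads m <= s kp (m + 2 k); when 2 kp s <= 1 half of
    the left side absorbs the m on the right. *)
Let absorb (s sn kp k : R) : 0 < s -> 0 <= sn -> 0 < kp -> 2 * kp * s <= 1 ->
  s * sn <= s * (kp * (s * sn + 2 * k)) -> sn <= 4 * kp * k.
Proof.
move=> s0 sn0 kp0 ks; rewrite ler_pM2l// => h.
have : 2 * kp * s * sn <= 1 * sn by rewrite ler_wpM2r.
lra.
Qed.

Lemma upper_vanish ep : (0 < n)%N -> 0 < ep -> ep <= 1 -> exists v1 : R, forall E h,
  isoperimetric_region C E -> v1 < vol E -> vol (low h) = vol E ->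
  vol (E `&` upper (h + ep)) = 0.
Proof.
move=> n0 ep0 ep1; have [kp kp0 [htail _]] := layers_iso bC n0.
have A0 := slab_sup_gt0 bC; have v00 := cell_vol_gt0 bC; have zc := zb_c0 bC.
have N0 : (0 : R) < n.+1%:R by rewrite ltr0n.
have nk0 : 0 < 4 * n.+1%:R * (4 * kp) by rewrite !mulr_gt0.
(* The entry with ep makes the volume die out within ep / 2 in [decay]; 1 / (2 kp) is for [absorb],
   v0 / 2 for the cells and A / 16 for [dilation_volume]. *)
pose t := Num.min (Num.min 1 (ep / 2 / (4 * n.+1%:R * (4 * kp)))) (Num.min (1 / (2 * kp)) (Num.min (v0 / 2) (A / 16))).
have t0 : 0 < t by rewrite !lt_min ltr01 !divr_gt0// ?mulr_gt0.
have t1 : t <= 1 by rewrite !ge_min lexx.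
have tep : 4 * n.+1%:R * (4 * kp) * t <= ep / 2.
  by rewrite mulrC -ler_pdivlMr// !ge_min lexx ?orbT.
have tk : 2 * kp * t <= 1 by rewrite mulrC -ler_pdivlMr ?mulr_gt0// !ge_min lexx ?orbT.
have tv : 2 * t <= v0 by rewrite mulrC -ler_pdivlMr// !ge_min lexx ?orbT.
have tA : t <= A / 16 by rewrite !ge_min lexx ?orbT.
have tN : t ^+ n.+1 <= t by rewrite ler_iXnr// ltW.
have [a1 ha1] := slab_sup_lim bC (divr_gt0 A0 (ltr0n R 2)).
have [v1 hv1] := small_defect bC n0 (exprn_gt0 n.+1 t0).
have [v2 v20 hv2] := low_unbounded bC (Num.max (a1 + 1) (Num.max (vert c0 + 32 * n.+1%:R) base)).
exists (Num.max v1 v2) => E h iE; rewrite gt_max => /andP[l1 l2] eh.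
have [mE EC _ _] := iE.
have fE : mfin E by case: iE => _ _ fE _; split => //; rewrite ltey_eq fE.
have pE := isoperimetric_pb bC iE.
have := hv2 h; rewrite eh => /(_ l2); rewrite !gt_max => /and3P[h1 h2 h3].
have zh : zb - 1 <= h by move: h3; rewrite /base; lra.
pose m s := vol (E `&` upper s).
have m0 s : 0 <= m s by exact: vol_ge0.
have mh : m h <= t ^+ n.+1 by apply: hv1.
have mono s s' : h <= s -> s <= s' -> s' <= h + ep -> m s' <= m s.
  move=> _ ss _; apply: vol_le; first exact: (mfinI fE (measurable_upper _)).
  by move=> x [Ex [Cx /= hx]]; split => //; split => //=; exact: le_lt_trans ss hx.
have sg s : h <= s -> s <= h + ep -> rootn n.+1 (m s) <= t.
  move=> s1 s2; rewrite -(@ler_pXn2r _ n.+1)// ?nnegrE ?rootn_ge0 ?(ltW t0)// rootnK//.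
  by apply: le_trans mh; exact: mono.
apply/eqP; rewrite eq_le vol_ge0 andbT leNgt; apply/negP => mb.
have hk0 : 0 < 4 * kp by rewrite mulr_gt0.
have heh : h <= h + ep by rewrite lerDl ltW.
suff key : forall s k, h < s -> s <= h + ep -> 0 < m s -> 0 <= k ->
    (forall d0, 0 < d0 -> exists d, [/\ 0 < d, d <= d0 & m (s - d) - m s <= k * d]) ->
    rootn n.+1 (m s) ^+ n <= 4 * kp * k.
  have := decay hk0 heh m0 mono key mb; rewrite [leLHS]addrC addKr leNgt => /negP; apply.
  apply: (@le_lt_trans _ _ (ep / 2)); last by rewrite ltr_pdivrMr// mulr_natr mulr2n ltrDr.
  by apply: le_trans tep; rewrite ler_pM2l//; exact: sg.
move=> s k hs sh ms k0 hd.
have hs' := ltW hs.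
pose U1 := C° `&` [set x : V | 1 * vert x < s].
have sU1 : U1 `<=` C° by move=> x [].
have sU2 : upper s `<=` C° by move=> x [].
have pU1 : pb U1 E (Per U1 E) by apply: Per_pb (pbW sU1 pE).
have hcut : forall d0, 0 < d0 -> exists d, [/\ 0 < d, d <= d0,
     mfin (C° `&` E `&` [set x | s - d <= 1 * vert x < s]) &
     vol (C° `&` E `&` [set x | s - d <= 1 * vert x < s]) <= k * d].
  move=> d0 d00; have [dd [q1 q2 q3]] := hd d0 d00.
  have [fL vL] := layer_above (C := C) s fE q1.
  by exists dd; split => //; exact: le_trans q3.
have pF := cut_perimeter (or_introl erefl) oI mE pU1 k0 hcut.
have ms16 : m s <= A / 16.
  apply: le_trans tA; apply: le_trans tN; apply: le_trans mh; exact: mono.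
have hslab : A / 2 <= vol (slab (s - 1) s).
  by have := ha1 (s - 1); rewrite subrK => /(_ ltac:(lra)); lra.
have sS : 32 * n.+1%:R <= s - vert c0 by lra.
have sh1 : s <= h + 1 by lra.
have := dilation_volume bC fE EC eh hs' sh1 zh hslab ms ms16 sS.
set mu := 1 + _; set G := _ `&` C => -[mu1 muA mu2 fG vG].
have pG : pb C° G (mu ^+ n * (Per U1 E + k)).
  apply: pb_restrict; first exact: interior_subset.
  apply: pb_aff => //; first exact: lt_trans mu1.
    by apply: measurableI => //; exact/open_lebesgue_measurable/open_kvert.
  by move=> x; apply: aff_center_interior; exact: ltW.
have pE2 := isoperimetric_le bC iE fG (@subIsetr _ _ C) vG pG.
have disj : U1 `&` upper s = set0.
  by apply/seteqP; split => // x [[_ /= q1] [_ /= q2]]; rewrite mul1r in q1; have := lt_trans q1 q2; rewrite ltxx.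
have pS := Per_super mE sU1 sU2 disj pE2.
have mu1' : 1 <= mu := ltW mu1.
have pU2 : Per (upper s) E <= m s + 2 * k.
  apply: (excess_bound _ _ _ _ mu2 muA k0 pS); first exact: (Per_ge0 mE pU1).
  - exact: (Per_le (pbW sU1 pE)).
  - exact: exprn_ege1.
  - by rewrite ler_eXn2l.
have pU : pb (upper s) E (m s + 2 * k).
  by move=> xi ux; apply: le_trans pU2; apply: (Per_pb (pbW sU2 pE)).
have rK : rootn n.+1 (m s) ^+ n.+1 = m s by exact: rootnK.
have := htail E s (m s + 2 * k) (rootn n.+1 (m s)) fE EC _ pU (rootn_ge0 _ _).
rewrite rK => /(_ (le_trans (ltW h3) hs')).
have ht2 : 2 * m s <= v0.
  by apply: le_trans tv; rewrite ler_pM2l//; apply: le_trans tN; apply: le_trans mh; exact: mono.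
move=> /(_ ht2) H.
apply: (absorb (rootn_gt0 n ms)) => //; first by rewrite exprn_ge0// rootn_ge0.
  by apply: le_trans tk; rewrite ler_pM2l ?mulr_gt0//; exact: sg.
rewrite -exprS rK; apply: H => a sa; apply: vol_le.
  exact: (mfinI fE (measurable_upper _)).
by move=> x [Ex [Cx /= /andP[q1 _]]]; split => //; split => //=; exact: le_lt_trans q1.
Qed.

End vanish.

Section vanish_below.
Context {R : realType} {n : nat}.
Local Notation V := 'rV[R]_n.+1.
Context {C : set V} {zb hb : R} {c0 : V} (bC : body C zb hb c0).
Local Notation slab := (slab C).
Local Notation upper := (@upper R n C).
Local Notation low := (slab (zb - 1)).
Local Notation d := (@cell_diam R n zb hb c0).
Local Notation v0 := (@cell_vol R n C c0).
Local Notation base := (@base R n c0).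
Implicit Types (x y v w : V) (E F U D : set V).

Let oI : open C° := open_interior C.

Lemma low_mono s t : s <= t -> low s `<=` low t.
Proof. by move=> st x [Cx /= /andP[h1 h2]]; split => //; rewrite /= /Z /= h1 (lt_le_trans h2). Qed.

Let cancel_factor (s sn kp k : R) : 0 < s -> s * sn <= s * (kp * k) -> sn <= kp * k.
Proof. by move=> s0; rewrite ler_pM2l. Qed.

Lemma lower_vanish ep : (0 < n)%N -> 0 < ep -> ep <= 1 -> exists v1 : R, forall E h,
  isoperimetric_region C E -> v1 < vol E -> vol (low h) = vol E ->
  vol (low (h - ep) `\` E) = 0.
Proof.
move=> n0 ep0 ep1; have [kp kp0 [_ hlow]] := layers_iso bC n0.
have v00 := cell_vol_gt0 bC; have zc := zb_c0 bC.
have nk0 : 0 < 4 * n.+1%:R * kp by rewrite !mulr_gt0// ltr0n.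
pose t := Num.min (Num.min 1 (ep / 2 / (4 * n.+1%:R * kp))) (v0 / 2).
have t0 : 0 < t by rewrite !lt_min ltr01 !divr_gt0.
have t1 : t <= 1 by rewrite !ge_min lexx.
have tep : 4 * n.+1%:R * kp * t <= ep / 2.
  by rewrite mulrC -ler_pdivlMr// !ge_min lexx ?orbT.
have tv : 2 * t <= v0 by rewrite mulrC -ler_pdivlMr// !ge_min lexx ?orbT.
have tN : t ^+ n.+1 <= t by rewrite ler_iXnr// ltW.
have [v1 hv1] := small_defect bC n0 (exprn_gt0 n.+1 t0).
have [v2 v20 hv2] := low_unbounded bC (base + 1).
exists (Num.max v1 v2) => E h iE; rewrite gt_max => /andP[l1 l2] eh.
have [mE EC _ _] := iE.
have fE : mfin E by case: iE => _ _ fE _; split => //; rewrite ltey_eq fE.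
have pE := isoperimetric_pb bC iE.
have hb0 : base + 1 < h by apply: hv2; rewrite eh.
(* The height is reversed, u = - s, because [decay] wants a nonincreasing function. *)
pose m u := vol (low (- u) `\` E).
have m0 u : 0 <= m u by exact: vol_ge0.
have fL s : mfin (low s `\` E) by exact: (mfinD (mfin_slab bC _ _) mE).
have mh : m (- h) <= t ^+ n.+1 by rewrite /m opprK (vol_defect bC fE EC eh); exact: hv1.
have mono u u' : - h <= u -> u <= u' -> u' <= - h + ep -> m u' <= m u.
  move=> _ uu _; apply: vol_le => //; apply: setSD; apply: low_mono; by rewrite lerN2.
have sg u : - h <= u -> u <= - h + ep -> rootn n.+1 (m u) <= t.
  move=> u1 u2; rewrite -(@ler_pXn2r _ n.+1)// ?nnegrE ?rootn_ge0 ?(ltW t0)// rootnK//.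
  by apply: le_trans mh; exact: mono.
apply/eqP; rewrite eq_le vol_ge0 andbT leNgt; apply/negP => mb.
have {}mb : 0 < m (- h + ep) by rewrite /m opprD opprK.
have heh : - h <= - h + ep by rewrite lerDl ltW.
suff key : forall u k, - h < u -> u <= - h + ep -> 0 < m u -> 0 <= k ->
    (forall d0, 0 < d0 -> exists d, [/\ 0 < d, d <= d0 & m (u - d) - m u <= k * d]) ->
    rootn n.+1 (m u) ^+ n <= kp * k.
  have := decay kp0 heh m0 mono key mb; rewrite [leLHS]addrC addKr leNgt => /negP; apply.
  apply: (@le_lt_trans _ _ (ep / 2)); last by rewrite ltr_pdivrMr// mulr_natr mulr2n ltrDr.
  by apply: le_trans tep; rewrite ler_pM2l//; exact: sg.
move=> u k hu uh mu k0 hd.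
have hu' := ltW hu.
pose s := - u.
have sh : s < h by rewrite ltrNl.
have bs : base <= s by rewrite /s; lra.
pose U1 := C° `&` [set x : V | -1 * vert x < - s].
have sU1 : U1 `<=` C° by move=> x [].
have sU2 : low s `<=` C° by move=> x [].
have pU1 : pb U1 E (Per U1 E) by apply: Per_pb (pbW sU1 pE).
have mC := body_measurable bC.
have mCE : lebesgue_measurable (C `\` E) by exact: measurableD.
have sU1C : U1 `<=` C by move=> x [/interior_subset].
have pU1' : pb U1 (C `\` E) (Per U1 E) := pb_compl mC mE EC sU1C pU1.
have hcut : forall d0, 0 < d0 -> exists d, [/\ 0 < d, d <= d0,
     mfin (C° `&` (C `\` E) `&` [set x | - s - d <= -1 * vert x < - s]) &
     vol (C° `&` (C `\` E) `&` [set x | - s - d <= -1 * vert x < - s]) <= k * d].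
  move=> d0 d00; have [dd [q1 q2 q3]] := hd d0 d00.
  have [fL' vL] := layer_below bC s mE q1.
  exists dd; split => //; apply: le_trans vL _; apply: le_trans q3.
  by rewrite /m /s opprB [dd - u]addrC.
have pF := cut_perimeter (or_intror erefl) oI mCE pU1' k0 hcut.
(* The holes of [E] above [s]. The competitor is the complement of [H] in [C], that is [E] filled up
   to [s]; it contains [E], so no volume has to be restored. *)
pose H := (C `\` E) `&` [set x : V | -1 * vert x < - s].
have mH : lebesgue_measurable H.
  by apply: measurableI => //; exact/open_lebesgue_measurable/open_kvert.
have HC : H `<=` C by move=> x [[]].
have pG := pb_compl mC mH HC (@interior_subset _ C) pF.
have GE : C `\` H `<=` E `|` (C `&` [set x | vert x <= s]).
  move=> x [Cx nH]; have [Ex|nEx] := pselect (E x); [by left|right; split => //=].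
  by rewrite leNgt; apply/negP => h'; apply: nH; split => //=; rewrite mulN1r ltrN2.
have fG : mfin (C `\` H).
  apply: (mfinS (mfinU fE (_ : mfin (C `&` [set x | vert x <= s])))) => //; last exact: measurableD.
  by apply: (mfin_below bC (b := s)) => [|x []|x []]//; apply: measurableI => //; exact: measurable_vert_le.
have vG : vol E <= vol (C `\` H).
  by apply: vol_le => // x Ex; split; [exact: EC|move=> [[_]]].
have pE2 := isoperimetric_le bC iE fG (@subDsetl _ C H) vG pG.
have disj : U1 `&` low s = set0.
  apply/seteqP; split => // x [[_ /= q1] [_ /= /andP[_ q2]]].
  by rewrite mulN1r ltrN2 in q1; have := lt_trans q1 q2; rewrite ltxx.
have pS := Per_super mE sU1 sU2 disj pE2.
rewrite lerD2l in pS.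
have pU : pb (low s) E k.
  by move=> xi ux; apply: le_trans pS; apply: (Per_pb (pbW sU2 pE)).
have rK : rootn n.+1 (m u) ^+ n.+1 = m u by exact: rootnK.
have := hlow E s k (rootn n.+1 (m u)) mE bs pU (rootn_ge0 _ _).
rewrite rK.
have ht2 : 2 * m u <= v0.
  by apply: le_trans tv; rewrite ler_pM2l//; apply: le_trans tN; apply: le_trans mh; exact: mono.
move=> /(_ ht2) H'.
apply: (cancel_factor (rootn_gt0 n mu)).
rewrite -exprS rK; apply: H' => a b ab bsle _; apply: vol_le; first exact: fL.
apply: setSD => x [Cx /= /andP[_ q2]]; rewrite (lowE bC); split => //=.
exact: lt_le_trans bsle.
Qed.

End vanish_below.

(** * Hausdorff convergence *)

Section density.
Context {R : realType} {n : nat}.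
Local Notation V := 'rV[R]_n.+1.
Local Notation lm := (@lebesgue R n).
Implicit Types (x y v w : V) (E F U D : set V).

Lemma enorm_dist_continuous x : continuous (fun y : V => enorm (y - x)).
Proof.
rewrite /enorm; apply: (@cont_comp _ _ _ (fun y : V => dot (y - x) (y - x))); last exact: sqrt_continuous.
rewrite /dot; have h i : continuous (fun y : V => (y - x) 0 i * (y - x) 0 i).
  have hc : continuous (fun y : V => (y - x) 0 i).
    rewrite (_ : (fun y => _) = (fun y : V => y 0 i - x 0 i)); last by apply/funext => y; rewrite !mxE.
    by apply: contB; [exact: coord_continuous|exact: cont_cst].
  exact: contM.
move=> y; apply: (@cvg_sum_seq R V _ (index_enum 'I_n.+1) (fun i z => (z - x) 0 i * (z - x) 0 i) _ (nbhs y)).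
by move=> i; exact: h.
Qed.

Lemma open_eball x (r : R) : open (eball x r).
Proof.
rewrite /eball (_ : [set y | _] = (fun y => enorm (y - x)) @^-1` [set t | t < r])//.
by apply: open_comp; [move=> y _; exact: enorm_dist_continuous|exact: open_lt].
Qed.

Lemma eball_sub_cube x (r : R) : eball x r `<=` cube x r.
Proof.
move=> y /= h i; apply: le_lt_trans h; apply: le_trans (coord_le_enorm (y - x) i).
by rewrite !mxE.
Qed.

Lemma mfin_eball x (r : R) : mfin (eball x r).
Proof.
apply: (@mfinS _ _ (ccube x r)); first by apply: mfin_compact; exact: compact_ccube.
  exact/open_lebesgue_measurable/open_eball.
by move=> y /eball_sub_cube h i; exact: ltW.
Qed.

Lemma nullU (E F : set V) : lm E = 0%E -> lm F = 0%E -> lm (E `|` F) = 0%E.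
Proof.
move=> E0 F0; have [fE vE] := mfin_null (null_measurable E0) E0.
have [fF vF] := mfin_null (null_measurable F0) F0.
apply: vol_null; last exact: mfinU.
by apply/eqP; rewrite eq_le vol_ge0 andbT (le_trans (volU_le fE fF))// vE vF addr0.
Qed.

Lemma has_density_near E x (r0 c : R) : 0 < r0 ->
  (forall r, 0 < r -> r < r0 -> vol (E `&` eball x r) = c * vol (eball x r)) -> has_density E x c.
Proof.
move=> r00 h; apply: cvg_near_cst; near=> r.
have rp : 0 < r by near: r; exact: nbhs_right_gt.
have rr : r < r0 by near: r; exact: nbhs_right_lt.
have hv : 0 < vol (eball x r).
  apply: vol_gt0; [exact: mfin_eball|exact: open_eball|exists x].
  by rewrite /eball /= subrr enorm0.
by rewrite -/(vol _) -/(vol (eball x r)) h// mulfK// gt_eqF.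
Unshelve. all: by end_near. Qed.

Lemma null_density0 E U x : open U -> U x -> lm (E `&` U) = 0%E -> has_density E x 0.
Proof.
move=> oU Ux h; have /nbhs_cubeP[r0 r00 hr] : nbhs x U by exact: open_nbhs_nbhs.
apply: (has_density_near r00) => r _ rr; rewrite mul0r.
have e : lm (E `&` eball x r) = 0%E.
  apply: nullS h => y [Ey /eball_sub_cube hy]; split => //; apply: hr => i.
  exact: lt_trans (hy i) rr.
by rewrite /vol e.
Qed.

Lemma full_density1 E U x : lebesgue_measurable E -> open U -> U x -> lm (U `\` E) = 0%E -> has_density E x 1.
Proof.
move=> mE oU Ux h; have /nbhs_cubeP[r0 r00 hr] : nbhs x U by exact: open_nbhs_nbhs.
apply: (has_density_near r00) => r _ rr; rewrite mul1r.
have fB := mfin_eball x r; symmetry; apply: vol_diff_null => //.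
  by apply: measurableI => //; case: fB.
apply: nullS h => y [hy ny]; split; last by move=> Ey; apply: ny.
apply: hr => i; exact: lt_trans (eball_sub_cube hy i) rr.
Qed.

End density.

Section stabilize.
Context {R : realType} {n : nat}.
Local Notation V := 'rV[R]_n.+1.
Context {C : set V} {zb hb : R} {c0 : V} (bC : body C zb hb c0).
Local Notation low := (slab C (zb - 1)).
Implicit Types (x y v w : V) (E F U D : set V).

(** Normalization turns null sets into empty ones: a point of [E] above h + ep would have density 0,
    and a point of [C] below h - ep is a limit of interior points of density 1, all in the closed
    set [E]. *)
Lemma flat_top ep T : (0 < n)%N -> 0 < ep -> ep <= 1 -> exists v1 : R, forall E h,
  isoperimetric_region C E -> normalized E -> v1 < vol E -> vol (low h) = vol E ->
  [/\ T < h, forall x, E x -> vert x <= h + ep &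
      forall x, C x -> vert x < h - ep -> E x].
Proof.
move=> n0 e0 e1; have [v1 hv1] := upper_vanish bC n0 e0 e1.
have [v2 hv2] := lower_vanish bC n0 e0 e1.
have [v3 v30 hv3] := low_unbounded bC T.
exists (Num.max v1 (Num.max v2 v3)) => E h iE [clE E1 E0]; rewrite !gt_max => /and3P[l1 l2 l3] eh.
have [mE EC _ _] := iE.
have fE : mfin E by case: iE => _ _ fE _; split => //; rewrite ltey_eq fE.
split; first by apply: hv3; rewrite eh.
  move=> x Ex; rewrite leNgt; apply/negP => hx.
  have : (E `&` [set x | has_density E x 0]) x.
    split => //=.
    have oU : open [set x : V | -1 * vert x < - (h + ep)] by exact: open_kvert.
    apply: (null_density0 oU); first by rewrite /= mulN1r ltrN2.
    have h1 := vol_null (hv1 E h iE l1 eh) (mfinI fE (measurable_upper _)).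
    apply: nullS (nullU h1 (boundary_null bC)) => y [Ey /=]; rewrite mulN1r ltrN2 => hy.
      by have [Iy|nI] := pselect (C° y); [left|right; split => //; exact: EC].
  by rewrite E0.
move=> x Cx hx.
apply: clE => B nB.
have nB2 : nbhs x (B `&` [set x : V | 1 * vert x < h - ep]).
  apply: filterI => //; apply: open_nbhs_nbhs; split; first exact: open_kvert.
  by rewrite /= mul1r.
have [y [Iy [By /= hy]]] := cvx_closure_interior (body_cvx bC) (body_int bC) Cx nB2.
exists y; split => //; apply: E1 => /=.
rewrite mul1r in hy.
apply: (full_density1 mE (open_slab (C := C) (a := zb - 1) (b := h - ep))).
  by rewrite (lowE bC).
by apply: vol_null; [exact: hv2|exact: (mfinD (mfin_slab bC _ _) mE)].
Qed.

End stabilize.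

(** * Inclusions between thickenings *)

Section slab_limit.
Context {R : realType} {n : nat}.
Local Notation V := 'rV[R]_n.+1.
Context {C : set V} {zb hb : R} {c0 : V} (bC : body C zb hb c0).
Local Notation K := (asymptotic_base C).
Implicit Types (x y v w p : V) (E F U D : set V).

Lemma horiz_vert x (c : R) : horiz (x + c *: e_vert) = horiz x.
Proof.
apply/rowP => j; rewrite !mxE (_ : (widen_ord _ j == ord_max) = false) ?andbF ?mulr0 ?addr0//.
by apply/eqP => /(congr1 val) /= e; have := ltn_ord j; rewrite e ltnn.
Qed.

Lemma coord_cases (P : 'I_n.+1 -> Prop) :
  P ord_max -> (forall j : 'I_n, P (widen_ord (leqnSn n) j)) -> forall i, P i.
Proof.
move=> Pm Pw i; have [->//|im] := eqVneq i ord_max.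
have iN : (i < n)%N.
  by have := ltn_ord i; rewrite ltnS leq_eqVlt => /predU1P[e|//]; case/eqP: im; exact/val_inj.
by rewrite (_ : i = widen_ord (leqnSn n) (Ordinal iN)) //; exact: val_inj.
Qed.

Lemma enorm_split x y (M : R) : 0 <= M -> (forall j, `|horiz x 0 j - horiz y 0 j| <= M) ->
  `|vert x - vert y| <= M -> enorm (x - y) <= n.+1%:R * M.
Proof.
move=> M0 hj hv; apply: enorm_le_coord => //; apply: coord_cases; first by rewrite !mxE.
by move=> j; have := hj j; rewrite !mxE.
Qed.

Lemma truncated_translationE (t : R) E x :
  truncated_translation t E x <-> E (x + t *: e_vert) /\ 0 <= vert x.
Proof.
split=> [[[y Ey <-] h]|[Ex h]]; first by rewrite addrAC addNr add0r.
by split => //; exists (x + t *: e_vert) => //; rewrite addrC addrK.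
Qed.

Lemma compact_base : compact K.
Proof.
have cB : compact [set v : 'rV[R]_n | forall i, `[- hb, hb]%classic (v ord0 i)].
  by have := @rV_compact R n (fun=> `[- hb, hb]%classic); apply => i; exact: segment_compact.
apply: (subclosed_compact _ cB); first exact: closed_closure.
have clB := compact_closed (@norm_hausdorff _ _) cB.
rewrite [X in _ `<=` X](proj1 (closure_id _) clB); apply: closureS => _ [x Cx <-] j.
have im : widen_ord (leqnSn n) j != ord_max.
  by apply/eqP => /(congr1 val) /= e; have := ltn_ord j; rewrite e ltnn.
by have := body_hor bC Cx im; rewrite /= in_itv/= mxE ler_norml.
Qed.

Lemma base_horiz x : C x -> K (horiz x).
Proof. by move=> Cx; apply: subset_closure; exists x. Qed.

Lemma cover_base e : 0 < e -> exists T, forall t, T <= t -> forall p, K (horiz p) ->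
  exists x, [/\ C° x, vert x = t & forall j, `|horiz x 0 j - horiz p 0 j| <= e].
Proof.
move=> e0; have /compact_near_coveringP cK := compact_base.
pose P (t : R) (q : 'rV[R]_n) := exists x, [/\ C° x, vert x = t & forall j, `|horiz x 0 j - q 0 j| <= e].
have e4 : 0 < e / 4 by rewrite divr_gt0.
have [] := cK R (pinfty_nbhs R) P _ _.
  move=> q Kq.
  have [_ [[x0 Cx0 <-] hx0]] := Kq _ (nbhsx_ballx q _ e4).
  have nB : nbhs x0 (cube x0 (e / 4)) by apply/nbhs_cubeP; exists (e / 4).
  have [x1 [Cx1 hx1]] := cvx_closure_interior (body_cvx bC) (body_int bC) Cx0 nB.
  exists (ball q (e / 4), [set t | vert x1 <= t]) => /=.
    split; first exact: nbhsx_ballx.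
    by exists (vert x1); split; [exact: num_real|move=> t /ltW].
  move=> [q' t] /= [hq ht]; exists (x1 + (t - vert x1) *: e_vert); split.
  - by apply: (body_up_int bC) => //; rewrite subr_ge0.
  - by rewrite vertD vertZ vert_e mulr1 addrC subrK.
  move=> j; rewrite horiz_vert.
  have a1 : `|horiz x1 0 j - horiz x0 0 j| <= e / 4 by have := hx1 (widen_ord (leqnSn n) j); rewrite !mxE => /ltW.
  have a2 : `|horiz x0 0 j - q 0 j| < e / 4 by have [_ /(_ 0 j)] := hx0; rewrite /ball /= distrC.
  have a3 : `|q 0 j - q' 0 j| < e / 4 by have [_ /(_ 0 j)] := hq.
  rewrite (_ : _ - _ = (horiz x1 0 j - horiz x0 0 j) + (horiz x0 0 j - q 0 j) + (q 0 j - q' 0 j)); last by ring.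
  apply: le_trans (ler_normD _ _) _; apply: le_trans (lerD (ler_normD _ _) (lexx _)) _.
  move: a1 a2 a3; move: `|_| `|_| `|_| => *; lra.
move=> M [_ hM]; exists (M + 1) => t tM p Kp.
by apply: (hM t) => //; apply: lt_le_trans tM; rewrite ltrDl.
Qed.

Section inclusions.
Variables (E : set V) (h ep T : R).
Hypotheses (EC : E `<=` C) (ep0 : 0 < ep) (ep1 : 4 * ep <= 1) (Th : T + 1 <= h).
Hypothesis hT : forall t, T <= t -> forall p, K (horiz p) ->
  exists x, [/\ C° x, vert x = t & forall j, `|horiz x 0 j - horiz p 0 j| <= ep].
Hypothesis E_top : forall x, E x -> vert x <= h + ep.
Hypothesis E_full : forall x, C x -> vert x < h - ep -> E x.

(** The top of the translated region is then near height 1, whatever [h] is. *)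
Let t := h - 1.
Let Om := truncated_translation t E.
Let Ct := truncated_translation t C.
(** Displacements are bounded by 2 ep in each coordinate; the factor n + 1 passes to the Euclidean
    norm. *)
Let r := n.+1%:R * (2 * ep).

Let ep20 : 0 <= 2 * ep. Proof. by rewrite mulr_ge0 // ltW. Qed.

Let vert_shift x c : vert (x + c *: e_vert) = vert x + c.
Proof. by rewrite vertD vertZ vert_e mulr1. Qed.

Let OmP x : Om x <-> E (x + t *: e_vert) /\ 0 <= vert x := truncated_translationE t E x.
Let CtP x : Ct x <-> C (x + t *: e_vert) /\ 0 <= vert x := truncated_translationE t C x.

Let near_pt x p : (forall j, `|horiz x 0 j - horiz p 0 j| <= ep) -> `|vert x - vert p| <= 2 * ep ->
  enorm (x - p) <= r.
Proof.
move=> hj hv; apply: enorm_split => // j; apply: le_trans (hj j) _.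
by rewrite ler_peMl ?(ltW ep0)// ler1n.
Qed.

Let near_vert x c : `|c| <= 2 * ep -> enorm (x - (x + c *: e_vert)) <= r.
Proof.
move=> hc; apply: near_pt => [j|]; first by rewrite horiz_vert subrr normr0 ltW.
by rewrite vert_shift opprD addNKr normrN.
Qed.

Lemma truncated_sub_slab : Om `<=` thickening (cylinder K `[0, 1]) r.
Proof.
move=> x /OmP[Ex x0]; have h1 := E_top Ex; rewrite vert_shift in h1.
exists (x + (Num.min (vert x) 1 - vert x) *: e_vert).
  split; first by rewrite horiz_vert -(horiz_vert x t); apply: base_horiz; exact: EC.
  rewrite vert_shift addrC subrK /= in_itv/= ge_min lexx orbT andbT.
  by rewrite le_min x0 ler01.
apply: near_vert; have [h2|h2] := leP (vert x) 1; first by rewrite subrr normr0.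
by rewrite ler_norml; apply/andP; split; move: h1 ep0; rewrite /t; lra.
Qed.

Lemma slab_sub_truncated : cylinder K `[0, 1] `<=` thickening Om r.
Proof.
move=> p [Kp]; rewrite /= in_itv/= => /andP[p0 p1].
(* Lowered so as to be strictly below 1 - ep, the level up to which [E_full] applies. *)
pose s := Num.min (vert p) (1 - 2 * ep).
have s0 : 0 <= s by rewrite le_min p0; move: ep1; lra.
have s1 : s <= 1 - 2 * ep by rewrite ge_min lexx orbT.
have sp : `|vert p - s| <= 2 * ep.
  rewrite /s; have [h2|h2] := leP (vert p) (1 - 2 * ep); first by rewrite subrr normr0.
  by rewrite ger0_norm; lra.
have [|x [Cx vx hx]] := @hT (s + t) _ p Kp; first by move: s0 Th; rewrite /t; lra.
exists (x + (- t) *: e_vert).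
  apply/OmP; rewrite scaleNr subrK -scaleNr vert_shift vx addrK; split => //.
  apply: E_full; first exact: interior_subset.
  by rewrite vx; move: s1 ep0; rewrite /t; lra.
rewrite -enormN opprB; apply: near_pt => [j|]; first by rewrite horiz_vert.
by rewrite vert_shift vx addrK distrC.
Qed.

(** Above 1 + ep a whole neighbourhood misses [Om]; below 1 - ep an interior point of [Ct] is
    interior to [Om]. *)
Lemma boundary_sub_top : boundary Om `&` Ct° `<=`
  [set x | K (horiz x) /\ `|vert x - 1| <= ep].
Proof.
move=> y [[clO nO] Cy]; have /CtP[Cy' y0] := interior_subset Cy; split.
  by rewrite -(horiz_vert y t); exact: base_horiz.
have y1 : vert y <= 1 + ep.
  rewrite leNgt; apply/negP => hy.
  have nU : nbhs y [set z : V | -1 * vert z < - (1 + ep)].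
    apply: open_nbhs_nbhs; split; first exact: open_kvert.
    by rewrite /= mulN1r ltrN2.
  have [z [/OmP[Ez _] /=]] := clO _ nU; rewrite mulN1r ltrN2.
  by have := E_top Ez; rewrite vert_shift /t; lra.
have y2 : 1 - ep <= vert y.
  rewrite leNgt; apply/negP => hy; apply: nO.
  have nU : nbhs y (Ct° `&` [set z : V | 1 * vert z < 1 - ep]).
    apply: open_nbhs_nbhs; split; first by apply: openI; [exact: open_interior|exact: open_kvert].
    by split => //=; rewrite mul1r.
  apply: filterS nU => z [/interior_subset/CtP[Cz z0] /=]; rewrite mul1r => hz.
  apply/OmP; split => //; apply: E_full => //; by rewrite vert_shift /t; lra.
by rewrite ler_norml; apply/andP; split; lra.
Qed.

Lemma free_boundary_sub_top : free_boundary Ct Om `<=` thickening (cylinder K [set 1]) r.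
Proof.
move=> x clx; have nc : nbhs x (cube x ep) by apply/nbhs_cubeP; exists ep.
have [y [/boundary_sub_top[Ky vy] xy]] := clx _ nc.
exists (y + (1 - vert y) *: e_vert).
  by split; rewrite ?horiz_vert// vert_shift addrC subrK.
apply: near_pt => [j|].
  have := xy (widen_ord (leqnSn n) j); rewrite horiz_vert !mxE distrC; exact: ltW.
rewrite vert_shift [vert y + _]addrC subrK.
have := xy ord_max; rewrite -!/(vert _) => hv.
rewrite (_ : vert x - 1 = (vert x - vert y) + (vert y - 1)); last by ring.
apply: le_trans (ler_normD _ _) _; move: hv; rewrite distrC.
by move: vy; move: `|_| `|_| => *; lra.
Qed.

(** On a vertical line through an interior point of [C], the height h - 2 ep is in [E] and heights
    above h + ep are not. The supremum of the points of [E] upwards from there is a boundary point,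
    and it stays interior to [Ct] because upward translations preserve the interior of [C]. *)
Lemma top_sub_free_boundary : cylinder K [set 1] `<=` thickening (free_boundary Ct Om) r.
Proof.
move=> p [Kp /= p1].
have [|x [Cx vx hx]] := @hT (h - 2 * ep) _ p Kp; first by move: ep1 Th; lra.
pose S := [set c | 0 <= c /\ E (x + c *: e_vert)].
have S0 : S 0.
  split => //; rewrite scale0r addr0; apply: E_full; first exact: interior_subset.
  by rewrite vx; move: ep0; lra.
have ubS : ubound S (3 * ep).
  by move=> c [cp /E_top]; rewrite vert_shift vx; lra.
have hS : has_sup S by split; [exists 0|exists (3 * ep)].
pose c := sup S.
have cp : 0 <= c by apply: ub_le_sup => //; exists (3 * ep).
have c3 : c <= 3 * ep by apply: ge_sup => //; exists 0.
pose y := x + c *: e_vert + (- t) *: e_vert.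
have vy : vert y = 1 - 2 * ep + c by rewrite !vert_shift vx /t; lra.
have yt s : y + s *: e_vert + t *: e_vert = x + (c + s) *: e_vert.
  by rewrite /y -!addrA -!scalerDl; congr (_ + _ *: _); ring.
have bO : boundary Om y.
  split.
    move=> B /nbhs_vert[k hk]; have k0 : 0 < k.+1%:R^-1 :> R by rewrite invr_gt0 ltr0n.
    have [s [s0 Es] cs] := sup_adherent k0 hS; rewrite -/c in cs.
    have sc : s <= c by apply: ub_le_sup => //; exists (3 * ep).
    exists (y + (s - c) *: e_vert); split.
      apply/OmP; rewrite yt [c + _]addrC subrK; split => //.
      by rewrite vert_shift vy; move: ep1 s0; lra.
    by apply: hk; rewrite ler_norml lerBlDr lerBrDr; move: cs sc k0; move: (_^-1) => q *; apply/andP; split; lra.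
  move=> /nbhs_vert[k hk]; have k0 : 0 < k.+1%:R^-1 :> R by rewrite invr_gt0 ltr0n.
  have := hk k.+1%:R^-1; rewrite ger0_norm ?(ltW k0)// => /(_ (lexx _))/OmP[Ey _].
  rewrite yt in Ey.
  have : c + k.+1%:R^-1 <= c.
    by apply: ub_le_sup; [exists (3 * ep)|split; [rewrite addr_ge0// ltW|]].
  by rewrite gerDl leNgt k0.
have CI : Ct° y.
  have nU : nbhs y ([set z | C° (z + t *: e_vert)] `&` [set z : V | -1 * vert z < 0]).
    apply: open_nbhs_nbhs; split.
      by apply: openI; [apply: open_shift; exact: open_interior|exact: open_kvert].
    split; last by rewrite /= mulN1r oppr_lt0 vy; move: ep1; lra.
    have := yt 0; rewrite scale0r !addr0 /= => ->; exact: (body_up_int bC).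
  apply: filterS nU => z [/interior_subset Cz /=]; rewrite mulN1r oppr_lt0 => z0.
  by apply/CtP; split => //; exact: ltW.
exists y; first by apply: subset_closure; split.
rewrite -enormN opprB; apply: near_pt => [j|].
  by rewrite /y !horiz_vert.
rewrite p1 vy ler_norml; apply/andP; split; lra.
Qed.

End inclusions.

End slab_limit.

Lemma hausdorff_cvg_thickening {R : realType} {n : nat} (A : nat -> set 'rV[R]_n.+1) B :
  (forall r, 0 < r -> \forall i \near \oo, A i `<=` thickening B r /\ B `<=` thickening (A i) r) ->
  hausdorff_cvg A B.
Proof.
move=> h.
have bound r : 0 < r -> \forall i \near \oo, (0 <= hausdorff_dist (A i) B <= r%:E)%E.
  move=> r0; apply: filterS (h r r0) => i [AB BA]; apply/andP; split.
    by apply: le_ereal_inf_tmp => _ [s [s0 _ _] <-]; rewrite lee_fin.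
  by apply: ereal_inf_lbound; exists r => //; split => //; exact: ltW.
apply/fine_cvgP; split.
  apply: filterS (bound 1 ltr01) => i /andP[h0 h1].
  by rewrite ge0_fin_numE//; apply: le_lt_trans h1 _; rewrite ltry.
apply/(@cvgrPdist_le R R^o nat \oo) => e e0; apply: filterS (bound e e0) => i /andP[h0 h1].
have hf : hausdorff_dist (A i) B \is a fin_num.
  by rewrite ge0_fin_numE//; apply: le_lt_trans h1 _; rewrite ltry.
rewrite /= sub0r normrN ger0_norm; first by rewrite -lee_fin fineK.
exact: fine_ge0.
Qed.

Theorem theorem4p13 (R : realType) (n : nat) (hn : (1 <= n)%N)
    (C : set 'rV[R]_n.+1)
    (hC : cylindrically_bounded_convex_body C)
    (hcoord : vertical_coordinates C)
    (E : nat -> set 'rV[R]_n.+1)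
    (hE : forall i, isoperimetric_region C (E i))
    (hEnorm : forall i, normalized (E i))
    (hvol : lebesgue (E i) @[i --> \oo] --> +oo%E) :
  let K := asymptotic_base C in
  exists (b : R) (t : nat -> R),
    let Omega i := truncated_translation (t i) (E i) in
    let C_ i := truncated_translation (t i) C in
    [/\ 0 < b,
        t i @[i --> \oo] --> +oo,
        hausdorff_cvg Omega (cylinder K `[0, b])
      & hausdorff_cvg (fun i => free_boundary (C_ i) (Omega i))
          (cylinder K [set b])].
Proof.
move=> K; have [zb [hb [c0 bC]]] := body_of hC hcoord.
have [h vh] := choice (fun i => low_height bC (vol_ge0 (E i))).
have fE i : mfin (E i).
  by case: (hE i) => mE _ fE _; split => //; rewrite ltey_eq fE.
have EC i : E i `<=` C by case: (hE i).
have large v1 : \forall i \near \oo, v1 < vol (E i).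
  have /cvgeyPgt/(_ v1) := hvol; apply: filterS => i.
  by rewrite (volE (fE i)) lte_fin.
have key r : 0 < r -> \forall i \near \oo,
    let Om := truncated_translation (h i - 1) (E i) in
    let FB := free_boundary (truncated_translation (h i - 1) C) Om in
    (Om `<=` thickening (cylinder K `[0, 1]) r /\
     cylinder K `[0, 1] `<=` thickening Om r) /\
    (FB `<=` thickening (cylinder K [set 1]) r /\
     cylinder K [set 1] `<=` thickening FB r).
  move=> r0; have N0 : (0 : R) < n.+1%:R by rewrite ltr0n.
  pose ep := Num.min (1 / 4) (r / (n.+1%:R * 2)).
  have ep0 : 0 < ep by rewrite lt_min !divr_gt0// mulr_gt0.
  have ep4 : 4 * ep <= 1 by rewrite mulrC -ler_pdivlMr// ge_min lexx.
  have epr : n.+1%:R * (2 * ep) <= r.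
    by rewrite mulrA mulrC -ler_pdivlMr ?mulr_gt0// ge_min lexx orbT.
  have ep1 : ep <= 1 by move: ep4 ep0; lra.
  have thick (A B : set 'rV[R]_n.+1) :
      A `<=` thickening B (n.+1%:R * (2 * ep)) -> A `<=` thickening B r.
    by move=> AB x /AB[y By xy]; exists y => //; exact: le_trans epr.
  have [T hT] := cover_base bC ep0.
  have [v1 hv1] := flat_top bC (T + 1) hn ep0 ep1.
  apply: filterS (large v1) => i hi.
  have [Th Etop Efull] := hv1 (E i) (h i) (hE i) (hEnorm i) hi (vh i).
  split; split; apply: thick.
  - exact: (truncated_sub_slab (EC i) ep0 Etop).
  - exact: (slab_sub_truncated ep0 ep4 (ltW Th) hT Efull).
  - exact: (free_boundary_sub_top ep0 Etop Efull).
  - exact: (top_sub_free_boundary bC ep0 ep4 (ltW Th) hT Etop Efull).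
(* The heights [h i] depend only on the volumes; subtracting 1 from each makes b = 1 for every
   sequence. *)
exists 1, (fun i => h i - 1); split.
- exact: ltr01.
- apply/cvgryPgt => M; have [v1 v10 hv1] := low_unbounded bC (M + 1).
  by apply: filterS (large v1) => i hi; rewrite ltrBrDr; apply: hv1; rewrite vh.
- by apply: hausdorff_cvg_thickening => r r0; apply: filterS (key r r0) => i [].
- by apply: hausdorff_cvg_thickening => r r0; apply: filterS (key r r0) => i [].
Qed.
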